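(* Let $\Lambda$ be a block with $|\Lambda|<\infty$. Then the generalised Khovanov algebra $H_\Lambda$ is a cellular algebra in the sense of Graham and Lehrer with cell datum $(\Lambda,M,C,* )$, where $\Lambda$ is partially ordered by the Bruhat order, $M(\lambda)=\{\alpha\in\Lambda^\circ\mid\alpha\subset\lambda\}$, $C^\lambda_{\alpha,\beta}=(\underline\alpha\lambda\overline\beta)$ for $\alpha,\beta\in M(\lambda)$, and $*$ is the linear map $(a\lambda b)\mapsto(b^*\lambda a^* )$ on $H_\Lambda$.
   Context: A number line carries vertices indexed by consecutive integers. A weight labels each vertex by $\circ,\times,\vee,\wedge$ with, outside a finite set of vertices, no $\vee$ to the left of an $\wedge$. Bruhat order: generated by declaring that interchanging a $\vee$ with an $\wedge$ to its right makes a weight bigger. Blocks: classes of weights related by permuting $\vee$'s and $\wedge$'s. Cup diagrams: finitely many non-crossing cups joining pairs of vertices plus rays down to infinity; cap diagrams similarly upward; $c^*$ = mirror image. $c\lambda$ is an oriented cup diagram if free vertices are $\circ/\times$, each cup has one $\vee$ and one $\wedge$ end, ray vertices are $\vee/\wedge$, and no two rays are labelled $\vee,\wedge$ in that order left to right; $\lambda c$ for a cap diagram is oriented if $c^*\lambda$ is. Clockwise cup/cap: left end labelled $\wedge$; degree = number of clockwise cups/caps. Oriented circle diagram $a\lambda b$: $a\lambda,\lambda b$ oriented. $\underline\lambda$: the unique cup diagram with $\underline\lambda\lambda$ oriented of degree $0$; $\overline\lambda=(\underline\lambda)^*$; $\mu\subset\lambda$: $\mu\sim\lambda$ and $\underline\mu\lambda$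 oriented. $\mathrm{def}(\lambda)$ = number of cups in $\underline\lambda$, $\mathrm{def}(\Lambda)=\sup_\Lambda\mathrm{def}$. $K_\Lambda$ is the graded algebra with basis $(a\lambda b)$ over oriented circle diagrams with $\lambda\in\Lambda$, multiplication defined via closure: add $p$ vertices labelled $\vee$ on the left and $q$ labelled $\wedge$ on the right ($p$, $q$ the numbers of $\wedge$'s and $\vee$'s in weights of $\Lambda$), with $\mathrm{cl}(\underline\alpha)=\underline{\mathrm{cl}\alpha}$, $\mathrm{cl}(\overline\beta)=\overline{\mathrm{cl}\beta}$, and $K_\Lambda\cong H_\Delta/I_\Lambda$, $(a\lambda b)\mapsto\mathrm{cl}(a\lambda b)+I_\Lambda$, where $H_\Delta$ is Khovanov's diagram algebra of the block $\Delta\supset\mathrm{cl}(\Lambda)$ (basis: closed oriented circle diagrams; product by iterated surgery with rules $1\otimes1\mapsto1$, $1\otimes x\mapsto x$, $x\otimes1\mapsto x$, $x\otimes x\mapsto0$, $1\mapsto1\otimes x+x\otimes1$, $x\mapsto x\otimes x$, product zero unless the middle diagrams are mirror images) and $I_\Lambda$ is spanned by basis vectors with weight outside $\mathrm{cl}(\Lambda)$. $e_\lambda=(\underline\lambda\lambda\overline\lambda)$. $\Lambda^\circ=\{\lambda\in\Lambda\mid\mathrm{def}(\lambda)=\mathrm{def}(\Lambda)\}$, and the generalised Khovanov algebra is $H_\Lambda=\bigoplus_{\alpha,\beta\in\Lambda^\circ}e_\alpha K_\Lambda e_\beta=eK_\Lambda e$ with $e=\sum_{\lambda\in\Lambda^\circ}e_\lambda$;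 it has basis $(\underline\alpha\lambda\overline\beta)$ for $\alpha,\beta\in\Lambda^\circ$, $\lambda\in\Lambda$, $\alpha\subset\lambda\supset\beta$. Cellular algebra (Graham–Lehrer): unital algebra with $(\Lambda,M,C,* )$: poset $\Lambda$, finite sets $M(\lambda)$, $C$ injective onto a basis, $*$ anti-automorphism with $(C^\lambda_{\alpha\beta})^*=C^\lambda_{\beta\alpha}$, and $xC^\mu_{\gamma\delta}\equiv\sum_{\gamma'}r_x(\gamma',\gamma)C^\mu_{\gamma'\delta}$ modulo the span of $C^\nu_{**}$ for $\nu>\mu$, with $r_x$ independent of $\delta$. *)

(* Defs.v *)
From HB Require Import structures.
From mathcomp Require Import all_boot all_order all_algebra.
From Stdlib Require Import Relations.Relation_Operators.

Set Implicit Arguments.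
Unset Strict Implicit.
Unset Printing Implicit Defensive.

Import GRing.Theory.

(* vertex labels:  Circ = o, Cross = x, Down = \vee, Up = \wedge *)
Inductive label := Circ | Cross | Down | Up.

Definition isDown (l : label) : bool := if l is Down then true else false.
Definition isUp (l : label) : bool := if l is Up then true else false.

Definition weight := int -> label.

Definition wf_weight (la : weight) : Prop :=
  exists N : nat, forall i j : int, (i < j)%R -> (N < absz i)%N -> (N < absz j)%N ->
    ~ (la i = Down /\ la j = Up).

(* la and mu are related by (finitely many) permutations of \vee's and \wedge's *)
Definition perm_related (la mu : weight) : Prop :=
  (forall i, la i = Circ <-> mu i = Circ) /\
  (forall i, la i = Cross <-> mu i = Cross) /\
  exists s : seq int, (forall i, i \notin s -> la i = mu i) /\
    count (fun i => isDown (la i)) (undup s) = count (fun i => isDown (mu i)) (undup s).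

Definition is_block (Lam : weight -> Prop) : Prop :=
  exists la0, wf_weight la0 /\ forall mu, Lam mu <-> (wf_weight mu /\ perm_related la0 mu).

Definition bruhat_step (la mu : weight) : Prop :=
  exists i j : int, (i < j)%R /\ la i = Down /\ la j = Up /\
    mu = (fun x => if x == i then Up else if x == j then Down else la x).

Definition bruhat_le : weight -> weight -> Prop := clos_refl_trans weight bruhat_step.

(* Diagrams on a finite ordered set of vertices 'I_n (the \vee/\wedge        *)
(* vertices; o/x vertices are free in every oriented diagram).    *)

(* \vee/\wedge words:  true = \wedge, false = \vee *)
Definition word n := {ffun 'I_n -> bool}.

(* cup diagrams: each vertex is the end of a ray (None) or of a cup joining it
   to its partner (Some j) *)
Definition cupd n := {ffun 'I_n -> option 'I_n}.

Definition wf_cup n (d : cupd n) : bool :=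
  [forall i, forall j, (d i == Some j) ==> ((i != j) && (d j == Some i))] &&
  [forall i : 'I_n, forall j : 'I_n, forall k : 'I_n, forall l : 'I_n,
     [&& d i == Some j, d k == Some l, (i < j)%N & (k < l)%N] ==>
       ~~ [&& (i < k)%N, (k < j)%N & (j < l)%N]] &&
  (* rays (going down to infinity) do not cross cups *)
  [forall i : 'I_n, forall j : 'I_n, forall r : 'I_n,
     [&& d i == Some j, (i < r)%N & (r < j)%N] ==> (d r != None)].

(* c la oriented (equivalently la c^* oriented for the cap diagram c^* ) *)
Definition oriented n (d : cupd n) (w : word n) : bool :=
  [forall i, forall j, (d i == Some j) ==> (w i != w j)] &&
  [forall i, forall j, [&& d i == None, d j == None & (i < j)%N] ==> ~~ (~~ w i && w j)].

Definition is_left_end n (d : cupd n) (i : 'I_n) : bool :=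
  [exists j, (d i == Some j) && (i < j)%N].

(* degree = number of clockwise cups (left end labelled \wedge) *)
Definition degree n (d : cupd n) (w : word n) : nat :=
  #|[set i | is_left_end d i && w i]|.

Definition ncups n (d : cupd n) : nat := #|[set i | is_left_end d i]|.

(* \underline{w}: the unique cup diagram c with c w oriented of degree 0 *)
Definition under n (w : word n) : cupd n :=
  odflt [ffun => None] [pick d : cupd n | [&& wf_cup d, oriented d w & degree d w == 0]].

Definition wat n (w : word n) (m : nat) : bool :=
  match (insub m : option 'I_n) with Some i => w i | None => false end.

Definition clw n (w : word n) : word (n + n) :=
  let p := #|[set i | w i]| in
  [ffun t : 'I_(n + n) =>
     if (t < p)%N then false else if (t < p + n)%N then wat w (t - p) else true].

(* We compute the product (A la C^* )(C mu D^* ) of two closed oriented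
   circle diagrams (the middle diagrams already mirror images).  The stacked
   diagram is a graph on (level, position), level false = the la line,
   level true = the mu line.  S is the set of vertices of C at which surgery
   has already been performed (the cap of C^* and the cup of C at i,j are
   then replaced by vertical segments at i and at j). *)

Section Khovanov.
Variables (R : fieldType) (N : nat) (A C D : cupd N).

Definition kedge (S : {set 'I_N}) : rel (bool * 'I_N) := fun u v =>
  if u.1 == v.1 then
    (if u.1 then D u.2 == Some v.2 else A u.2 == Some v.2) ||
    ((C u.2 == Some v.2) && (u.2 \notin S))
  else (u.2 == v.2) && (u.2 \in S).

(* labellings of the circles by 1 (false) or x (true); an element of the
   tensor product of copies of F[x]/(x^2) is a function on labellings *)
Definition labeling := {ffun bool * 'I_N -> bool}.
Definition kvec := {ffun labeling -> R}.

Definition valid (S : {set 'I_N}) (l : labeling) : bool :=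
  [forall u, forall v, connect (kedge S) u v ==> (l u == l v)].

(* the labelling of an oriented stacked diagram: a circle is clockwise
   (label x) iff its leftmost vertex is labelled \wedge *)
Definition orient_lab (S : {set 'I_N}) (wl : bool * 'I_N -> bool) : labeling :=
  [ffun u => wl [arg min_(v < u | connect (kedge S) u v) (nat_of_ord v.2)]].

(* matrix entry of the surgery at the cup {i,j} of C: merge
   (1(x)1->1, 1(x)x->x, x(x)1->x, x(x)x->0) or split (1->1(x)x+x(x)1, x->x(x)x) *)
Definition surg_entry (S S' : {set 'I_N}) (i j : 'I_N) (l l' : labeling) : R :=
  let e := connect (kedge S) in
  if [&& valid S l, valid S' l' &
         [forall v, ~~ (e (false, i) v || e (true, i) v) ==> (l v == l' v)]] then
    (nat_of_bool
      (if ~~ e (false, i) (true, i) then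
         (l' (false, i) == (l (false, i) || l (true, i))) && ~~ (l (false, i) && l (true, i))
       else if l (false, i) then l' (false, i) && l' (false, j)
       else l' (false, i) != l' (false, j)))%:R%R
  else 0%R.

Definition surg_step (st : {set 'I_N} * kvec) (i : 'I_N) : {set 'I_N} * kvec :=
  match C i with
  | Some j => let S' := i |: (j |: st.1) in
              (S', [ffun l' => (\sum_l st.2 l * surg_entry st.1 S' i j l l')%R])
  | None => st
  end.

Definition left_ends : seq 'I_N := [seq i <- enum 'I_N | is_left_end C i].

(* coefficient of (A nu D^* ) in (A la C^* )(C mu D^* ); surgeries are
   performed on the cup-cap pairs from left to right *)
Definition kh_coef (la mu nu : word N) : R :=
  let l0 := orient_lab set0 (fun v => if v.1 then mu v.2 else la v.2) in
  let init := (set0, [ffun l => (nat_of_bool (l == l0))%:R%R]) in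
  let fin := foldl surg_step init left_ends in
  fin.2 (orient_lab fin.1 (fun v => nu v.2)).

End Khovanov.

(* The block is enumerated by lam : 'I_k -> weight, and its \vee/\wedge
   vertices (common to all weights of the block) by the increasing map
   pos : 'I_n -> int. *)

Section GenKhovanov.
Variables (F : fieldType) (k n : nat) (lam : 'I_k -> weight) (pos : 'I_n -> int).

Definition wd (a : 'I_k) : word n := [ffun t => isUp (lam a (pos t))].

Definition defect (a : 'I_k) : nat := ncups (under (wd a)).
Definition defL : nat := \max_(a < k) defect a.
Definition circb (a : 'I_k) : bool := defect a == defL.
Definition subw (a l : 'I_k) : bool := oriented (under (wd a)) (wd l).

(* basis of H_Lambda: (\underline a  l  \overline b), written (a, l, b) *)
Definition inH (t : 'I_k * 'I_k * 'I_k) : bool :=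
  let: (a, l, b) := t in [&& circb a, circb b, subw a l & subw b l].
Definition Bas := {t : 'I_k * 'I_k * 'I_k | inH t}.
Definition Halg := {ffun Bas -> F^o}.

(* product of basis vectors: via the closure into H_Delta, modulo I_Lambda *)
Definition bmul (s t : Bas) : Halg :=
  let: (a, l, b) := val s in
  let: (c, m, d) := val t in
  if under (clw (wd b)) == under (clw (wd c)) then
    ([ffun u : Bas => let: (a', nu, d') := val u in
       if (a' == a) && (d' == d) then
         kh_coef F (under (clw (wd a))) (under (clw (wd c))) (under (clw (wd d)))
                 (clw (wd l)) (clw (wd m)) (clw (wd nu))
       else 0%R] : Halg)
  else (0 : Halg)%R.

Definition Hmul (x y : Halg) : Halg := (\sum_s \sum_t (x s * y t) *: bmul s t)%R.

Definition Hone : Halg :=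
  [ffun u : Bas => (let: (a, l, b) := val u in (nat_of_bool ((a == l) && (l == b)))%:R%R : F^o)].

Definition swapB (u : Bas) : Bas := insubd u (let: (a, l, b) := val u in (b, l, a)).

Definition Hstar (x : Halg) : Halg := [ffun u => x (swapB u)].

Definition Cel (l a b : 'I_k) : Halg := [ffun u : Bas => ((nat_of_bool (val u == (a, l, b)))%:R%R : F^o)].

Definition Mset (l : 'I_k) : {set 'I_k} := [set a | circb a && subw a l].

Definition bruhat_idx (i j : 'I_k) : Prop := bruhat_le (lam i) (lam j).

End GenKhovanov.

Definition is_cellular (R : fieldType) (A : lmodType R) (mul : A -> A -> A) (one : A)
    (L X : finType) (le : L -> L -> Prop) (M : L -> {set X}) (C : L -> X -> X -> A)
    (star : A -> A) : Prop :=
  (forall x y z, mul x (mul y z) = mul (mul x y) z) /\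
  (forall x, mul one x = x) /\ (forall x, mul x one = x) /\
  (forall (a : R) x y z, mul (a *: x + y)%R z = (a *: mul x z + mul y z)%R) /\
  (forall (a : R) x y z, mul x (a *: y + z)%R = (a *: mul x y + mul x z)%R) /\
  (forall l, le l l) /\ (forall l m, le l m -> le m l -> l = m) /\
  (forall l m p, le l m -> le m p -> le l p) /\
  (forall l a b l' a' b', a \in M l -> b \in M l -> a' \in M l' -> b' \in M l' ->
     C l a b = C l' a' b' -> (l, a, b) = (l', a', b')) /\
  (forall x : A, exists! c : {ffun L * X * X -> R},
     (forall t, ~~ ((t.1.2 \in M t.1.1) && (t.2 \in M t.1.1)) -> c t = 0%R) /\
     x = (\sum_t c t *: C t.1.1 t.1.2 t.2)%R) /\
  (forall (a : R) x y, star (a *: x + y)%R = (a *: star x + star y)%R) /\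
  bijective star /\
  (forall x y, star (mul x y) = mul (star y) (star x)) /\
  (forall l a b, a \in M l -> b \in M l -> star (C l a b) = C l b a) /\
  (forall (x : A) l g, g \in M l ->
     exists r : X -> R, forall d, d \in M l ->
       exists c : L * X * X -> R,
         (forall t, c t <> 0%R ->
            [/\ t.1.2 \in M t.1.1, t.2 \in M t.1.1, le l t.1.1 & t.1.1 <> l]) /\
         (mul x (C l g d) - \sum_(g' in M l) r g' *: C l g' d)%R =
           (\sum_t c t *: C t.1.1 t.1.2 t.2)%R).

(* Main.v *)
(** Khovanov's product is a TQFT computation.  Colouring the vertices of a stacked
    diagram by the parity of position plus line makes every circle the orbit of a
    permutation, and a surgery multiplies this permutation by a transposition;
    hence it merges two circles or splits one.  All surgery maps are linear over
    the polynomial ring in variables x_v (v a vertex, x_v^2 = 0), so they are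
    determined by the image of 1; on functionals on this ring a split becomes the
    identity and a merge at p, q becomes precomposition with multiplication by
    x_p + x_q.  In this form surgeries at different places visibly commute, which
    gives associativity: perform the surgeries of two adjacent products on a
    diagram with three lines in either order.

    Monotonicity for the Bruhat order: a circle K has winding numbers h_K along
    either line which only take the values 0 and one sign s_K (a discrete Jordan
    curve theorem).  The number of \wedge minus the number of \vee among the
    first t vertices of a line is the sum over the circles of +-|h_K|, with + for
    clockwise circles, and each term of a merge or split can only increase it, by
    the triangle inequality for h_K = h_K' + h_K''.  So (a l b)(b m d) only
    involves weights above l and m.  In particular weights outside the closure
    span an ideal, and Bruhat order is the comparison of all these heights.

    If D0 is the cup diagram of m, the product (A m D0)(D0 m D) is (A m D) modulo
    higher weights.  Comparing the coefficient of m in the two bracketings of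
    (A l C)(C m D0)(D0 m D) then shows that the coefficient of (A m D) in
    (A l C)(C m D) does not depend on D, which is the cellular axiom. *)

Require Import Defs.
From HB Require Import structures.
From mathcomp Require Import all_boot all_order all_algebra all_fingroup.
From mathcomp Require Import zify.
From Stdlib Require Import FunctionalExtensionality Relations.Relation_Operators.

Set Implicit Arguments.
Unset Strict Implicit.
Unset Printing Implicit Defensive.

Import Order.TTheory GRing.Theory Num.Theory.

(** * Closed cup diagrams *)

(** Why functionals turn a split into the identity: the trace with x to 1 and 1 to 0 makes
    F[x]/(x^2) a Frobenius algebra, identified with its dual so that multiplication and
    comultiplication are exchanged. A split is dual to the multiplication identifying two variables,
    which a functional on all the x_v does not notice. A merge is dual to the comultiplication, with
    value x_p + x_q at 1. All stages of a computation thus live in one fixed space, and only the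
    condition of respecting the circles changes. Closures have no rays, so every diagram in the
    product is a fixed-point-free involution; rays matter only when orienting a weight is compared
    with orienting its closure. Associativity does not care in which order the cups are cut. The
    Jordan argument does: a vertical segment must not be spanned by a remaining cup, and cutting
    from left to right ensures this. The cup diagram of a weight m may have too few cups to belong
    to the basis of H. The comparison of brackets with boundary D0 therefore takes place among
    coefficients of closed diagrams, not inside H. *)

Section Matching.
Variable N : nat.
Implicit Types (d : cupd N) (i j k : 'I_N) (w : word N).

Definition matching d := wf_cup d && [forall i, d i != None].
Definition par d i := odflt i (d i).

Lemma wf_cupP d : reflect
  [/\ forall i j, d i = Some j -> i != j /\ d j = Some i,
      forall i j k l, d i = Some j -> d k = Some l -> i < j -> k < l -> ~ (i < k /\ k < j /\ j < l) &
      forall i j (r : 'I_N), d i = Some j -> i < r -> r < j -> d r != None] (wf_cup d).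
Proof.
apply: (iffP idP) => [/andP[/andP[/forallP h1 /forallP h2] /forallP h3]|[h1 h2 h3]].
  split=> [i j dij|i j k l dij dkl ij kl [ik [kj jl]]|i j r dij ir rj].
  - have /forallP/(_ j) := h1 i; rewrite dij eqxx /= => /andP[-> /eqP ->] //.
  - have /forallP/(_ j)/forallP/(_ k)/forallP/(_ l) := h2 i.
    by rewrite dij dkl !eqxx ij kl ik kj jl.
  - have /forallP/(_ j)/forallP/(_ r) := h3 i.
    by rewrite dij eqxx ir rj.
apply/andP; split; first (apply/andP; split).
- apply/forallP=> i; apply/forallP=> j; apply/implyP=> /eqP/h1[-> ->]; exact: eqxx.
- apply/forallP=> i; apply/forallP=> j; apply/forallP=> k; apply/forallP=> l.
  apply/implyP=> /and4P[/eqP dij /eqP dkl ij kl]; apply/negP=> /and3P[ik kj jl].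
  exact: (h2 i j k l).
- apply/forallP=> i; apply/forallP=> j; apply/forallP=> r.
  by apply/implyP=> /and3P[/eqP dij ir rj]; apply: (h3 i j).
Qed.

Lemma card_invol_even (T : finType) (f : T -> T) (B : {set T}) :
  {in B, forall x, f x \in B} -> {in B, forall x, f (f x) = x} -> {in B, forall x, f x != x} ->
  ~~ odd #|B|.
Proof.
have [m] := ubnP #|B|; elim: m B => // m IHm B ltB fB fK fN.
have [->|[x xB]] := set_0Vmem B; first by rewrite cards0.
have fxB : f x \in B :\ x by rewrite !inE fN // fB.
rewrite (cardsD1 x B) xB (cardsD1 (f x) (B :\ x)) fxB /= negbK.
have inj y : y \in B -> f y = x -> y = f x by move=> yB <-; rewrite fK.
apply: IHm => [|y|y|y]; rewrite ?inE.
- by move: ltB; rewrite (cardsD1 x B) xB (cardsD1 (f x) (B :\ x)) fxB /=; lia.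
- case/and3P=> yf yx yB; rewrite fB // andbT; apply/andP; split.
    by apply: contraNneq yx => e; rewrite -(fK y yB) e fK.
  by apply: contraNneq yf => /(inj y yB)->.
- by case/and3P=> _ _; apply: fK.
- by case/and3P=> _ _; apply: fN.
Qed.

Lemma card_between (i j : 'I_N) : #|[set k : 'I_N | i < k < j]| = j - i.+1.
Proof.
rewrite -sum1_card -[RHS]muln1 -sum_nat_const_nat (big_nat_widen _ _ N) ?(ltnW (ltn_ord j)) //.
rewrite (big_nat_widenl _ 0) // big_mkord; apply: eq_bigl => k; by rewrite inE andbC.
Qed.

Variable d : cupd N.
Hypothesis dm : matching d.

Lemma parE i j : (d i == Some j) = (par d i == j).
Proof.
by case/andP: dm => _ /forallP/(_ i); rewrite /par; case: (d i).
Qed.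

Lemma parP i : d i = Some (par d i).
Proof. by apply/eqP; rewrite parE. Qed.

Lemma parK : involutive (par d).
Proof.
move=> i; case/andP: dm => /wf_cupP[h _ _] _; have [_ e] := h _ _ (parP i).
by rewrite /par -/(par d i) e.
Qed.

Lemma par_neq i : par d i != i.
Proof. by case/andP: dm => /wf_cupP[h _ _] _; have [e _] := h _ _ (parP i); rewrite eq_sym. Qed.

Lemma par_nest i k : i < par d i -> i < k < par d i -> i < par d k < par d i.
Proof.
case/andP: dm => /wf_cupP[_ h _] _ ij /andP[ik kj].
have := par_neq k; rewrite neq_ltn => /orP[lt|lt].
  have lt' : par d k < par d (par d k) by rewrite parK.
  have := h _ _ _ _ (parP (par d k)) (parP i) lt' ij; rewrite parK.
  have : par d k != i :> nat by apply: contraTneq kj => /val_inj <-; rewrite parK ltnn.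
  by move: lt => /= lt n1 n2; lia.
have := h _ _ _ _ (parP i) (parP k) ij lt.
have : par d k != par d i :> nat.
  by apply: contraTneq ik => /val_inj/(inv_inj parK) ->; rewrite ltnn.
by move: lt => /= lt n1 n2; lia.
Qed.

(** Noncrossing makes [par d] a fixed-point-free involution of the vertices strictly under a cup, so
    their number is even. This is what makes the parity colouring of circles possible. *)
Lemma par_odd i : odd (par d i) = ~~ odd i.
Proof.
wlog lt : i / i < par d i => [gen|].
  have := par_neq i; rewrite neq_ltn => /orP[lt|]; last exact: gen.
  by have := gen (par d i); rewrite parK => /(_ lt) ->; rewrite negbK.
have : ~~ odd #|[set k : 'I_N | i < k < par d i]|.
  apply: (@card_invol_even _ (par d)) => k; rewrite ?inE => H; first exact: par_nest.
  - exact: parK.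
  - exact: par_neq.
by rewrite card_between oddB //=; case: (odd _); case: (odd i).
Qed.
End Matching.

(** * Surgery as multiplication by a transposition *)

Section JoinRel.
Variable V : finType.
Implicit Types (e : rel V) (p q u v : V).

(** For an equivalence relation [e] this is the equivalence relation generated by [e] and the pair
    [p], [q]. *)
Definition join_rel e p q u v := [|| e u v, e u p && e q v | e u q && e p v].

(** Here [p] and [p'] are the two ends of one cut arc and [q] faces [p]. Exchanging [e] with [e']
    and [q] with [p'] turns the merge clause into the split clause, so both are described by
    [join_rel]. *)
Definition surgery e e' p q p' : Prop :=
  [/\ e' p p' = ~~ e p q,
      ~~ e p q -> forall u v, e' u v = join_rel e p q u v &
      e p q -> forall u v, e u v = join_rel e' p p' u v].
End JoinRel.

Lemma orbit_rel1 (V : finType) (s : {perm V}) u : s u \in porbit s u.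
Proof. by have := mem_porbit s 1 u; rewrite expg1. Qed.

(* A circle is traversed by following kap from one colour class and rho from the
   other; in a stacked diagram the colour is the parity of position plus line. *)
Section Walk.
Variables (V : finType) (kap rho : V -> V) (col : V -> bool).
Hypotheses (kapK : involutive kap) (rhoK : involutive rho).
Hypotheses (col_kap : forall v, col (kap v) = ~~ col v).
Hypotheses (col_rho : forall v, col (rho v) = ~~ col v).

Definition two_rel (k r : V -> V) : rel V := fun u v => (k u == v) || (r u == v).

Definition walkf v := if col v then kap v else rho v.

Lemma walkf_inj : injective walkf.
Proof.
have cw v : col (walkf v) = ~~ col v.
  by rewrite /walkf; case: (boolP (col v)) => cv; rewrite ?col_kap ?col_rho ?cv.
move=> u v eq_uv; have cuv : col u = col v by apply: negb_inj; rewrite -!cw eq_uv.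
move: eq_uv; rewrite /walkf cuv; case: ifP => _; last by apply: (can_inj rhoK).
exact: (can_inj kapK).
Qed.

Definition walk := perm walkf_inj.

(** The permutation follows each edge in one direction only; the opposite direction is available
    because orbits are symmetric. *)
Lemma connect_walk u v : connect (two_rel kap rho) u v = (v \in porbit walk u).
Proof.
apply/idP/idP.
  case/connectP=> s; elim: s u => [|w s IHs] u /=; first by move=> _ ->; apply: porbit_id.
  case/andP=> uw /IHs{}IHs /IHs; rewrite -!eq_porbit_mem => /eqP ->.
  have step x : walkf x \in porbit walk x.
    by rewrite (_ : walkf x = walk x) ?orbit_rel1 // permE.
  rewrite eq_porbit_mem; case cu: (col u); case/orP: uw => /eqP <-.
  - by have := step u; rewrite /walkf cu.
  - by have := step (rho u); rewrite porbit_sym /walkf col_rho cu rhoK.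
  - by have := step (kap u); rewrite porbit_sym /walkf col_kap cu kapK.
  - by have := step u; rewrite /walkf cu.
case/porbitP=> i ->; elim: i => [|i IHi]; first by rewrite expg0 perm1 connect0.
apply: connect_trans IHi _; apply: connect1; rewrite expgSr permM permE /two_rel /walkf.
by case: ifP; rewrite eqxx ?orbT.
Qed.

End Walk.

Section TpermOrbit.
Variable V : finType.
Implicit Types (s : {perm V}) (p q u v : V).

(** A transposition changes the number of orbits by one, the sign telling whether [p] and [q] share
    an orbit. Multiplying twice restores the number, so the two signs are opposite. *)
Lemma porbit_tperm s p q : p != q ->
  (p \in porbit (tperm p q * s)%g q) = (p \notin porbit s q).
Proof.
move=> npq; have:= porbits_mul_tperm s p q; have:= porbits_mul_tperm (tperm p q * s)%g p q.
rewrite /= mulgA tperm2 mul1g npq !(porbit_sym _ p q).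
by case: (_ \in _); case: (_ \in _) => //=; lia.
Qed.

Definition orbit_rel s : rel V := fun u v => v \in porbit s u.

Lemma orbit_rel_sym s : symmetric (orbit_rel s).
Proof. by move=> u v; rewrite /orbit_rel porbit_sym. Qed.

Lemma orbit_rel_trans s : transitive (orbit_rel s).
Proof. by move=> v u w; rewrite /orbit_rel -!eq_porbit_mem => /eqP <- /eqP <-. Qed.

Lemma orbit_rel_refl s : reflexive (orbit_rel s).
Proof. by move=> u; apply: porbit_id. Qed.

Lemma orbit_rel_step s u : orbit_rel s u (s u).
Proof. exact: orbit_rel1. Qed.

Lemma orbit_rel_min s (e : rel V) : reflexive e -> transitive e ->
  (forall u, e u (s u)) -> forall u v, orbit_rel s u v -> e u v.
Proof.
move=> er et es u v /porbitP[i ->]; elim: i => [|i IHi]; first by rewrite expg0 perm1.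
by apply: et IHi _; rewrite expgSr permM.
Qed.

Lemma equiv_joinr (e : rel V) p q : reflexive e -> symmetric e -> transitive e ->
  [/\ reflexive (join_rel e p q), symmetric (join_rel e p q) & transitive (join_rel e p q)].
Proof.
move=> er es et; have eeq u v w : e u v -> e u w = e v w.
  by move=> uv; apply/idP/idP; apply: et; rewrite // es.
split=> [u|u v|v u w]; rewrite /join_rel.
- by rewrite er.
- rewrite (es v u) (es v p) (es v q) (es q u) (es p u); congr (_ || _).
  by rewrite orbC; congr (_ || _); rewrite andbC.
- case/or3P=> [uv|/andP[up qv]|/andP[uq pv]].
  + by rewrite !(eeq _ _ _ uv).
  + case/or3P=> [vw|/andP[vp qw]|/andP[vq pw]].
    * by rewrite up (et _ _ _ qv vw) orbT.
    * by rewrite up qw orbT.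
    * by rewrite (et _ _ _ up pw).
  + case/or3P=> [vw|/andP[vp qw]|/andP[vq pw]].
    * by rewrite uq (et _ _ _ pv vw) !orbT.
    * by rewrite (et _ _ _ uq qw).
    * by rewrite uq pw !orbT.
Qed.

Lemma orbit_rel_tperm_sub s p q u v : orbit_rel (tperm p q * s)%g u v -> join_rel (orbit_rel s) p q u v.
Proof.
have [jr js jt] := equiv_joinr p q (orbit_rel_refl s) (@orbit_rel_sym s) (@orbit_rel_trans s).
apply: orbit_rel_min => // {v}u; rewrite permM /join_rel; case: tpermP => [->|->|_ _].
- by rewrite orbit_rel_refl orbit_rel_step orbT.
- by rewrite orbit_rel_refl orbit_rel_step !orbT.
- by rewrite orbit_rel_step.
Qed.

(** The converse inclusion comes from writing [s] as the transposition times the new permutation, in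
    whose orbits [p] and [q] are joined. *)
Lemma orbit_rel_tperm_merge s p q u v : p != q -> ~~ orbit_rel s p q ->
  orbit_rel (tperm p q * s)%g u v = join_rel (orbit_rel s) p q u v.
Proof.
move=> npq sep; apply/idP/idP; first exact: orbit_rel_tperm_sub.
set s' := (tperm p q * s)%g.
have pq : orbit_rel s' p q by rewrite orbit_rel_sym /orbit_rel porbit_tperm // porbit_sym.
have sE : s = (tperm p q * s')%g by rewrite mulgA tperm2 mul1g.
have sub x y : orbit_rel s x y -> orbit_rel s' x y.
  rewrite {1}sE => /orbit_rel_tperm_sub; case/or3P=> // /andP[xp qy].
    exact: orbit_rel_trans (orbit_rel_trans xp pq) qy.
  by apply: orbit_rel_trans (orbit_rel_trans xp _) qy; rewrite orbit_rel_sym.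
case/or3P=> [/sub //|/andP[/sub xp /sub qy]|/andP[/sub xp /sub qy]].
  exact: orbit_rel_trans (orbit_rel_trans xp pq) qy.
by apply: orbit_rel_trans (orbit_rel_trans xp _) qy; rewrite orbit_rel_sym.
Qed.

End TpermOrbit.

(* Surgery at a cup a--a' and a cap b--b' replaces the two arcs by a--b and
   a'--b'.  Reading circles as orbits of the walk, this multiplies the walk by
   a transposition, so a surgery always merges two circles or splits one. *)
Lemma surgery_two_rel (V : finType) (kap rho rho' : V -> V) (col : V -> bool) (a a' b b' : V) :
  involutive kap -> involutive rho -> involutive rho' ->
  (forall v, col (kap v) = ~~ col v) -> (forall v, col (rho v) = ~~ col v) ->
  (forall v, col (rho' v) = ~~ col v) ->
  rho a = a' -> rho b = b' -> rho' a = b -> rho' a' = b' -> a != b' ->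
  (forall v, v \notin [:: a; a'; b; b'] -> rho' v = rho v) ->
  surgery (connect (two_rel kap rho)) (connect (two_rel kap rho')) a b a'.
Proof.
move=> kapK rhoK rho'K ck cr cr' ra rb r'a r'a' nab r'E.
have ra' : rho a' = a by rewrite -ra rhoK.
have rb' : rho b' = b by rewrite -rb rhoK.
have r'b : rho' b = a by rewrite -r'a rho'K.
have r'b' : rho' b' = a' by rewrite -r'a' rho'K.
(* These are the ends of colour [false] of the two cut arcs, where the walk follows [rho]. Only
   there do the two walks differ, and their values are exchanged. *)
pose p := if col a then a' else a; pose q := if col a then b else b'.
have ca' : col a' = ~~ col a by rewrite -ra cr.
have cb : col b = ~~ col a by rewrite -r'a cr'.
have cb' : col b' = col a by rewrite -rb cr cb negbK.
have npq : p != q.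
  by rewrite /p /q; case: ifP => // _; apply: contraNneq nab => E; rewrite -ra' E rb.
set w := walk kapK rhoK ck cr; set w' := walk kapK rho'K ck cr'.
have wE : w' = (tperm p q * w)%g.
  apply/permP=> v; rewrite permM [w' v]permE [w _]permE /walkf; case: tpermP => [->|->|vp vq].
  - by rewrite /p /q; case ca: (col a); rewrite ?(ca', cb, cb', ca) /= ?(r'a', r'a, rb, rb').
  - by rewrite /p /q; case ca: (col a); rewrite ?(ca', cb, cb', ca) /= ?(r'b, r'b', ra, ra').
  - case: ifP => // cv; apply: r'E; rewrite !inE; move: vp vq; rewrite /p /q.
    case: ifP => ca vp vq; apply/or4P; case=> /eqP vE; move: cv vp vq; rewrite vE ?ca' ?cb ?cb' ca //.
have cE u v : connect (two_rel kap rho) u v = orbit_rel w u v by exact: connect_walk.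
have c'E u v : connect (two_rel kap rho') u v = orbit_rel w' u v by exact: connect_walk.
have paq u : orbit_rel w u p = orbit_rel w u (if col a then a' else a) by [].
have aa : orbit_rel w a a' by rewrite -cE connect1 // /two_rel ra eqxx orbT.
have bb : orbit_rel w b b' by rewrite -cE connect1 // /two_rel rb eqxx orbT.
have ab : orbit_rel w' a b by rewrite -c'E connect1 // /two_rel r'a eqxx orbT.
have ab' : orbit_rel w' a' b' by rewrite -c'E connect1 // /two_rel r'a' eqxx orbT.
have eqr (s : {perm V}) x y : orbit_rel s x y -> forall z, orbit_rel s z x = orbit_rel s z y.
  by move=> xy z; apply/idP/idP => h; apply: orbit_rel_trans h _; rewrite // orbit_rel_sym.
have pE u : orbit_rel w u p = orbit_rel w u a by rewrite /p; case: ifP; rewrite // (eqr _ _ _ aa).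
have qE u : orbit_rel w u q = orbit_rel w u b by rewrite /q; case: ifP; rewrite // (eqr _ _ _ bb).
have pqE : orbit_rel w p q = orbit_rel w a b by rewrite qE orbit_rel_sym pE orbit_rel_sym.
have pqE' : orbit_rel w' p q = orbit_rel w' a a'.
  rewrite /p /q; case: ifP => _; first by rewrite -(eqr _ _ _ ab) orbit_rel_sym.
  by rewrite (eqr _ _ _ ab').
have wE' : w = (tperm p q * w')%g by rewrite wE mulgA tperm2 mul1g.
have F0 : orbit_rel w' a a' = ~~ orbit_rel w a b.
  rewrite -pqE -pqE' wE (orbit_rel_sym _ p q) (orbit_rel_sym w p q); exact: porbit_tperm.
split; first by rewrite cE c'E F0.
  rewrite cE => sep u v; rewrite c'E wE orbit_rel_tperm_merge ?pqE // /join_rel !cE pE.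
  by rewrite !(orbit_rel_sym w q) !(orbit_rel_sym w p) !pE !qE !(orbit_rel_sym w v).
rewrite cE => joined u v; rewrite cE wE' orbit_rel_tperm_merge ?pqE' ?F0 ?joined //.
rewrite /join_rel !c'E !(orbit_rel_sym w' _ v).
have qE' x : orbit_rel w' x q = orbit_rel w' x (if col a then a else a').
  by rewrite /q; case: ifP => _; rewrite -?(eqr _ _ _ ab) -?(eqr _ _ _ ab').
rewrite !qE' /p; case: ifP => // _; congr (_ || _); exact: orbC.
Qed.

(** * Surgery on functionals *)

(* Functionals on F[x_v : v in V]/(x_v^2), given by their values on the
   squarefree monomials; mulx v is precomposition with multiplication by x_v. *)
Section Functional.
Local Open Scope ring_scope.
Variables (F : fieldType) (V : finType).
Definition functional := {ffun {set V} -> F^o}.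
Implicit Types (e : rel V) (phi : functional) (u v p q : V) (T : {set V}).

Definition mulx v phi : functional := [ffun T : {set V} => if v \in T then 0 else phi (v |: T)].

Lemma mulxC u v phi : mulx u (mulx v phi) = mulx v (mulx u phi).
Proof.
apply/ffunP=> T; rewrite !ffunE !in_setU1 (eq_sym v u) setUCA.
by case: (u \in T); case: (v \in T); case: (u == v).
Qed.

Lemma mulxX v phi : mulx v (mulx v phi) = 0.
Proof. by apply/ffunP=> T; rewrite !ffunE setU11; case: ifP. Qed.

Lemma mulxD v phi psi : mulx v (phi + psi) = mulx v phi + mulx v psi.
Proof. by apply/ffunP=> T; rewrite !ffunE; case: ifP; rewrite ?addr0 // !ffunE. Qed.

Definition surg_fnl e p q phi := if e p q then phi else mulx p phi + mulx q phi.

(** Such a functional factors through the quotient identifying the variables along each class of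
    [e], that is, through one copy of F[x]/(x^2) per circle. *)
Definition compat e phi := forall u v, e u v -> mulx u phi = mulx v phi.

(** A split only refines the relation. After a merge, (x_p + x_q) x_p = x_p x_q = (x_p + x_q) x_q
    because squares vanish. *)
Lemma surg_fnl_compat e e' p q p' phi : reflexive e -> symmetric e ->
  surgery e e' p q p' -> compat e phi -> compat e' (surg_fnl e p q phi).
Proof.
move=> er es [f0 f1 f2] c u v e'uv; rewrite /surg_fnl; case: ifPn => [epq|sep].
  by apply: c; rewrite f2 // /join_rel e'uv.
rewrite !mulxD; move: e'uv; rewrite f1 // => /or3P[uv|/andP[up qv]|/andP[uq pv]].
- by rewrite !(mulxC _ p) !(mulxC _ q) (c _ _ uv).
- have vq : e v q by rewrite es.
  by rewrite !(mulxC _ p) !(mulxC _ q) (c _ _ up) (c _ _ vq) !mulxX (mulxC q) add0r addr0.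
- have vp : e v p by rewrite es.
  by rewrite !(mulxC _ p) !(mulxC _ q) (c _ _ uq) (c _ _ vp) !mulxX (mulxC q) add0r addr0.
Qed.

(* By F[x]-linearity only the images of 1 have to be compared: merging
   contributes the factor 1 and splitting the factor x_p + x_q, which are
   transposed here. *)
Lemma surg_fnl_comm e e1 e2 e12 p q p' r s r' phi :
  reflexive e -> symmetric e -> reflexive e2 ->
  surgery e e1 p q p' -> surgery e e2 r s r' ->
  surgery e1 e12 r s r' -> surgery e2 e12 p q p' ->
  compat e phi ->
  surg_fnl e1 r s (surg_fnl e p q phi) = surg_fnl e2 p q (surg_fnl e r s phi).
Proof.
move=> er es er2 [a0 a1 a2] [b0 b1 b2] [c0 c1 c2] [d0 d1 d2] cp.
have up e3 x y u v : e3 u v -> join_rel e3 x y u v by move=> h; rewrite /join_rel h.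
(* One surgery can change the type of the other only if both change: two splits that become merges,
   or two merges that become splits. *)
have sp : e p q -> ~~ e2 p q -> e r s && ~~ e1 r s.
  move=> epq npq; apply/andP; split.
    by apply: contraNT npq => /b1->; apply: up.
  apply/negP=> /c2/(_ p p'); rewrite a0 epq /= => /esym.
  by rewrite (up e12) // d0 npq.
have mg : ~~ e p q -> e2 p q -> ~~ e r s && e1 r s.
  move=> npq pq2; apply/andP; split.
    by apply: contra npq => /b2->; apply: up.
  apply: contraT => /c1/(_ p p'); rewrite d0 pq2 /= => /esym.
  by rewrite (up e1) // a0 npq.
have sp' : e r s -> ~~ e1 r s -> e p q && ~~ e2 p q.
  move=> ers nrs; apply/andP; split.
    by apply: contraNT nrs => /a1->; apply: up.
  apply/negP=> /d2/(_ r r'); rewrite b0 ers /= => /esym.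
  by rewrite (up e12) // c0 nrs.
have mg' : ~~ e r s -> e1 r s -> ~~ e p q && e2 p q.
  move=> nrs rs1; apply/andP; split.
    by apply: contra nrs => /a2->; apply: up.
  apply: contraT => /d1/(_ r r'); rewrite c0 rs1 /= => /esym.
  by rewrite (up e2) // b0 nrs.
rewrite /surg_fnl.
case epq: (e p q) sp mg sp' mg'; case ers: (e r s); case pq2: (e2 p q); case rs1: (e1 r s);
  move=> sp mg sp' mg' //;
  try solve [by case/andP: (sp isT isT) | by case/andP: (mg isT isT)
           | by case/andP: (sp' isT isT) | by case/andP: (mg' isT isT)].
(* Both surgeries split the same circle alone, and the second one performed is a merge: either side
   multiplies by twice the variable of that circle. *)
- have pr : e p r.
    have := b2 ers p q; rewrite epq b2 // /join_rel pq2 /= => /esym/orP[]/andP[-> _] //.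
    by rewrite er2 !orbT.
  by rewrite -(cp _ _ epq) -(cp _ _ ers) (cp _ _ pr).
(* Both surgeries merge the same two circles, so [r] and [s] lie on the circles of [p] and [q] in
   one of the two orders. *)
- have := a1 (negbT epq) r s; rewrite rs1 /join_rel ers /= => /esym/orP[]/andP[h1 h2].
    by rewrite (cp _ _ h1) (cp _ _ h2).
  by rewrite (cp _ _ h1) -(cp _ _ h2) addrC.
- by rewrite !mulxD (mulxC r) (mulxC r) (mulxC s) (mulxC s) addrACA.
Qed.

Lemma mulx_compat e w phi : compat e phi -> compat e (mulx w phi).
Proof. by move=> c u v uv; rewrite !(mulxC _ w) (c _ _ uv). Qed.

Lemma mulx_seq0 (s : seq V) phi : uniq s -> foldr mulx phi s set0 = phi [set x in s].
Proof.
have gen T : uniq s -> [disjoint [set x in s] & T] -> foldr mulx phi s T = phi ([set x in s] :|: T).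
  elim: s T => [|x s IHs] T /=; first by move=> *; rewrite set_nil set0U.
  case/andP=> nxs us dT; rewrite ffunE.
  have nxT : x \notin T by rewrite (disjointFr dT) // !inE eqxx.
  rewrite (negbTE nxT) IHs // ?set_cons ?setUA ?[_ :|: [set x]]setUC //.
  apply/pred0P=> y /=; rewrite !inE; apply/negP=> /andP[ys /orP[/eqP yx|yT]].
    by rewrite -yx ys in nxs.
  by move/pred0P/(_ y): dT; rewrite /= !inE ys yT orbT.
by move=> us; rewrite gen ?setU0 // -setI_eq0 setI0.
Qed.

(** Evaluation at a monomial is an iterated [mulx] evaluated at 1, so each variable can be moved
    along its circle separately. *)
Lemma compat_move e (I : finType) (f g : I -> V) (B : {set I}) phi : compat e phi ->
  {in B &, injective f} -> {in B &, injective g} -> {in B, forall i, e (f i) (g i)} ->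
  phi (f @: B) = phi (g @: B).
Proof.
move=> c fi gi efg.
have im (h : I -> V) : {in B &, injective h} -> phi (h @: B) = foldr mulx phi (map h (enum B)) set0.
  move=> hi; rewrite mulx_seq0.
    congr (phi _); apply/setP=> x; rewrite inE; apply/imsetP/mapP=> -[i iB ->]; exists i => //.
      by rewrite mem_enum.
    by rewrite mem_enum in iB.
  rewrite map_inj_in_uniq ?enum_uniq // => x y; rewrite !mem_enum; exact: hi.
rewrite !im // => {im fi gi}.
have: {subset enum B <= B} by move=> i; rewrite mem_enum.
move=> sB; suff -> : foldr mulx phi (map f (enum B)) = foldr mulx phi (map g (enum B)) by [].
elim: (enum B) sB => //= i s IHs sB.
rewrite -IHs; last by move=> j js; apply: sB; rewrite inE js orbT.
have ce : compat e (foldr mulx phi (map f s)) by elim: (s) => //= j t IHt; apply: mulx_compat.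
by rewrite (ce _ _ (efg _ _)) // sB // mem_head.
Qed.

Lemma compat_dup e T u v phi : compat e phi -> u \in T -> v \in T -> u != v -> e u v -> phi T = 0.
Proof.
move=> c uT vT nuv euv; have -> : T = u |: (v |: (T :\ u :\ v)).
  by rewrite [v |: _]setD1K ?setD1K // !inE eq_sym nuv.
have := mulxX v phi; rewrite -(c _ _ euv) => /ffunP/(_ (T :\ u :\ v)).
by rewrite !ffunE !inE !eqxx /= andbF (negbTE nuv).
Qed.
End Functional.

Section Restrict.
Local Open Scope ring_scope.
Variables (F : fieldType) (V V' : finType) (iota : V' -> V) (B : {set V}).
Hypotheses (ii : injective iota) (iB : forall v, iota v \notin B).

(** Freezing the monomial [B] in the other variables gives a slice of [phi]; surgeries between two
    of three lines act slice by slice. *)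
Definition restr (phi : functional F V) : functional F V' := [ffun T : {set V'} => phi ((iota @: T) :|: B)].

Lemma restr_X v phi : restr (mulx (iota v) phi) = mulx v (restr phi).
Proof.
apply/ffunP=> T; rewrite !ffunE in_setU (negbTE (iB v)) orbF (mem_imset _ _ ii).
by case: ifP => // _; rewrite imsetU1 setUA.
Qed.

Lemma restr_surg (e : rel V) (e' : rel V') p q phi : e (iota p) (iota q) = e' p q ->
  restr (surg_fnl e (iota p) (iota q) phi) = surg_fnl e' p q (restr phi).
Proof.
rewrite /surg_fnl => ->; case: ifP => // _; rewrite -!restr_X.
by apply/ffunP=> T; rewrite !ffunE.
Qed.
End Restrict.

(** * Stacked diagrams with two and three lines *)

Lemma connect_hom (V V' : finType) (r : rel V) (r' : rel V') (f : V -> V') :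
  (forall u v, r u v -> connect r' (f u) (f v)) ->
  forall u v, connect r u v -> connect r' (f u) (f v).
Proof.
move=> h u v /connectP[s]; elim: s u => [|w s IHs] u /=; first by move=> _ ->.
by case/andP=> uw sp vE; apply: connect_trans (h _ _ uw) (IHs _ sp vE).
Qed.

Lemma surgery_ext (V : finType) (e f e' f' : rel V) p q p' :
  (forall u v, e u v = f u v) -> (forall u v, e' u v = f' u v) ->
  surgery e e' p q p' -> surgery f f' p q p'.
Proof.
move=> ee ee' [h0 h1 h2]; split=> [|H u v|H u v]; first by rewrite -ee -ee'.
  by rewrite -ee' h1 ?ee // /join_rel !ee.
by rewrite -ee h2 ?ee // /join_rel !ee'.
Qed.

Section Stack.
Variable N : nat.
Implicit Types (A C D E : cupd N) (S : {set 'I_N}) (i j : 'I_N).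

Definition circ A D : rel 'I_N := connect (two_rel (par A) (par D)).

Definition V2 := (bool * 'I_N)%type.
Definition conn2 A C D S : rel V2 := connect (kedge A C D S).

(** [kap2] follows the arcs that no surgery touches; [rho2] follows [C], or the vertical segments
    that replace it over [S]. *)
Definition kap2 A D (u : V2) : V2 := (u.1, par (if u.1 then D else A) u.2).
Definition rho2 C S (u : V2) : V2 := if u.2 \in S then (~~ u.1, u.2) else (u.1, par C u.2).

(* Three lines with A below, C and D between them and E above. The sets S and S'
   record at which vertices of C and of D surgery has been performed. *)
Definition V3 := (option bool * 'I_N)%type.
Definition low i : V3 := (Some false, i).
Definition mid i : V3 := (Some true, i).
Definition top i : V3 := (None, i).

Definition kap3 A D S (u : V3) : V3 :=
  match u.1 with
  | Some false => low (par A u.2)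
  | Some true => if u.2 \in S then top u.2 else mid (par D u.2)
  | None => if u.2 \in S then mid u.2 else top (par D u.2)
  end.
Definition rho3 C E S (u : V3) : V3 :=
  match u.1 with
  | Some false => if u.2 \in S then mid u.2 else low (par C u.2)
  | Some true => if u.2 \in S then low u.2 else mid (par C u.2)
  | None => top (par E u.2)
  end.
Definition conn3 A C D E S S' : rel V3 := connect (two_rel (kap3 A D S') (rho3 C E S)).

Definition par_closed C S := forall i, (par C i \in S) = (i \in S).

Definition addc C S i := i |: (par C i |: S).

Lemma addc_closed C S i : matching C -> par_closed C S -> par_closed C (addc C S i).
Proof.
move=> mC cS j; rewrite !inE cS (inv_eq (parK mC)) (inj_eq (inv_inj (parK mC))).
by rewrite orbCA.
Qed.

Lemma set0_closed C : par_closed C set0.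
Proof. by move=> j; rewrite !inE. Qed.

Section Edges2.
Variables (A C D : cupd N).
Hypotheses (mA : matching A) (mC : matching C) (mD : matching D).

Lemma kedgeE S u v : kedge A C D S u v = two_rel (kap2 A D) (rho2 C S) u v.
Proof.
by case: u v => [[] i] [[] j]; rewrite /kedge /two_rel /kap2 /rho2 /= ?parE //;
  case: ifP => iS; rewrite !xpair_eqE /= ?andbT ?andbF ?orbF.
Qed.

Lemma kap2K : involutive (kap2 A D).
Proof. by case=> [[] i]; rewrite /kap2 /= parK. Qed.

Lemma rho2K S : par_closed C S -> involutive (rho2 C S).
Proof. by move=> cS [b i]; rewrite /rho2 /=; case iS: (i \in S); rewrite /= ?cS iS ?negbK ?parK. Qed.

Definition col2 (u : V2) := u.1 (+) odd u.2.

Lemma col2_kap u : col2 (kap2 A D u) = ~~ col2 u.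
Proof. by case: u => [[] i]; rewrite /col2 /= par_odd. Qed.

Lemma col2_rho S u : col2 (rho2 C S u) = ~~ col2 u.
Proof. by case: u => [b i]; rewrite /col2 /rho2 /=; case: ifP => _ /=; rewrite ?par_odd ?addNb ?addbN. Qed.

Lemma conn2E S : conn2 A C D S =2 connect (two_rel (kap2 A D) (rho2 C S)).
Proof. exact: (eq_connect (@kedgeE S)). Qed.

Lemma conn2_refl S : reflexive (conn2 A C D S).
Proof. by move=> u; apply: connect0. Qed.

Lemma conn2_trans S : transitive (conn2 A C D S).
Proof. exact: connect_trans. Qed.

Lemma two_rel_sym (V : finType) (k r : V -> V) : involutive k -> involutive r ->
  symmetric (connect (two_rel k r)).
Proof.
move=> kK rK; apply: sym_connect_sym => u v.
by rewrite /two_rel !(eq_sym _ u) (inv_eq kK) (inv_eq rK).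
Qed.

Lemma conn2_sym S : par_closed C S -> symmetric (conn2 A C D S).
Proof. by move=> cS u v; rewrite !conn2E; apply: two_rel_sym; [exact: kap2K|exact: rho2K]. Qed.

Lemma surgery2 S i : par_closed C S -> i \notin S ->
  surgery (conn2 A C D S) (conn2 A C D (addc C S i)) (false, i) (true, i) (false, par C i).
Proof.
move=> cS iS; have iS' : par C i \notin S by rewrite cS.
have cS' := addc_closed i mC cS.
apply: (surgery_ext (fun u v => esym (conn2E _ u v)) (fun u v => esym (conn2E _ u v))).
apply: (surgery_two_rel (b' := (true, par C i)) kap2K (rho2K cS) (rho2K cS') col2_kap (@col2_rho S)
  (@col2_rho (addc C S i))); rewrite /rho2 /= ?(negbTE iS) ?inE ?eqxx ?orbT //.
case=> [b j]; rewrite !inE !negb_or /= !xpair_eqE => H.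
by rewrite (_ : j == i = false) 1?(_ : j == par C i = false) //; move: H; case: (b); rewrite /= ?eqxx /=; lia.
Qed.
End Edges2.

Section Edges3.
Variables (A C D E : cupd N).
Hypotheses (mA : matching A) (mC : matching C) (mD : matching D) (mE : matching E).

Lemma kap3K S : par_closed D S -> involutive (kap3 A D S).
Proof.
by move=> cS [[[]|] i]; rewrite /kap3 /= ?parK //; case iS: (i \in S); rewrite /= ?cS iS ?parK.
Qed.

Lemma rho3K S : par_closed C S -> involutive (rho3 C E S).
Proof.
by move=> cS [[[]|] i]; rewrite /rho3 /= ?parK //; case iS: (i \in S); rewrite /= ?cS iS ?parK.
Qed.

Definition col3 (u : V3) := (u.1 == Some true) (+) odd u.2.

Lemma col3_kap S u : col3 (kap3 A D S u) = ~~ col3 u.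
Proof. by case: u => [[[]|] i]; rewrite /col3 /kap3 /= ?par_odd //; case: ifP => _ /=; rewrite ?par_odd ?negbK. Qed.

Lemma col3_rho S u : col3 (rho3 C E S u) = ~~ col3 u.
Proof. by case: u => [[[]|] i]; rewrite /col3 /rho3 /= ?par_odd //; case: ifP => _ /=; rewrite ?par_odd ?negbK. Qed.

Lemma conn3_refl S S' : reflexive (conn3 A C D E S S').
Proof. by move=> u; apply: connect0. Qed.

Lemma conn3_sym S S' : par_closed C S -> par_closed D S' -> symmetric (conn3 A C D E S S').
Proof. by move=> cS cS'; apply: two_rel_sym; [exact: kap3K|exact: rho3K]. Qed.

Lemma surgery3C S S' i : par_closed C S -> par_closed D S' -> i \notin S ->
  surgery (conn3 A C D E S S') (conn3 A C D E (addc C S i) S') (low i) (mid i) (low (par C i)).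
Proof.
move=> cS cS' iS; have iS' : par C i \notin S by rewrite cS.
have cS2 := addc_closed i mC cS.
apply: (surgery_two_rel (b' := mid (par C i)) (kap3K cS') (rho3K cS) (rho3K cS2) (@col3_kap S') (@col3_rho S)
  (@col3_rho (addc C S i))); rewrite /rho3 /= ?(negbTE iS) ?inE ?eqxx ?orbT //.
case=> [l j]; rewrite !inE !negb_or /low /mid /= !xpair_eqE => H.
rewrite /rho3 /=; case: l H => [[]|//] H; rewrite /= ?inE (_ : j == i = false) 1?(_ : j == par C i = false) //;
  move: H; rewrite /= ?eqxx /=; lia.
Qed.

Lemma surgery3D S S' i : par_closed C S -> par_closed D S' -> i \notin S' ->
  surgery (conn3 A C D E S S') (conn3 A C D E S (addc D S' i)) (mid i) (top i) (mid (par D i)).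
Proof.
move=> cS cS' iS; have iS' : par D i \notin S' by rewrite cS'.
have cS2 := addc_closed i mD cS'.
(* The arcs of [D] belong to [kap3], so the two involutions exchange their roles here. *)
have sw S1 u v : connect (two_rel (rho3 C E S) (kap3 A D S1)) u v = conn3 A C D E S S1 u v.
  by apply: eq_connect => x y; rewrite /two_rel orbC.
apply: (surgery_ext (sw _) (sw _)).
apply: (surgery_two_rel (b' := top (par D i)) (rho3K cS) (kap3K cS') (kap3K cS2)
  (@col3_rho S) (@col3_kap S') (@col3_kap (addc D S' i)));
  rewrite /kap3 /= ?(negbTE iS) ?inE ?eqxx ?orbT //.
case=> [l j]; rewrite !inE !negb_or /top /mid /= !xpair_eqE => H.
by case: l H => [[]|] H //=; rewrite ?inE (_ : j == i = false) 1?(_ : j == par D i = false) //;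
  move: H; rewrite /= ?eqxx /=; lia.
Qed.
End Edges3.
End Stack.

(** * Two-line diagrams inside a three-line diagram *)

Section Relate.
Variable N : nat.
Implicit Types (A C D E : cupd N) (S : {set 'I_N}) (i j : 'I_N).
Variables (A C D E : cupd N).
Hypotheses (mA : matching A) (mC : matching C) (mD : matching D) (mE : matching E).

Definition iota01 (u : V2 N) : V3 N := (Some u.1, u.2).
Definition iota12 (u : V2 N) : V3 N := (if u.1 then None else Some true, u.2).

Lemma iota01_inj : injective iota01.
Proof. by move=> [b i] [b' j] [-> ->]. Qed.

Lemma iota12_inj : injective iota12.
Proof. by move=> [[] i] [[] j] // [->]. Qed.

Ltac edge3 := rewrite /kap3 /rho3 /kap2 /rho2 /low /mid /top /= ?inE.

Lemma conn3_low S u v : conn3 A C D E S set0 (iota01 u) (iota01 v) = conn2 A C D S u v.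
Proof.
rewrite conn2E //; apply/idP/idP.
  pose f (x : V3 N) : V2 N := if x.1 is Some b then (b, x.2) else u.
  rewrite (surjective_pairing u) (surjective_pairing v) -[(u.1, u.2)]/(f (iota01 u)) -[(v.1, v.2)]/(f (iota01 v)).
  apply: (@connect_hom _ _ _ _ f) => x y /orP[]/eqP<-.
    case: x => [[[]|] i]; rewrite /f; edge3 => //; by apply: connect1; rewrite /two_rel eqxx.
  case: x => [[[]|] i]; rewrite /f; edge3 => //; case: ifP => iS; 
    by apply: connect1; rewrite /two_rel /rho2 /= ?iS ?eqxx ?orbT.
apply: (@connect_hom _ _ _ _ iota01) => x y /orP[]/eqP<-; apply: connect1; rewrite /two_rel.
  by case: x => [[] i]; edge3; rewrite eqxx.
by case: x => [[] i]; edge3; case: ifP => iS; rewrite eqxx ?orbT.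
Qed.

Lemma conn3_high S u v : conn3 A C D E set0 S (iota12 u) (iota12 v) = conn2 C D E S u v.
Proof.
rewrite conn2E //; apply/idP/idP.
  pose f (x : V3 N) : V2 N := match x.1 with Some true => (false, x.2) | None => (true, x.2) | _ => u end.
  have fE x : f (iota12 x) = x by case: x => [[] i].
  rewrite -{2}(fE u) -{2}(fE v).
  apply: (@connect_hom _ _ _ _ f) => x y /orP[]/eqP<-.
    case: x => [[[]|] i]; rewrite /f; edge3 => //; case: ifP => iS; apply: connect1;
    by rewrite /two_rel /rho2 /= ?iS ?eqxx ?orbT.
  by case: x => [[[]|] i]; rewrite /f; edge3 => //; apply: connect1; rewrite /two_rel /kap2 /= eqxx.
apply: (@connect_hom _ _ _ _ iota12) => x y /orP[]/eqP<-; apply: connect1; rewrite /two_rel.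
  by case: x => [[] i]; edge3; rewrite eqxx ?orbT.
by case: x => [[] i]; edge3; case: ifP => iS; rewrite eqxx ?orbT.
Qed.

(** With all of [C] cut, every vertex of the low line is joined vertically to the middle line. An
    arc of [A] then acts on the middle line by going down, along [A], and up. *)
Lemma conn3_lowT S u v : conn3 A C D E setT S (iota12 u) (iota12 v) = conn2 A D E S u v.
Proof.
rewrite conn2E //; apply/idP/idP.
  pose f (x : V3 N) : V2 N := if x.1 is Some _ then (false, x.2) else (true, x.2).
  have fE x : f (iota12 x) = x by case: x => [[] i].
  rewrite -{2}(fE u) -{2}(fE v).
  apply: (@connect_hom _ _ _ _ f) => x y /orP[]/eqP<-.
    case: x => [[[]|] i]; rewrite /f; edge3 => //; try (case: ifP => iS);
      by apply: connect1; rewrite /two_rel /kap2 /rho2 /= ?iS eqxx ?orbT.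
  by case: x => [[[]|] i]; rewrite /f; edge3 => //; apply: connect1; rewrite /two_rel /kap2 /= eqxx.
apply: (@connect_hom _ _ _ _ iota12) => x y /orP[]/eqP<-; last first.
  by apply: connect1; rewrite /two_rel; case: x => [[] i]; edge3; case: ifP => iS; rewrite eqxx ?orbT.
case: x => [[] i]; first by apply: connect1; rewrite /two_rel; edge3; rewrite eqxx ?orbT.
apply: (@connect_trans _ _ (low i)); first by apply: connect1; rewrite /two_rel; edge3; rewrite eqxx ?orbT.
apply: (@connect_trans _ _ (low (par A i))); apply: connect1; rewrite /two_rel; edge3; by rewrite eqxx ?orbT.
Qed.

Lemma conn3_highT S u v : conn3 A C D E S setT (iota01 u) (iota01 v) = conn2 A C E S u v.
Proof.
rewrite conn2E //; apply/idP/idP.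
  pose f (x : V3 N) : V2 N := if x.1 is Some false then (false, x.2) else (true, x.2).
  have fE x : f (iota01 x) = x by case: x => [[] i].
  rewrite -{2}(fE u) -{2}(fE v).
  apply: (@connect_hom _ _ _ _ f) => x y /orP[]/eqP<-.
    by case: x => [[[]|] i]; rewrite /f; edge3 => //; apply: connect1; rewrite /two_rel /kap2 /= eqxx.
  case: x => [[[]|] i]; rewrite /f; edge3 => //; try (case: ifP => iS);
      by apply: connect1; rewrite /two_rel /kap2 /rho2 /= ?iS eqxx ?orbT.
apply: (@connect_hom _ _ _ _ iota01) => x y /orP[]/eqP<-; last first.
  by apply: connect1; rewrite /two_rel; case: x => [[] i]; edge3; case: ifP => iS; rewrite eqxx ?orbT.
case: x => [[] i]; last by apply: connect1; rewrite /two_rel; edge3; rewrite eqxx.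
apply: (@connect_trans _ _ (top i)); first by apply: connect1; rewrite /two_rel; edge3; rewrite eqxx.
apply: (@connect_trans _ _ (top (par E i))); apply: connect1; rewrite /two_rel; edge3; by rewrite eqxx ?orbT.
Qed.

Lemma conn2_setT b b' i j : conn2 A C D setT (b, i) (b', j) = circ A D i j.
Proof.
rewrite conn2E //; apply/idP/idP.
  rewrite -[i in X in _ -> X]/((b, i).2) -[j in X in _ -> X]/((b', j).2).
  apply: (@connect_hom _ _ _ _ snd) => x y /orP[]/eqP<-.
    by case: x => [[] k]; apply: connect1; rewrite /two_rel /= eqxx ?orbT.
  by rewrite /rho2 inE.
have vert k c c' : connect (two_rel (kap2 A D) (rho2 C setT)) (c, k) (c', k).
  case: (eqVneq c c') => [->|n]; first exact: connect0.
  by apply: connect1; rewrite /two_rel /rho2 /= inE; move: n; case: c; case: c' => // _; rewrite eqxx ?orbT.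
move=> h; apply: connect_trans (vert _ _ false) _; apply: connect_trans (vert _ false _).
apply: (@connect_hom _ _ _ _ (pair false)) h => x y /orP[]/eqP<-.
  by apply: connect1; rewrite /two_rel /kap2 /= eqxx.
apply: connect_trans (vert _ _ true) _; apply: connect_trans (vert _ true _).
by apply: connect1; rewrite /two_rel /kap2 /= eqxx.
Qed.

Lemma conn2_set0 b b' i j :
  conn2 A C D set0 (b, i) (b', j) = (b == b') && (if b then circ C D i j else circ A C i j).
Proof.
rewrite conn2E //; apply/idP/andP => [h|[/eqP<-]].
  have lv : b = b'.
    case/connectP: h => s; elim: s b i => [|[c k] s IHs] b i /=; first by move=> _ [<-].
    by case/andP=> /orP[]/eqP; rewrite /kap2 /rho2 /= ?inE => -[<- _]; apply: IHs.
  split; first exact/eqP; move: h; rewrite -lv.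
  have gen (x y : V2 N) : connect (two_rel (kap2 A D) (rho2 C set0)) x y -> x.1 = b ->
      if b then circ C D x.2 y.2 else circ A C x.2 y.2.
    case/connectP=> s; elim: s x => [|z s IHs] x /=; first by move=> _ ->; case: (b); rewrite /circ connect0.
    case/andP=> xz zs yE xb; have zb : z.1 = b by case/orP: xz => /eqP<-; rewrite /kap2 /rho2 ?inE.
    have := IHs z zs yE zb; move: xz; rewrite /two_rel /kap2 /rho2 inE xb.
    case: (b) => /orP[]/eqP<- /=; apply: connect_trans; apply: connect1; by rewrite /two_rel eqxx ?orbT.
  by move/gen; apply.
case: b; [apply: (@connect_hom _ _ _ _ (pair true))|apply: (@connect_hom _ _ _ _ (pair false))];
  move=> x y /orP[]/eqP<-; apply: connect1; by rewrite /two_rel /kap2 /rho2 /= ?inE eqxx ?orbT.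
Qed.

End Relate.

(** * The product and its associativity *)

Section LeftEnds.
Variables (N : nat) (C : cupd N).
Hypothesis mC : matching C.
Implicit Types (S : {set 'I_N}) (s : seq 'I_N).

(** Invariant of the surgery loop: [S] consists of whole cups, and [s] lists left ends of cups still
    uncut. *)
Definition fresh S s : Prop :=
  [/\ par_closed C S, uniq s & forall x, x \in s -> x \notin S /\ x < par C x].

Lemma fresh_cons S i s : fresh S (i :: s) -> [/\ par_closed C S, i \notin S & fresh (addc C S i) s].
Proof.
case=> cS /= /andP[nis us] h; have [iS ip] := h _ (mem_head _ _).
split=> //; split=> // [|x xs]; first exact: addc_closed.
have [xS xp] := h x (mem_behead (s := i :: s) xs); split=> //.
rewrite !inE !negb_or xS andbT; apply/andP; split; first by apply: contraNneq nis => <-.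
by apply/negP=> /eqP E; move: xp; rewrite E parK //; lia.
Qed.

Lemma left_endP i : is_left_end C i = (i < par C i).
Proof.
apply/existsP/idP=> [[j /andP[]]|lt]; first by rewrite parE // => /eqP->.
by exists (par C i); rewrite parE // eqxx.
Qed.

Lemma mem_left_ends i : (i \in left_ends C) = (i < par C i).
Proof. by rewrite mem_filter mem_enum andbT left_endP. Qed.

Lemma fresh_left_ends : fresh set0 (left_ends C).
Proof.
split; [exact: set0_closed|by rewrite filter_uniq ?enum_uniq|move=> x].
by rewrite mem_left_ends inE.
Qed.

Lemma fold_addc S s : foldl (addc C) S s =i [pred v | [|| v \in S, v \in s | par C v \in s]].
Proof.
elim: s S => [|i s IHs] S v /=; first by rewrite !inE orbF.
rewrite IHs !inE -(inv_eq (parK mC)).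
by case: (v == i); case: (par C v == i); case: (v \in S); case: (v \in s); case: (par C v \in s).
Qed.

Lemma fold_left_ends : foldl (addc C) set0 (left_ends C) = setT.
Proof.
apply/setP=> v; rewrite fold_addc !inE /= !mem_left_ends parK //.
by have := par_neq mC v; rewrite neq_ltn orbC.
Qed.
End LeftEnds.

Section Prod.
Local Open Scope ring_scope.
Variables (F : fieldType) (N : nat).
Implicit Types (A C D E : cupd N) (S : {set 'I_N}) (s : seq 'I_N).

Definition rstep A C D (st : {set 'I_N} * functional F (V2 N)) (i : 'I_N) :=
  (addc C st.1 i, surg_fnl (conn2 A C D st.1) (false, i) (true, i) st.2).

Definition tensor (phi psi : functional F 'I_N) : functional F (V2 N) :=
  [ffun T : {set V2 N} => phi (pair false @^-1: T) * psi (pair true @^-1: T)].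

Definition run2 A C D (phi : functional F (V2 N)) := (foldl (rstep A C D) (set0, phi) (left_ends C)).2.

(** After all surgeries both lines carry the same circles, so reading on the line [false] is a mere
    choice ([surg_prodE]). *)
Definition surg_prod A C D (phi psi : functional F 'I_N) : functional F 'I_N :=
  [ffun T : {set 'I_N} => run2 A C D (tensor phi psi) (pair false @: T)].

Lemma rstep_compat A C D S phi s : matching A -> matching C -> matching D ->
  fresh C S s -> compat (conn2 A C D S) phi ->
  compat (conn2 A C D (foldl (addc C) S s)) (foldl (rstep A C D) (S, phi) s).2.
Proof.
move=> mA mC mD; elim: s S phi => //= i s IHs S phi /(fresh_cons mC)[cS iS fr] c.
apply: IHs => //; apply: surg_fnl_compat c; first exact: conn2_refl.
  exact: conn2_sym.
exact: surgery2.
Qed.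

Lemma tensor_X0 i phi psi : mulx (false, i) (tensor phi psi) = tensor (mulx i phi) psi.
Proof.
apply/ffunP=> T; rewrite !ffunE !inE; case: ifP => _; first by rewrite mul0r.
by congr (phi _ * psi _); apply/setP=> x; rewrite !inE ?xpair_eqE.
Qed.

Lemma tensor_X1 i phi psi : mulx (true, i) (tensor phi psi) = tensor phi (mulx i psi).
Proof.
apply/ffunP=> T; rewrite !ffunE !inE; case: ifP => _; first by rewrite mulr0.
by congr (phi _ * psi _); apply/setP=> x; rewrite !inE ?xpair_eqE.
Qed.

Lemma tensor_compat A C D phi psi : matching A -> matching C -> matching D ->
  compat (circ A C) phi -> compat (circ C D) psi ->
  compat (conn2 A C D set0) (tensor phi psi).
Proof.
move=> mA mC mD c c' [b i] [b' j]; rewrite conn2_set0 // => /andP[/eqP<-].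
by case: b => ij; rewrite ?tensor_X0 ?tensor_X1 ?(c _ _ ij) ?(c' _ _ ij).
Qed.

Lemma run2_compat A C D phi psi : matching A -> matching C -> matching D ->
  compat (circ A C) phi -> compat (circ C D) psi ->
  compat (conn2 A C D setT) (run2 A C D (tensor phi psi)).
Proof.
move=> mA mC mD c c'; rewrite /run2 -(fold_left_ends mC); apply: rstep_compat => //.
  exact: fresh_left_ends.
exact: tensor_compat.
Qed.

Lemma surg_prodE A C D phi psi b T : matching A -> matching C -> matching D ->
  compat (circ A C) phi -> compat (circ C D) psi ->
  surg_prod A C D phi psi T = run2 A C D (tensor phi psi) (pair b @: T).
Proof.
move=> mA mC mD c c'; rewrite ffunE.
apply: (compat_move (e := conn2 A C D setT)) => [|i j _ _ []|i j _ _ []|i _] //.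
  exact: run2_compat.
by rewrite conn2_setT // /circ connect0.
Qed.

Lemma surg_prod_compat A C D phi psi : matching A -> matching C -> matching D ->
  compat (circ A C) phi -> compat (circ C D) psi -> compat (circ A D) (surg_prod A C D phi psi).
Proof.
move=> mA mC mD c c' i j ij.
have rE u : mulx u (surg_prod A C D phi psi) =
    restr (pair false) set0 (mulx (false, u) (run2 A C D (tensor phi psi))).
  rewrite restr_X; [|by move=> ? ? []|by move=> ?; rewrite inE].
  by congr mulx; apply/ffunP=> T; rewrite !ffunE setU0.
rewrite !rE; congr restr; apply: run2_compat => //.
by rewrite conn2_setT.
Qed.

Lemma mulx_lin (V : finType) (v : V) (a : F) (phi psi : functional F V) : mulx v (a *: phi + psi) = a *: mulx v phi + mulx v psi.
Proof. by apply/ffunP=> T; rewrite !ffunE; case: ifP; rewrite ?scaler0 ?addr0 ?ffunE. Qed.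

Lemma surg_fnl_lin (V : finType) (e : rel V) p q (a : F) (phi psi : functional F V) :
  surg_fnl e p q (a *: phi + psi) = a *: surg_fnl e p q phi + surg_fnl e p q psi.
Proof. by rewrite /surg_fnl; case: ifP => // _; rewrite !mulx_lin scalerDr addrACA. Qed.

Lemma run2_lin A C D a phi psi :
  run2 A C D (a *: phi + psi) = a *: run2 A C D phi + run2 A C D psi.
Proof.
rewrite /run2; elim: (left_ends C) (set0 : {set 'I_N}) phi psi => //= i s IHs S phi psi.
by rewrite /rstep /= surg_fnl_lin IHs.
Qed.

Lemma surg_prod_linl A C D a phi phi' psi :
  surg_prod A C D (a *: phi + phi') psi = a *: surg_prod A C D phi psi + surg_prod A C D phi' psi.
Proof.
have tl : tensor (a *: phi + phi') psi = a *: tensor phi psi + tensor phi' psi.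
  by apply/ffunP=> T; rewrite !ffunE mulrDl -scalerAl.
by apply/ffunP=> T; rewrite !ffunE tl run2_lin !ffunE.
Qed.

Lemma surg_prod_linr A C D a phi psi psi' :
  surg_prod A C D phi (a *: psi + psi') = a *: surg_prod A C D phi psi + surg_prod A C D phi psi'.
Proof.
have tl : tensor phi (a *: psi + psi') = a *: tensor phi psi + tensor phi psi'.
  by apply/ffunP=> T; rewrite !ffunE mulrDr -scalerAr.
by apply/ffunP=> T; rewrite !ffunE tl run2_lin !ffunE.
Qed.

End Prod.

Section Assoc.
Local Open Scope ring_scope.
Variables (F : fieldType) (N : nat) (A C D E : cupd N).
Hypotheses (mA : matching A) (mC : matching C) (mD : matching D) (mE : matching E).
Local Notation e3S S S' := (conn3 A C D E S S').
Implicit Types (S : {set 'I_N}) (s : seq 'I_N) (phi : functional F (V3 N)).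

Definition step_low S' (st : {set 'I_N} * functional F (V3 N)) (i : 'I_N) :=
  (addc C st.1 i, surg_fnl (e3S st.1 S') (low i) (mid i) st.2).
Definition step_high S (st : {set 'I_N} * functional F (V3 N)) (i : 'I_N) :=
  (addc D st.1 i, surg_fnl (e3S S st.1) (mid i) (top i) st.2).

(** Iteration of [surg_fnl_comm]: a single surgery at [D] is carried past all those at [C], whose
    types may change on the way. *)
Lemma step_low_rd1 S S' phi s k : fresh C S s -> par_closed D S' -> k \notin S' -> compat (e3S S S') phi ->
  surg_fnl (e3S (foldl (addc C) S s) S') (mid k) (top k) (foldl (step_low S') (S, phi) s).2 =
  (foldl (step_low (addc D S' k)) (S, surg_fnl (e3S S S') (mid k) (top k) phi) s).2.
Proof.
move=> + cS' kS'; elim: s S phi => //= i s IHs S phi /(fresh_cons mC)[cS iS fr] c.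
rewrite {2}/step_low /= [in LHS]/step_low /= -/(step_low _) IHs //; last first.
  by apply: surg_fnl_compat c; [exact: conn3_refl|exact: conn3_sym|exact: surgery3C].
congr (foldl _ _ _).2; congr pair.
apply: surg_fnl_comm c; [exact: conn3_refl|exact: conn3_sym|exact: conn3_refl|exact: surgery3C
 |exact: surgery3D| |]; [apply: surgery3D => //|apply: surgery3C => //]; exact: addc_closed.
Qed.

Lemma step_low_rd S S' phi s s' : fresh C S s -> fresh D S' s' -> compat (e3S S S') phi ->
  (foldl (step_high (foldl (addc C) S s)) (S', (foldl (step_low S') (S, phi) s).2) s').2 =
  (foldl (step_low (foldl (addc D) S' s')) (S, (foldl (step_high S) (S', phi) s').2) s).2.
Proof.
move=> fr; elim: s' S' phi => //= k s' IHs S' phi /(fresh_cons mD)[cS' kS' fr'] c.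
rewrite {2}/step_high /= [in RHS]/step_high /= -/(step_high _) step_low_rd1 // IHs //.
have cS : par_closed C S by case: fr.
by apply: surg_fnl_compat c; [exact: conn3_refl|exact: conn3_sym|exact: surgery3D].
Qed.

Definition tensor3 (phi psi chi : functional F 'I_N) : functional F (V3 N) :=
  [ffun T : {set V3 N} => phi (@low N @^-1: T) * psi (@mid N @^-1: T) * chi (@top N @^-1: T)].

Lemma restr_rc01 (B : {set V3 N}) S phi s : (forall v, @iota01 N v \notin B) ->
  restr (@iota01 N) B (foldl (step_low set0) (S, phi) s).2 =
  (foldl (rstep A C D) (S, restr (@iota01 N) B phi) s).2.
Proof.
move=> hB; elim: s S phi => //= i s IHs S phi; rewrite IHs {2}/rstep /=.
congr (foldl _ (_, _) _).2; apply: (@restr_surg _ _ _ (@iota01 N) _ _ _ _ _ (false, i) (true, i)) => //; first exact: iota01_inj.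
exact: conn3_low.
Qed.

Lemma restr_rd12 (B : {set V3 N}) S phi s : (forall v, @iota12 N v \notin B) ->
  restr (@iota12 N) B (foldl (step_high set0) (S, phi) s).2 =
  (foldl (rstep C D E) (S, restr (@iota12 N) B phi) s).2.
Proof.
move=> hB; elim: s S phi => //= i s IHs S phi; rewrite IHs {2}/rstep /=.
congr (foldl _ (_, _) _).2; apply: (@restr_surg _ _ _ (@iota12 N) _ _ _ _ _ (false, i) (true, i)) => //; first exact: iota12_inj.
exact: conn3_high.
Qed.

Lemma restr_rdT S phi s :
  restr (@iota12 N) set0 (foldl (step_high setT) (S, phi) s).2 =
  (foldl (rstep A D E) (S, restr (@iota12 N) set0 phi) s).2.
Proof.
elim: s S phi => //= i s IHs S phi; rewrite IHs {2}/rstep /=.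
congr (foldl _ (_, _) _).2; apply: (@restr_surg _ _ _ (@iota12 N) _ _ _ _ _ (false, i) (true, i)) => //; first exact: iota12_inj.
  by move=> v; rewrite inE.
exact: conn3_lowT.
Qed.

Lemma restr_rcT S phi s :
  restr (@iota01 N) set0 (foldl (step_low setT) (S, phi) s).2 =
  (foldl (rstep A C E) (S, restr (@iota01 N) set0 phi) s).2.
Proof.
elim: s S phi => //= i s IHs S phi; rewrite IHs {2}/rstep /=.
congr (foldl _ (_, _) _).2; apply: (@restr_surg _ _ _ (@iota01 N) _ _ _ _ _ (false, i) (true, i)) => //; first exact: iota01_inj.
  by move=> v; rewrite inE.
exact: conn3_highT.
Qed.

Lemma compat_connect (V : finType) (r : rel V) (phi : functional F V) :
  (forall u v, r u v -> mulx u phi = mulx v phi) -> compat (connect r) phi.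
Proof.
move=> h u v /connectP[s]; elim: s u => [|w s IHs] u /=; first by move=> _ ->.
by case/andP=> /h -> /IHs; apply.
Qed.

Lemma tensor3_low i (phi psi chi : functional F 'I_N) : mulx (low i) (tensor3 phi psi chi) = tensor3 (mulx i phi) psi chi.
Proof.
apply/ffunP=> T; rewrite !ffunE !inE; case: ifP => _; first by rewrite !mul0r.
by congr (phi _ * psi _ * chi _); apply/setP=> x; rewrite !inE ?xpair_eqE.
Qed.

Lemma tensor3_mid i (phi psi chi : functional F 'I_N) : mulx (mid i) (tensor3 phi psi chi) = tensor3 phi (mulx i psi) chi.
Proof.
apply/ffunP=> T; rewrite !ffunE !inE; case: ifP => _; first by rewrite mulr0 mul0r.
by congr (phi _ * psi _ * chi _); apply/setP=> x; rewrite !inE ?xpair_eqE.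
Qed.

Lemma tensor3_top i (phi psi chi : functional F 'I_N) : mulx (top i) (tensor3 phi psi chi) = tensor3 phi psi (mulx i chi).
Proof.
apply/ffunP=> T; rewrite !ffunE !inE; case: ifP => _; first by rewrite mulr0.
by congr (phi _ * psi _ * chi _); apply/setP=> x; rewrite !inE ?xpair_eqE.
Qed.

Lemma circ_l (P Q : cupd N) i : circ P Q i (par P i).
Proof. by apply: connect1; rewrite /two_rel eqxx. Qed.

Lemma circ_r (P Q : cupd N) i : circ P Q i (par Q i).
Proof. by apply: connect1; rewrite /two_rel eqxx orbT. Qed.

Lemma tensor3_compat (phi psi chi : functional F 'I_N) :
  compat (circ A C) phi -> compat (circ C D) psi -> compat (circ D E) chi ->
  compat (e3S set0 set0) (tensor3 phi psi chi).
Proof.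
move=> c1 c2 c3; apply: compat_connect => u v /orP[]/eqP<-; case: u => [[[]|] i];
  rewrite /kap3 /rho3 /= ?inE.
- by rewrite !tensor3_mid -(c2 _ _ (circ_r _ _ i)).
- by rewrite !tensor3_low -(c1 _ _ (circ_l _ _ i)).
- by rewrite !tensor3_top -(c3 _ _ (circ_l _ _ i)).
- by rewrite !tensor3_mid -(c2 _ _ (circ_l _ _ i)).
- by rewrite !tensor3_low -(c1 _ _ (circ_r _ _ i)).
- by rewrite !tensor3_top -(c3 _ _ (circ_r _ _ i)).
Qed.

Lemma run2Z (P Q R : cupd N) (a : F) (phi : functional F (V2 N)) : run2 P Q R (a *: phi) = a *: run2 P Q R phi.
Proof.
have r0 : run2 P Q R (0 : functional F (V2 N)) = 0.
  by apply: (addrI (run2 P Q R 0)); rewrite addr0 -{1}[run2 _ _ _ _]scale1r -run2_lin scaler0 addr0.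
by rewrite -[a *: phi]addr0 run2_lin r0 addr0.
Qed.

Section Three.
Variables (phi psi chi : functional F 'I_N).
Hypotheses (c1 : compat (circ A C) phi) (c2 : compat (circ C D) psi) (c3 : compat (circ D E) chi).
Let Phi := tensor3 phi psi chi.

(** With the monomial on the top line frozen, [chi] is a scalar and the low surgeries see only [phi]
    and [psi]. Their product is read on the middle line, where the next surgeries attach. *)
Lemma tensor_prodl : tensor (surg_prod A C D phi psi) chi =
  restr (@iota12 N) set0 (foldl (step_low set0) (set0, Phi) (left_ends C)).2.
Proof.
apply/ffunP=> T; set T0 := pair false @^-1: T; set T1 := pair true @^-1: T.
pose B := @top N @: T1; rewrite [LHS]ffunE [RHS]ffunE setU0 -/T0 -/T1.
have hB v : @iota01 N v \notin B by apply/imsetP=> -[? _ []]; case: v.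
have -> : @iota12 N @: T = (@iota01 N @: (pair true @: T0)) :|: B.
  apply/setP=> x; rewrite !inE; apply/imsetP/orP.
    case=> [[[] i] iT ->]; [right|left]; first by apply/imsetP; exists i; rewrite ?inE.
    by apply/imsetP; exists (true, i) => //; apply/imsetP; exists i; rewrite ?inE.
  case=> [/imsetP[_ /imsetP[i + ->] ->]|/imsetP[i + ->]]; rewrite inE => iT.
    by exists (false, i).
  by exists (true, i).
have -> (f : functional F (V3 N)) (T' : {set V2 N}) : f ((@iota01 N @: T') :|: B) = restr (@iota01 N) B f T' by rewrite ffunE.
rewrite restr_rc01 // (_ : restr (@iota01 N) B Phi = chi T1 *: tensor phi psi).
  by rewrite -/(run2 A C D _) run2Z [RHS]ffunE (surg_prodE true) // mulrC.
apply/ffunP=> T'; rewrite !ffunE [RHS]mulrC; congr (phi _ * psi _ * chi _);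
  apply/setP=> i; rewrite !inE.
- rewrite -[low i]/(iota01 (false, i)) (mem_imset _ _ (@iota01_inj N)) orbC.
  by case: imsetP => // -[].
- rewrite -[mid i]/(iota01 (true, i)) (mem_imset _ _ (@iota01_inj N)) orbC.
  by case: imsetP => // -[].
- rewrite (mem_imset _ _ (_ : injective (@top N))) ?inE; last by move=> ? ? [].
  by case: imsetP => // -[[]].
Qed.

Lemma tensor_prodr : tensor phi (surg_prod C D E psi chi) =
  restr (@iota01 N) set0 (foldl (step_high set0) (set0, Phi) (left_ends D)).2.
Proof.
apply/ffunP=> T; set T0 := pair false @^-1: T; set T1 := pair true @^-1: T.
pose B := @low N @: T0; rewrite [LHS]ffunE [RHS]ffunE setU0 -/T0 -/T1.
have hB v : @iota12 N v \notin B by apply/imsetP=> -[? _ []]; case: v => [[]].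
have -> : @iota01 N @: T = (@iota12 N @: (pair false @: T1)) :|: B.
  apply/setP=> x; rewrite !inE; apply/imsetP/orP.
    case=> [[[] i] iT ->]; [left|right]; last by apply/imsetP; exists i; rewrite ?inE.
    by apply/imsetP; exists (false, i) => //; apply/imsetP; exists i; rewrite ?inE.
  case=> [/imsetP[_ /imsetP[i + ->] ->]|/imsetP[i + ->]]; rewrite inE => iT.
    by exists (true, i).
  by exists (false, i).
have -> (f : functional F (V3 N)) (T' : {set V2 N}) : f ((@iota12 N @: T') :|: B) = restr (@iota12 N) B f T' by rewrite ffunE.
rewrite restr_rd12 // (_ : restr (@iota12 N) B Phi = phi T0 *: tensor psi chi).
  by rewrite -/(run2 C D E _) run2Z [RHS]ffunE (surg_prodE false).
apply/ffunP=> T'; rewrite !ffunE.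
transitivity (phi T0 * (psi (pair false @^-1: T') * chi (pair true @^-1: T'))) => //.
rewrite mulrA; congr (phi _ * psi _ * chi _);
  apply/setP=> i; rewrite !inE.
- rewrite (mem_imset _ _ (_ : injective (@low N))) ?inE; last by move=> ? ? [].
  by case: imsetP => // -[[[]]].
- rewrite -[mid i]/(iota12 (false, i)) (mem_imset _ _ (@iota12_inj N)) orbC.
  by case: imsetP => // -[].
- rewrite -[top i]/(iota12 (true, i)) (mem_imset _ _ (@iota12_inj N)) orbC.
  by case: imsetP => // -[].
Qed.

Theorem surg_prod_assoc :
  surg_prod A D E (surg_prod A C D phi psi) chi = surg_prod A C E phi (surg_prod C D E psi chi).
Proof.
have cl : compat (circ A D) (surg_prod A C D phi psi) by apply: surg_prod_compat.
have cr : compat (circ C E) (surg_prod C D E psi chi) by apply: surg_prod_compat.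
(* Both products are read on the middle line, the lower line of one two-line diagram and the upper
   line of the other. *)
apply/ffunP=> T; rewrite (surg_prodE false) // (surg_prodE true) //.
rewrite tensor_prodl tensor_prodr /run2 -restr_rdT -restr_rcT !ffunE !setU0.
have := step_low_rd (fresh_left_ends mC) (fresh_left_ends mD) (tensor3_compat c1 c2 c3).
rewrite !fold_left_ends // => ->; congr (fun_of_fin _ _).
by rewrite -!imset_comp; apply: eq_imset => i.
Qed.
End Three.
End Assoc.

(** * Labellings of circles *)

Section Transversal.
Variables (V : finType) (e : rel V).
Hypotheses (er : reflexive e) (es : symmetric e) (et : transitive e).
Implicit Types (T : {set V}) (l : {ffun V -> bool}) (u v w : V).

Definition ptransversal T := [forall u in T, forall v in T, e u v ==> (u == v)].
Definition missed T : {ffun V -> bool} := [ffun u => [forall v in T, ~~ e u v]].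
Definition missed_del l u : {ffun V -> bool} := [ffun w => l w && ~~ e w u].
Definition class_const l := [forall u, forall v, e u v ==> (l u == l v)].
(** Equivalent points give the same predicate, and [pick] depends only on the predicate, so this is
    a canonical point of each class. *)
Definition class_rep u := odflt u [pick v | e u v].
Definition transversal l := [set u | (class_rep u == u) && ~~ l u].

Lemma ptransversalP T : reflect {in T &, forall u v, e u v -> u = v} (ptransversal T).
Proof.
apply: (iffP forall_inP) => h u; first by move=> v uT vT uv; apply/eqP; have /forall_inP/(_ v vT)/implyP := h u uT; apply.
by move=> uT; apply/forall_inP=> v vT; apply/implyP=> uv; apply/eqP; apply: h.
Qed.

Lemma class_constP l : reflect (forall u v, e u v -> l u = l v) (class_const l).
Proof.
apply: (iffP forallP) => h u; first by move=> v uv; have /forallP/(_ v)/implyP/(_ uv)/eqP := h u.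
by apply/forallP=> v; apply/implyP=> uv; apply/eqP; apply: h.
Qed.

Lemma eqr u v w : e u v -> e u w = e v w.
Proof. by move=> uv; apply/idP/idP; apply: et; rewrite // es. Qed.

Lemma class_const_lab T : class_const (missed T).
Proof.
apply/class_constP=> u v uv; rewrite !ffunE; apply: eq_forallb_in => w _.
by rewrite (eqr _ uv).
Qed.

Lemma missed_notin T u : missed T u -> u \notin T.
Proof. by rewrite ffunE => /forall_inP h; apply/negP=> /h; rewrite er. Qed.

Lemma ptransversalU1 u T : u \notin T -> ptransversal (u |: T) = ptransversal T && missed T u.
Proof.
move=> uT; rewrite ffunE; apply/ptransversalP/andP=> [h|[/ptransversalP h /forall_inP h'] x y].
  split; first by apply/ptransversalP=> x y xT yT; apply: h; rewrite !inE ?xT ?yT orbT.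
  apply/forall_inP=> v vT; apply: contra uT => /h ->; rewrite ?inE ?eqxx ?vT ?orbT //.
rewrite !inE => /orP[/eqP->|xT] /orP[/eqP->|yT] // xy; last exact: h.
  by have := h' _ yT; rewrite xy.
by have := h' _ xT; rewrite es xy.
Qed.

Lemma missedU1 u T : missed (u |: T) = missed_del (missed T) u.
Proof.
apply/ffunP=> w; rewrite !ffunE; apply/forall_inP/andP=> [h|[/forall_inP h wu] x].
  split; last by apply: h; rewrite setU11.
  by apply/forall_inP=> x xT; apply: h; rewrite inE xT orbT.
by rewrite !inE => /orP[/eqP->|/h].
Qed.

Lemma class_rep_e u : e u (class_rep u).
Proof. by rewrite /class_rep; case: pickP => //= v; rewrite er. Qed.

Lemma class_rep_eq u v : e u v -> class_rep u = class_rep v.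
Proof.
move=> uv; rewrite /class_rep (eq_pick (fun w => eqr w uv)).
by case: pickP => // /(_ v); rewrite er.
Qed.

Lemma ptransversal_tr l : ptransversal (transversal l).
Proof. by apply/ptransversalP=> u v; rewrite !inE => /andP[/eqP ru _] /andP[/eqP rv _] /class_rep_eq; rewrite ru rv. Qed.

Lemma missed_tr l : class_const l -> missed (transversal l) = l.
Proof.
move=> /class_constP vl; apply/ffunP=> u; rewrite ffunE; apply/forall_inP/idP=> [h|lu v].
  apply: contraT => nlu; have := h (class_rep u); rewrite inE -(class_rep_eq (class_rep_e u)) eqxx -(vl _ _ (class_rep_e u)) nlu.
  by rewrite class_rep_e => /(_ isT).
by rewrite inE => /andP[_]; apply: contra => uv; rewrite -(vl _ _ uv).
Qed.

Lemma missed_tr_rep T : ptransversal T -> transversal (missed T) = class_rep @: T.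
Proof.
move=> /ptransversalP h; apply/setP=> u; rewrite inE ffunE; apply/andP/imsetP.
  case=> /eqP ru; rewrite negb_forall_in => /exists_inP[v vT]; rewrite negbK => uv.
  by exists v; rewrite // -(class_rep_eq uv).
case=> v vT ->; rewrite -(class_rep_eq (class_rep_e v)) eqxx; split=> //.
by rewrite negb_forall_in; apply/exists_inP; exists v; rewrite // negbK es class_rep_e.
Qed.

Section Fnl.
Variable F : fieldType.
Local Open Scope ring_scope.
Definition lvec := {ffun {ffun V -> bool} -> F}.
Implicit Types (f : lvec).

(* The basis vector of a labelling becomes the indicator of the sets meeting each
   circle labelled 1 (false) once and no circle labelled x (true). *)
Definition fnl_of f : functional F V := [ffun T : {set V} => if ptransversal T then f (missed T) else 0].
Definition basis_fnl l : functional F V := [ffun T : {set V} => (ptransversal T && (missed T == l))%:R].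

Lemma mulx_fnl_of u f T : mulx u (fnl_of f) T = if ptransversal T && missed T u then f (missed_del (missed T) u) else 0.
Proof.
rewrite [LHS]ffunE; case: ifPn => [uT|uT]; last by rewrite [LHS]ffunE ptransversalU1 // missedU1.
case: ifP => // /andP[_ lu]; by have := missed_notin lu; rewrite uT.
Qed.

Lemma fnl_of_compat f : compat e (fnl_of f).
Proof.
move=> u v uv; apply/ffunP=> T; rewrite !mulx_fnl_of (class_constP _ (class_const_lab T) _ _ uv).
congr (if _ then f _ else _); apply/ffunP=> w; rewrite !ffunE.
by rewrite !(es w) (eqr w uv).
Qed.

Lemma basis_fnlE l : basis_fnl l = fnl_of [ffun l' => (l' == l)%:R].
Proof. by apply/ffunP=> T; rewrite !ffunE; case: (ptransversal T). Qed.

Lemma basis_fnl_compat l : compat e (basis_fnl l).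
Proof. rewrite basis_fnlE; exact: fnl_of_compat. Qed.

Lemma basis_fnl_tr l l' : class_const l' -> basis_fnl l (transversal l') = (l' == l)%:R :> F.
Proof. by move=> vl; rewrite ffunE ptransversal_tr missed_tr. Qed.

Lemma compat_eval (phi : functional F V) T : compat e phi -> phi T = if ptransversal T then phi (transversal (missed T)) else 0.
Proof.
move=> c; case: ifPn => pT.
  rewrite missed_tr_rep // -{1}(imset_id T); apply: compat_move c _ _ _ => [||u _] //.
    by move=> u v uT vT ruv; apply: (ptransversalP _ pT) => //; apply: et (class_rep_e u) _; rewrite ruv es class_rep_e.
  exact: class_rep_e.
move: pT; rewrite negb_forall_in => /exists_inP[u uT].
rewrite negb_forall_in => /exists_inP[v vT]; rewrite negb_imply => /andP[uv nuv].
exact: compat_dup c uT vT nuv uv.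
Qed.

Lemma compat_expand (phi : functional F V) : compat e phi ->
  phi = \sum_(l | class_const l) phi (transversal l) *: basis_fnl l.
Proof.
move=> c; apply/ffunP=> T; rewrite sum_ffunE (compat_eval T c).
case: ifPn => pT; last first.
  by rewrite big1 // => l _; rewrite !ffunE (negbTE pT) /= scaler0.
rewrite (bigD1 (missed T)) ?class_const_lab //= big1 => [|l /andP[_ nl]].
  by rewrite !ffunE pT eqxx /= addr0 [_ *: _]mulr1.
by rewrite !ffunE pT /= eq_sym (negbTE nl) scaler0.
Qed.
End Fnl.
End Transversal.

(** * The surgery matrix acting on functionals *)

Section Step.
Variables (V : finType) (e e' : rel V) (p q p' : V) (F : fieldType).
Hypotheses (er : reflexive e) (es : symmetric e) (et : transitive e).
Hypotheses (er' : reflexive e') (es' : symmetric e') (et' : transitive e').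
Hypothesis sg : surgery e e' p q p'.
Implicit Types (T : {set V}) (l m : {ffun V -> bool}).

Definition entry l m : bool :=
  [&& class_const e l, class_const e' m, [forall v, ~~ (e p v || e q v) ==> (l v == m v)] &
   if ~~ e p q then (m p == (l p || l q)) && ~~ (l p && l q)
   else if l p then m p && m p' else m p != m p'].

(** Used with [r] the coarser relation, the new one for a merge and the old one for a split. A glued
    circle is missed when both parts are, and a set with at most one point on it must miss one
    part. *)
Lemma glue_lab (r r' : rel V) x y T : reflexive r' -> symmetric r' -> transitive r' ->
  (forall u v, r u v = join_rel r' x y u v) ->
  (forall v, missed r T v = if r x v then missed r' T x && missed r' T y else missed r' T v) /\
  (~~ r' x y -> ptransversal r T = ptransversal r' T && (missed r' T x || missed r' T y)).
Proof.
move=> rr rs rt rE.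
have LE u : missed r' T u = [forall v in T, ~~ r' u v] by rewrite ffunE.
have L u v : r' u v -> missed r' T u = missed r' T v by apply: class_constP; apply: class_const_lab.
split=> [v|nxy].
  rewrite [LHS]ffunE rE /join_rel rr /= [r' x v]rs.
  case: ifPn => [vxy|].
    rewrite !LE; apply/forall_inP/andP=> [h|[/forall_inP hx /forall_inP hy] w wT].
      split; apply/forall_inP=> w wT; apply: contra (h w wT); rewrite rE /join_rel => xw.
        case/or3P: vxy => [vx|yv|/andP[xy xv]]; first by rewrite (rt _ _ _ vx xw).
          by rewrite xw [r' v y]rs yv !orbT.
        by rewrite (rt _ _ _ _ xw) // rs.
      case/or3P: vxy => [vx|yv|/andP[xy xv]]; first by rewrite xw vx !orbT.
        by rewrite (rt _ _ _ _ xw) // rs.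
      by rewrite (rt _ _ _ _ (rt _ _ _ xy xw)) // rs.
    rewrite rE /join_rel !negb_or !negb_and hx // hy // !orbT !andbT.
    case/or3P: vxy => [vx|yv|/andP[xy xv]].
    - by apply: contra (hx w wT) => vw; rewrite (rt _ _ _ _ vw) // rs.
    - by apply: contra (hy w wT) => vw; rewrite (rt _ _ _ yv vw).
    - by apply: contra (hx w wT) => vw; rewrite (rt _ _ _ _ vw) // rs.
  rewrite !negb_or negb_and => /and3P[nvx nyv _]; rewrite LE.
  apply: eq_forallb_in => w _; rewrite rE /join_rel (negbTE nvx) [r' v y]rs (negbTE nyv) /=.
  by rewrite orbF.
have sub u v : r' u v -> r u v by rewrite rE /join_rel => ->.
apply/ptransversalP/andP=> [h|[/ptransversalP h lxy] u v uT vT].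
  split; first by apply/ptransversalP=> u v uT vT /sub; apply: h.
  apply: contraT; rewrite negb_or !LE !negb_forall_in => /andP[/exists_inP[u uT]].
  rewrite negbK => xu /exists_inP[v vT]; rewrite negbK => yv.
  have uv : u = v by apply: h; rewrite // rE /join_rel [r' u x]rs xu yv orbT.
  by move: nxy; rewrite (rt _ _ _ xu) // rs uv.
rewrite rE => /or3P[|/andP[ux yv]|/andP[uy xv]]; first exact: h.
  move: lxy; rewrite !LE => /orP[]/forall_inP; first by move/(_ u uT); rewrite rs ux.
  by move/(_ v vT); rewrite yv.
move: lxy; rewrite !LE => /orP[]/forall_inP; first by move/(_ v vT); rewrite xv.
by move/(_ u uT); rewrite rs uy.
Qed.

Local Open Scope ring_scope.
Definition step_vec (f : lvec V F) : lvec V F := [ffun m => \sum_l f l * (entry l m)%:R].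

Definition set1v m b : {ffun V -> bool} := [ffun v => if e p v then b else m v].
Definition set2v m b1 b2 : {ffun V -> bool} := [ffun v => if e p v then b1 else if e q v then b2 else m v].

Lemma sub_split u v : e p q -> e' u v -> e u v.
Proof. by case: sg => _ _ h /h -> uv; rewrite /join_rel uv. Qed.

(** Away from the circle being split the input labelling must agree with [m], so only its value on
    that circle is free and the sum has two terms. *)
Lemma step_split f m : e p q -> class_const e' m ->
  step_vec f m = (m p && m p')%:R * f (set1v m true) + (m p != m p')%:R * f (set1v m false).
Proof.
move=> epq vm; have inj : injective (set1v m).
  by move=> b b' /ffunP/(_ p); rewrite !ffunE er.
have epp : e p p' by case: sg => _ _ h; rewrite h // /join_rel !er' orbT.
have vs b : class_const e (set1v m b).
  apply/class_constP=> u v uv; rewrite !ffunE (es p u) (es p v) -(eqr es et _ uv) es; case: ifPn => // np.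
  have nu : ~~ e u p by rewrite es.
  have nu' : ~~ e u p' by apply: contra nu => h; apply: et h _; rewrite es.
  move: uv; case: sg => _ _ h; rewrite h // /join_rel; case/or3P=> [|/andP[h' _]|/andP[h' _]].
  - exact: (class_constP _ _ vm).
  - by rewrite (sub_split epq h') in nu.
  - by rewrite (sub_split epq h') in nu'.
have eE b : entry (set1v m b) m = if b then m p && m p' else m p != m p'.
  rewrite /entry vs vm epq /= !ffunE er /= (_ : [forall v, _]) //.
  by apply/forallP=> v; apply/implyP; rewrite negb_or ffunE => /andP[/negbTE->].
rewrite ffunE (bigID (mem (set1v m @: setT))) /= [X in _ + X]big1 ?addr0; last first.
  move=> l nl; rewrite (_ : entry l m = false) ?mulr0 //; apply/negP.
  case/and4P=> /class_constP vl _ /forallP h _; case/negP: nl; apply/imsetP; exists (l p) => //.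
  apply/ffunP=> v; rewrite ffunE; case: ifPn => [/vl//|npv].
  have /implyP/(_ _)/eqP-> // := h v; rewrite negb_or npv /=.
  by apply: contra npv => /(et epq).
rewrite big_imset /=; last by move=> b b' _ _; apply: inj.
rewrite (eq_bigl xpredT) ?big_bool; last by move=> b; rewrite inE.
by rewrite !eE mulrC [X in _ + X]mulrC.
Qed.

Lemma step_merge f m : ~~ e p q -> class_const e' m ->
  step_vec f m = if m p then f (set2v m true false) + f (set2v m false true) else f (set2v m false false).
Proof.
move=> epq vm.
have inj : injective (fun bb : bool * bool => set2v m bb.1 bb.2).
  move=> [b1 b2] [c1 c2] /= h; move/ffunP: (h) => /(_ p); move/ffunP: h => /(_ q).
  by rewrite !ffunE !er (negbTE epq) => -> ->.
have vs b1 b2 : class_const e (set2v m b1 b2).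
  apply/class_constP=> u v uv; rewrite !ffunE !(es p) !(es q) -!(eqr es et _ uv).
  case: ifPn => // np; case: ifPn => // nq; apply: (class_constP _ _ vm).
  by case: sg => _ h _; rewrite h // /join_rel uv.
have eE b1 b2 : entry (set2v m b1 b2) m = (m p == (b1 || b2)) && ~~ (b1 && b2).
  rewrite /entry vs vm epq /= !ffunE !er (negbTE epq) /= (_ : [forall v, _]) //.
  by apply/forallP=> v; apply/implyP; rewrite negb_or ffunE => /andP[/negbTE-> /negbTE->].
rewrite ffunE (bigID (mem ((fun bb : bool * bool => set2v m bb.1 bb.2) @: setT))) /=.
rewrite [X in _ + X]big1 ?addr0; last first.
  move=> l nl; rewrite (_ : entry l m = false) ?mulr0 //; apply/negP.
  case/and4P=> /class_constP vl _ /forallP h _; case/negP: nl; apply/imsetP; exists (l p, l q) => //.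
  apply/ffunP=> v; rewrite ffunE /=; case: ifPn => [/vl//|npv]; case: ifPn => [/vl//|nqv].
  by have /implyP/(_ _)/eqP-> // := h v; rewrite negb_or npv.
rewrite big_imset /=; last by move=> b b' _ _; apply: inj.
rewrite (eq_bigl xpredT); last by move=> b; rewrite inE.
rewrite -(pair_big predT predT (fun b1 b2 => f (set2v m b1 b2) * (entry (set2v m b1 b2) m)%:R)) /=.
rewrite !big_bool !eE /=; case: (m p); rewrite /= ?mulr0 ?mulr1 ?add0r ?addr0 //.
Qed.

Lemma fnl_of_step f : fnl_of e' (step_vec f) = surg_fnl e p q (fnl_of e f).
Proof.
apply/ffunP=> T; rewrite /surg_fnl ffunE; case: (boolP (e p q)) => epq.
  have [h0 _ /(_ epq) h] := sg.
  have [gl /(_ _) gp] := glue_lab T er' es' et' h.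
  have {gp} gp : ptransversal e T = ptransversal e' T && (missed e' T p || missed e' T p') by apply: gp; rewrite h0 epq.
  rewrite step_split ?class_const_lab // [RHS]ffunE gp; case: (ptransversal e' T) => //=.
  have -> : missed e T = set1v (missed e' T) (missed e' T p && missed e' T p').
    by apply/ffunP=> v; rewrite gl [RHS]ffunE.
  case: (missed e' T p); case: (missed e' T p'); rewrite /= ?mul1r ?mul0r ?add0r ?addr0 //.
have [_ /(_ epq) h _] := sg.
have [gl /(_ epq) gp] := glue_lab T er es et h.
rewrite step_merge ?class_const_lab // [RHS]ffunE !mulx_fnl_of // gp; case: (ptransversal e T); last by rewrite addr0.
have ep : e' p p by rewrite er'.
have gpp := gl p; rewrite ep in gpp; rewrite gpp /=.
have lE b1 b2 : set2v (missed e' T) b1 b2 = [ffun v => if e p v then b1 else if e q v then b2 else missed e T v].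
  apply/ffunP=> v; rewrite [LHS]ffunE [RHS]ffunE; case: ifPn => // npv; case: ifPn => // nqv.
  by rewrite gl h /join_rel er (negbTE npv) (negbTE nqv) (negbTE epq).
have dp : missed_del e (missed e T) p = set2v (missed e' T) false (missed e T q).
  apply/ffunP=> v; rewrite lE [LHS]ffunE [RHS]ffunE (es v p); case: ifP => pv; rewrite ?andbF ?andbT //.
  by case: ifP => // qv; rewrite (class_constP _ _ (class_const_lab es et T) _ _ qv).
have dq : missed_del e (missed e T) q = set2v (missed e' T) (missed e T p) false.
  apply/ffunP=> v; rewrite lE [LHS]ffunE [RHS]ffunE (es v q); case: ifPn => pv.
    rewrite (class_constP _ _ (class_const_lab es et T) _ _ pv) (_ : e q v = false) ?andbT //.
    by apply/negP=> qv; case/negP: epq; apply: et pv _; rewrite es.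
  by case: ifP => qv; rewrite ?andbF ?andbT.
rewrite dp dq; case: (missed e T p); case: (missed e T q); rewrite /= ?add0r ?addr0 // addrC //.
Qed.
End Step.

Section Labels.
Variable N : nat.
Implicit Types (A C D : cupd N) (S : {set 'I_N}) (w : word N) (i j : 'I_N).

Definition circle_label A D w : {ffun 'I_N -> bool} :=
  [ffun i => w [arg min_(j < i | circ A D i j) nat_of_ord j]].

Definition leftmost A D i : 'I_N := [arg min_(j < i | circ A D i j) nat_of_ord j].

Lemma circ_refl A D i : circ A D i i. Proof. exact: connect0. Qed.

Lemma circ_trans A D : transitive (circ A D). Proof. exact: connect_trans. Qed.

Lemma circ_sym A D : matching A -> matching D -> symmetric (circ A D).
Proof. by move=> mA mD; apply: two_rel_sym; apply: parK. Qed.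

Lemma leftmostP A D i : circ A D i (leftmost A D i) /\ forall j, circ A D i j -> leftmost A D i <= j.
Proof. by rewrite /leftmost; case: arg_minnP => [|j ij h]; [exact: connect0|split]. Qed.

Lemma leftmost_eq A D i j : circ A D i j -> (forall k, circ A D i k -> j <= k) -> leftmost A D i = j.
Proof.
have [h1 h2] := leftmostP A D i; move=> ij h; apply: val_inj; apply/eqP; rewrite eqn_leq.
by rewrite h2 // h.
Qed.

Lemma leftmost_circ A D i j : matching A -> matching D -> circ A D i j -> leftmost A D i = leftmost A D j.
Proof.
move=> mA mD ij; have [h1 h2] := leftmostP A D j; apply: leftmost_eq => [|k ik].
  exact: circ_trans ij h1.
by apply: h2; apply: circ_trans ik; rewrite circ_sym.
Qed.

Lemma circle_label_vlab A D w : matching A -> matching D -> class_const (circ A D) (circle_label A D w).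
Proof.
by move=> mA mD; apply/class_constP=> i j ij; rewrite !ffunE -!/(leftmost _ _ _) (leftmost_circ mA mD ij).
Qed.

Section Lev.
Variables (A C D : cupd N).
Hypotheses (mA : matching A) (mC : matching C) (mD : matching D).

Lemma orient_lab_set0 (la mu : word N) b i :
  orient_lab A C D set0 (fun v => if v.1 then mu v.2 else la v.2) (b, i) =
  if b then circle_label C D mu i else circle_label A C la i.
Proof.
rewrite ffunE; case: arg_minnP => [|[c j] h1 h2]; first exact: connect0.
move: h1; rewrite -/(conn2 A C D _ _ _) conn2_set0 // => /andP[/eqP<-] /= ij.
have {}h2 k : (if b then circ C D i k else circ A C i k) -> j <= k.
  move=> h; apply: (h2 (b, k)); by rewrite -/(conn2 A C D _ _ _) conn2_set0 // eqxx.
by case: b ij h2 => ij h2; rewrite ffunE -/(leftmost _ _ _) (leftmost_eq ij).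
Qed.

Lemma orient_lab_setT (nu : word N) b i :
  orient_lab A C D setT (fun v => nu v.2) (b, i) = circle_label A D nu i.
Proof.
rewrite ffunE; case: arg_minnP => [|[c j] h1 h2]; first exact: connect0.
move: h1; rewrite -/(conn2 A C D _ _ _) conn2_setT // => /= ij.
rewrite ffunE -/(leftmost _ _ _) (leftmost_eq ij) // => k ik.
by apply: (h2 (true, k)); rewrite -/(conn2 A C D _ _ _) conn2_setT.
Qed.
End Lev.
End Labels.

(** * Khovanov's coefficients as values of functionals *)

Section KhCoef.
Local Open Scope ring_scope.
Variables (F : fieldType) (N : nat) (A C D : cupd N).
Hypotheses (mA : matching A) (mC : matching C) (mD : matching D).
Implicit Types (S : {set 'I_N}) (s : seq 'I_N) (la mu nu : word N).

Lemma surg_entryE S i l l' : surg_entry F A C D S (addc C S i) i (par C i) l l' =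
  (entry (conn2 A C D S) (conn2 A C D (addc C S i)) (false, i) (true, i) (false, par C i) l l')%:R.
Proof.
rewrite /surg_entry /entry /valid -/(class_const (conn2 A C D S) l) -/(class_const (conn2 A C D (addc C S i)) l').
rewrite /conn2; case: (class_const _ _) => //=; case: (class_const _ _) => //=.
by case: [forall v, _] => //=; case: (~~ _) => //; case: (l _).
Qed.

Lemma surg_stepE S f i : par_closed C S -> surg_step A C D (S, f) i =
  (addc C S i, step_vec (conn2 A C D S) (conn2 A C D (addc C S i)) (false, i) (true, i) (false, par C i) f) :> _ * kvec F N.
Proof.
move=> cS; rewrite /surg_step /= parP // -/(addc C S i); congr pair.
by apply/ffunP=> l'; rewrite !ffunE; apply: eq_bigr => l _; rewrite surg_entryE.
Qed.

Lemma fold_surg_step S (f : kvec F N) s : fresh C S s ->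
  let st := foldl (surg_step A C D) (S, f) s in
  st.1 = foldl (addc C) S s /\
  fnl_of (conn2 A C D st.1) st.2 = (foldl (rstep A C D) (S, fnl_of (conn2 A C D S) f) s).2.
Proof.
elim: s S f => //= i s IHs S f /(fresh_cons mC)[cS iS fr].
rewrite surg_stepE // /rstep /=.
set g := step_vec _ _ _ _ _ f.
rewrite (_ : surg_fnl _ _ _ _ = fnl_of (conn2 A C D (addc C S i)) g); first exact: IHs.
apply/esym/fnl_of_step; [exact: conn2_refl|exact: conn2_sym|exact: conn2_trans|exact: conn2_refl| |exact: conn2_trans|].
  by apply: conn2_sym => //; apply: addc_closed.
exact: surgery2.
Qed.

Lemma fnl_of_init la mu :
  fnl_of (conn2 A C D set0) [ffun l => (l == orient_lab A C D set0 (fun v => if v.1 then mu v.2 else la v.2))%:R : F] =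
  tensor (basis_fnl (circ A C) F (circle_label A C la)) (basis_fnl (circ C D) F (circle_label C D mu)).
Proof.
apply/ffunP=> T; rewrite [RHS]ffunE [LHS]ffunE [X in if _ then X else _]ffunE ![basis_fnl _ _ _ _]ffunE.
set T0 := pair false @^-1: T; set T1 := pair true @^-1: T.
have -> : ptransversal (conn2 A C D set0) T = ptransversal (circ A C) T0 && ptransversal (circ C D) T1.
  apply/ptransversalP/andP=> [h|[/ptransversalP h0 /ptransversalP h1] [b i] [b' j] iT jT].
    split; apply/ptransversalP=> i j; rewrite !inE => iT jT ij.
      by have [] : (false, i) = (false, j) by apply: h; rewrite ?conn2_set0.
    by have [] : (true, i) = (true, j) by apply: h; rewrite ?conn2_set0.
  rewrite conn2_set0 // => /andP[/eqP eb]; case: b eb iT jT => <- iT jT ij; congr pair.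
    by apply: h1; rewrite ?inE.
  by apply: h0; rewrite ?inE.
have L b i : missed (conn2 A C D set0) T (b, i) = if b then missed (circ C D) T1 i else missed (circ A C) T0 i.
  rewrite ffunE; case: b; rewrite ffunE; apply/forall_inP/forall_inP=> h.
  - by move=> j; rewrite inE => /h; rewrite conn2_set0.
  - by move=> [[] j] jT; rewrite conn2_set0 //=; apply: h; rewrite inE.
  - by move=> j; rewrite inE => /h; rewrite conn2_set0.
  - by move=> [[] j] jT; rewrite conn2_set0 //=; apply: h; rewrite inE.
have -> : (missed (conn2 A C D set0) T == orient_lab A C D set0 (fun v => if v.1 then mu v.2 else la v.2)) =
   (missed (circ A C) T0 == circle_label A C la) && (missed (circ C D) T1 == circle_label C D mu).
  apply/eqP/andP=> [/ffunP h|[/eqP h0 /eqP h1]].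
    split; apply/eqP/ffunP=> i.
      by have := h (false, i); rewrite L orient_lab_set0.
    by have := h (true, i); rewrite L orient_lab_set0.
  by apply/ffunP=> -[b i]; rewrite L orient_lab_set0 // h0 h1.
by case: (ptransversal _ _); case: (ptransversal _ _); case: (missed _ _ == _); case: (missed _ _ == _); rewrite /= ?mulr1 ?mulr0.
Qed.

Definition word_fnl P Q (w : word N) : functional F 'I_N := basis_fnl (circ P Q) F (circle_label P Q w).

(** Evaluation at a transversal of the circles labelled 1 extracts the coefficient of a labelling,
    so statements about coefficients can be proved for functionals. *)
Lemma kh_coefE la mu nu :
  kh_coef F A C D la mu nu = surg_prod A C D (word_fnl A C la) (word_fnl C D mu) (transversal (circ A D) (circle_label A D nu)).
Proof.
rewrite /kh_coef; set f0 := finfun _; have := fold_surg_step f0 (fresh_left_ends mC).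
rewrite fold_left_ends //; set st := foldl _ _ _; move=> [-> H].
rewrite ffunE /run2 -fnl_of_init -/f0 -H ffunE.
have -> : ptransversal (conn2 A C D setT) (pair false @: transversal (circ A D) (circle_label A D nu)).
  apply/ptransversalP=> _ _ /imsetP[i iT ->] /imsetP[j jT ->]; rewrite conn2_setT // => ij; congr pair.
  by apply: (ptransversalP _ _ (ptransversal_tr _ _ _ _)) iT jT ij; [exact: circ_refl|exact: circ_sym|exact: circ_trans].
congr (st.2 _); apply/ffunP=> -[b i]; rewrite orient_lab_setT //.
have /ffunP/(_ i) <- := missed_tr (@circ_refl _ A D) (circ_sym mA mD) (@circ_trans _ A D) (circle_label_vlab nu mA mD).
rewrite !ffunE; apply/forall_inP/forall_inP=> h j.
  by case/imsetP=> k kT ->; rewrite conn2_setT // h.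
by move=> jT; have := h (false, j); rewrite conn2_setT // imset_f // => ->.
Qed.
End KhCoef.

(** * Unit and anti-involution *)

Section Orient.
Variable N : nat.
Implicit Types (A C D : cupd N) (w : word N) (i j : 'I_N).

Lemma orientedP d w : matching d -> reflect (forall i, w (par d i) = ~~ w i) (@oriented N d w).
Proof.
move=> md; apply: (iffP andP) => [[/forallP h _] i|h].
  have /forallP/(_ (par d i)) := h i; rewrite parE // eqxx /=.
  by case: (w i); case: (w (par d i)).
split; apply/forallP=> i; apply/forallP=> j.
  by apply/implyP; rewrite parE // => /eqP<-; rewrite h; case: (w i).
by rewrite parP.
Qed.

Definition co_oriented A D w := oriented A w && oriented D w.

Section Pair.
Variables (A D : cupd N).
Hypotheses (mA : matching A) (mD : matching D).

(** Orientation and parity both flip along every arc. Hence an orienting word is the same as a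
    labelling of the circles, and [word_of] is the inverse of [circle_label]. *)
Lemma co_oriented_circ w i j : co_oriented A D w -> circ A D i j -> w j (+) odd j = w i (+) odd i.
Proof.
case/andP=> /(orientedP _ mA) oA /(orientedP _ mD) oD /connectP[s].
elim: s i => [|k s IHs] i /=; first by move=> _ ->.
case/andP=> ik sp jE; rewrite (IHs _ sp jE).
by case/orP: ik => /eqP<-; rewrite ?oA ?oD par_odd // addNb addbN negbK.
Qed.

Lemma circle_labelE w i : circle_label A D w i = w (leftmost A D i). Proof. by rewrite ffunE. Qed.

Lemma co_oriented_word w i : co_oriented A D w -> w i = circle_label A D w i (+) odd (leftmost A D i) (+) odd i.
Proof.
move=> ow; rewrite circle_labelE (co_oriented_circ ow (leftmostP A D i).1).
by case: (w i); case: (odd i).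
Qed.

Definition word_of (l : {ffun 'I_N -> bool}) : word N := [ffun i => l i (+) odd (leftmost A D i) (+) odd i].

Lemma word_of_olab w : co_oriented A D w -> word_of (circle_label A D w) = w.
Proof. by move=> ow; apply/ffunP=> i; rewrite ffunE -co_oriented_word. Qed.

Lemma word_of_orie l : class_const (circ A D) l -> co_oriented A D (word_of l).
Proof.
move=> /class_constP vl; apply/andP; split; [apply/(orientedP _ mA)|apply/(orientedP _ mD)] => i; rewrite !ffunE par_odd //.
  by rewrite -(vl _ _ (circ_l A D i)) -(leftmost_circ mA mD (circ_l A D i)) addbN.
by rewrite -(vl _ _ (circ_r A D i)) -(leftmost_circ mA mD (circ_r A D i)) addbN.
Qed.

Lemma circle_label_word_of l : class_const (circ A D) l -> circle_label A D (word_of l) = l.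
Proof.
move=> /class_constP vl; apply/ffunP=> i; rewrite circle_labelE ffunE.
have h := (leftmostP A D i).1; rewrite -(vl _ _ h) -(leftmost_circ mA mD h).
by case: (l i); case: (odd _).
Qed.

Lemma circle_label_inj w w' : co_oriented A D w -> co_oriented A D w' -> circle_label A D w = circle_label A D w' -> w = w'.
Proof. by move=> o o' e; rewrite -(word_of_olab o) e word_of_olab. Qed.
End Pair.
End Orient.

Section Kh.
Local Open Scope ring_scope.
Variables (F : fieldType) (N : nat).
Implicit Types (A C D E : cupd N) (la mu nu rho : word N).
Local Notation bf := (word_fnl F).
Local Notation kh := (kh_coef F).

Lemma functionalZ (V : finType) (a : F) (phi : functional F V) T : (a *: phi) T = a * phi T.
Proof. by rewrite ffunE. Qed.

Lemma word_fnl_compat A D w : matching A -> matching D -> compat (circ A D) (bf A D w).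
Proof. by move=> mA mD; apply: basis_fnl_compat; [exact: circ_refl|exact: circ_sym|exact: circ_trans]. Qed.

Lemma word_expand A D (phi : functional F 'I_N) : matching A -> matching D -> compat (circ A D) phi ->
  phi = \sum_(w | co_oriented A D w) phi (transversal (circ A D) (circle_label A D w)) *: bf A D w.
Proof.
move=> mA mD c; rewrite {1}(compat_expand (@circ_refl _ A D) (circ_sym mA mD) (@circ_trans _ A D) c).
rewrite (reindex_onto (circle_label A D) (word_of A D)) /=; last by move=> l /(circle_label_word_of mA mD).
apply: eq_big => [w|w _]; last by [].
rewrite circle_label_vlab //=; apply/eqP/idP=> [<-|]; last exact: word_of_olab.
by apply: word_of_orie => //; apply: circle_label_vlab.
Qed.

Lemma surg_prod0l A C D (psi : functional F 'I_N) : surg_prod A C D 0 psi = 0.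
Proof. by have /esym/(canRL (addrK _)) := surg_prod_linl A C D 1 0 0 psi; rewrite !scale1r addr0 subrr. Qed.

Lemma surg_prod0r A C D (phi : functional F 'I_N) : surg_prod A C D phi 0 = 0.
Proof. by have /esym/(canRL (addrK _)) := surg_prod_linr A C D 1 phi 0 0; rewrite !scale1r addr0 subrr. Qed.

Lemma surg_prod_suml A C D (I : finType) (P : pred I) (a : I -> F) (phi : I -> functional F 'I_N) psi :
  surg_prod A C D (\sum_(i | P i) a i *: phi i) psi = \sum_(i | P i) a i *: surg_prod A C D (phi i) psi.
Proof.
elim/big_rec2: _ => [|i x y _ <-]; first exact: surg_prod0l.
exact: surg_prod_linl.
Qed.

Lemma surg_prod_sumr A C D (I : finType) (P : pred I) (a : I -> F) phi (psi : I -> functional F 'I_N) :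
  surg_prod A C D phi (\sum_(i | P i) a i *: psi i) = \sum_(i | P i) a i *: surg_prod A C D phi (psi i).
Proof.
elim/big_rec2: _ => [|i x y _ <-]; first exact: surg_prod0r.
exact: surg_prod_linr.
Qed.

Theorem kh_assoc A C D E la mu rho nu :
  matching A -> matching C -> matching D -> matching E ->
  \sum_(k | co_oriented A D k) kh A C D la mu k * kh A D E k rho nu =
  \sum_(k | co_oriented C E k) kh C D E mu rho k * kh A C E la k nu.
Proof.
move=> mA mC mD mE.
have c1 := word_fnl_compat la mA mC; have c2 := word_fnl_compat mu mC mD; have c3 := word_fnl_compat rho mD mE.
have cl := surg_prod_compat mA mC mD c1 c2; have cr := surg_prod_compat mC mD mE c2 c3.
set T := transversal (circ A E) (circle_label A E nu).
have hl : surg_prod A D E (surg_prod A C D (bf A C la) (bf C D mu)) (bf D E rho) T =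
    \sum_(k | co_oriented A D k) kh A C D la mu k * kh A D E k rho nu.
  rewrite {1}(word_expand mA mD cl) surg_prod_suml sum_ffunE; apply: eq_bigr => k _.
  by rewrite functionalZ !kh_coefE.
have hr : surg_prod A C E (bf A C la) (surg_prod C D E (bf C D mu) (bf D E rho)) T =
    \sum_(k | co_oriented C E k) kh C D E mu rho k * kh A C E la k nu.
  rewrite {1}(word_expand mC mE cr) surg_prod_sumr sum_ffunE; apply: eq_bigr => k _.
  by rewrite functionalZ !kh_coefE.
rewrite (surg_prod_assoc mA mC mD mE c1 c2 c3) in hl; exact: etrans (esym hl) hr.
Qed.

Lemma circC A D : circ A D = circ D A.
Proof.
apply: functional_extensionality => i; apply: functional_extensionality => j.
by apply: eq_connect => x y; rewrite /two_rel orbC.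
Qed.

Definition flip (u : V2 N) : V2 N := (~~ u.1, u.2).

Lemma flip_inj : injective flip.
Proof. by move=> [b i] [b' j] [/(can_inj negbK) -> ->]. Qed.

Lemma conn2_flip A C D S u v : conn2 A C D S (flip u) (flip v) = conn2 D C A S u v.
Proof.
have gen A' D' x y : conn2 A' C D' S x y -> conn2 D' C A' S (flip x) (flip y).
  apply: (@connect_hom _ _ _ _ flip) => {}x {}y xy; apply: connect1; move: xy.
  by case: x => [[] i]; case: y => [[] j].
have fK x : flip (flip x) = x by case: x => [[] i].
by apply/idP/idP=> /gen //; rewrite !fK.
Qed.

(** A surgery is symmetric in its two points, since x_p + x_q is, and the result may be read on
    either line. *)
Lemma surg_prod_flip A C D (phi psi : functional F 'I_N) : matching A -> matching C -> matching D ->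
  compat (circ A C) phi -> compat (circ C D) psi ->
  surg_prod A C D phi psi = surg_prod D C A psi phi.
Proof.
move=> mA mC mD c1 c2.
have h0 v : flip v \notin (set0 : {set V2 N}) by rewrite inE.
have stepE S Phi s : fresh C S s -> restr flip set0 (foldl (rstep A C D) (S, Phi) s).2 =
   (foldl (rstep D C A) (S, restr flip set0 Phi) s).2.
  elim: s S Phi => //= i s IHs S Phi /(fresh_cons mC)[cS iS fr]; rewrite IHs // {2}/rstep /=.
  congr (foldl _ (_, _) _).2; rewrite /surg_fnl addrC (conn2_sym mA mC mD) //.
  rewrite -(restr_X flip_inj h0) -(restr_X flip_inj h0) /flip /=.
  rewrite -[(true, i)]/(flip (false, i)) -[(false, i) in X in if X then _ else _]/(flip (true, i)).
  rewrite conn2_flip; case: ifP => // _; by apply/ffunP=> T; rewrite !ffunE.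
apply/ffunP=> T; rewrite (surg_prodE true) // [RHS]ffunE.
have -> : pair true @: T = flip @: (pair false @: T) by rewrite -imset_comp; apply: eq_imset.
have -> (f : functional F (V2 N)) (T' : {set V2 N}) : f (flip @: T') = restr flip set0 f T' by rewrite ffunE setU0.
rewrite /run2 stepE; last exact: fresh_left_ends.
suff -> : restr flip set0 (tensor phi psi) = tensor psi phi by [].
apply/ffunP=> T'; rewrite !ffunE mulrC setU0.
by congr (psi _ * phi _); apply/setP=> i; rewrite !inE;
  [rewrite -[(true, i)]/(flip (false, i))|rewrite -[(false, i)]/(flip (true, i))];
  rewrite (mem_imset _ _ flip_inj).
Qed.

Theorem kh_flip A C D la mu nu : matching A -> matching C -> matching D ->
  kh A C D la mu nu = kh D C A mu la nu.
Proof.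
move=> mA mC mD; rewrite (kh_coefE F mA mC mD) (kh_coefE F mD mC mA).
rewrite (surg_prod_flip mA mC mD (word_fnl_compat la mA mC) (word_fnl_compat mu mC mD)).
by rewrite /word_fnl /circle_label (circC A C) (circC C D) (circC A D).
Qed.

Section Unit.
Variables (A D : cupd N).
Hypotheses (mA : matching A) (mD : matching D).

Lemma circ_self i j : circ A A i j = (i == j) || (par A i == j).
Proof.
apply/idP/orP=> [/connectP[s]|[/eqP<-|/eqP<-]]; last first.
- exact: circ_l.
- exact: circ_refl.
elim: s i => [|k s IHs] i /=; first by move=> _ ->; left.
case/andP=> /orP[]/eqP ki sp jE; case: (IHs k sp jE) => /eqP<-; rewrite -ki ?parK ?eqxx; auto.
Qed.

(** As long as a cup of [A] is uncut, its two ends on the lower line form a circle by themselves. So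
    all surgeries of a product with the unit are merges. *)
Lemma conn2_unit_sep (S : {set 'I_N}) i : i \notin S -> par_closed A S -> ~~ conn2 A A D S (false, i) (true, i).
Proof.
move=> iS cS; pose P (u : V2 N) := ~~ u.1 && ((u.2 == i) || (u.2 == par A i)).
have step u v : kedge A A D S u v -> P u -> P v.
  move=> uv /andP[/negbTE u1 u2]; move: uv; rewrite /kedge u1.
  case: v => [[] k] /=; rewrite ?parE //.
    by case/andP=> _; case/orP: u2 => /eqP->; rewrite ?cS (negbTE iS).
  move=> uv; have /eqP<- : par A u.2 == k by case/orP: uv => // /andP[].
  by rewrite /P /=; case/orP: u2 => /eqP->; rewrite ?parK ?eqxx ?orbT.
have closedP u v : connect (kedge A A D S) u v -> P u -> P v.
  case/connectP=> s; elim: s u => [|w s IHs] u /=; first by move=> _ ->.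
  by case/andP=> /step uw sp vE /uw; apply: IHs.
by apply/negP=> /closedP; rewrite /P /= eqxx => /(_ isT).
Qed.

Definition X01 (s : seq 'I_N) (Phi : functional F (V2 N)) : functional F (V2 N) :=
  foldl (fun f i => mulx (false, i) f + mulx (true, i) f) Phi s.

Lemma rstep_unit (S : {set 'I_N}) Phi s : fresh A S s -> (foldl (rstep A A D) (S, Phi) s).2 = X01 s Phi.
Proof.
elim: s S Phi => //= i s IHs S Phi /(fresh_cons mA)[cS iS fr].
by rewrite IHs // /rstep /= /surg_fnl (negbTE (conn2_unit_sep iS cS)).
Qed.

Definition lowdeg m (Phi : functional F (V2 N)) := forall T, Phi T != 0 -> #|pair false @^-1: T| = m.

Lemma X01D s Phi Psi : X01 s (Phi + Psi) = X01 s Phi + X01 s Psi.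
Proof. by elim: s Phi Psi => //= i s IHs Phi Psi; rewrite !mulxD addrACA IHs. Qed.

(* Of the terms of the product of the mulx (false, i) + mulx (true, i), only the one
   putting a point on every lower circle survives evaluation on the upper line. *)
Lemma X01_lowdeg s Phi m (T : {set 'I_N}) : (size s <= m)%N -> lowdeg m Phi ->
  X01 s Phi (pair true @: T) =
  if m == size s then foldl (fun f i => mulx (false, i) f) Phi s (pair true @: T) else 0.
Proof.
elim: s m Phi => [|i s IHs] m Phi /= lem ld.
  case: (eqVneq m 0%N) => // nm; apply: contraNeq nm => /ld <-; rewrite cards_eq0.
  by apply/eqP/setP=> j; rewrite !inE; apply/imsetP=> -[? _ []].
have ld1 : lowdeg m (mulx (true, i) Phi).
  move=> T'; rewrite ffunE; case: ifP => _; rewrite ?eqxx // => /ld <-; congr #|pred_of_set _|.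
  by apply/setP=> j; rewrite !inE.
have ld0 : lowdeg m.-1 (mulx (false, i) Phi).
  move=> T'; rewrite ffunE; case: ifPn => [_|iT]; rewrite ?eqxx // => /ld <-.
  rewrite [in RHS](cardsD1 i) !inE eqxx /=; congr #|pred_of_set _|.
  by apply/setP=> j; rewrite !inE xpair_eqE /=; case: eqVneq => // ->; rewrite (negbTE iT).
rewrite X01D [LHS]ffunE (IHs m.-1) //; last by lia.
rewrite (IHs m) //; last by lia.
have -> : (m == size s) = false by lia.
have -> : (m.-1 == size s) = (m == (size s).+1) by lia.
exact: addr0.
Qed.

(** Since [al] is \vee at the left ends, every small circle has label 1. Its functional sees exactly
    one point per small circle, and in the expanded product of the x_p + x_q this selects the term
    with all points on the lower line. *)
Lemma surg_prod_unit (al : word N) (phi : functional F 'I_N) : (forall i : 'I_N, (i < par A i)%N -> al i = false) -> compat (circ A D) phi ->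
  surg_prod A A D (bf A A al) phi = phi.
Proof.
move=> a0 c; apply/ffunP=> T; rewrite (surg_prodE true) //; last exact: word_fnl_compat.
have o0 i : circle_label A A al i = false.
  have [h1 h2] := leftmostP A A i; rewrite ffunE -/(leftmost _ _ _); apply: a0.
  rewrite ltn_neqAle eq_sym (inj_eq val_inj) par_neq //=; apply: h2.
  by apply: circ_trans h1 _; apply: circ_l.
have ld : lowdeg (size (left_ends A)) (tensor (bf A A al) phi).
  move=> T'; rewrite !ffunE; case: (boolP (ptransversal _ _ && _)); last by rewrite /= mul0r eqxx.
  set B := pair false @^-1: T'; case/andP=> /ptransversalP pB /eqP lB _.
  (* Replacing a vertex by the left end of its cup counts the points of [B] by cups, each of which
     is met exactly once. *)
  have : {in B &, injective (fun i : 'I_N => if (i < par A i)%N then i else par A i)}.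
    move=> i j iB jB; case: ifP => _; case: ifP => _ h.
    - by [].
    - by apply: pB; rewrite // h circ_sym // circ_l.
    - by apply: pB; rewrite // -h circ_l.
    - by apply: (inv_inj (parK mA)).
  move/card_in_imset => <-; rewrite -(card_uniqP _); last by rewrite filter_uniq ?enum_uniq.
  apply: eq_card => j; rewrite mem_left_ends //; apply/imsetP/idP.
    case=> i _ ->; case: ifP => // /negbT; rewrite -leqNgt parK // leq_eqVlt.
    by rewrite (inj_eq val_inj) (negbTE (par_neq mA i)).
  move=> lt; have := o0 j; rewrite -lB ffunE => /negbT; rewrite negb_forall_in.
  case/exists_inP=> k kB; rewrite negbK circ_self => /orP[]/eqP E; exists k; rewrite // -E ?lt //.
  by rewrite parK // ltnNge (ltnW lt).
rewrite /run2 rstep_unit; last exact: fresh_left_ends.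
rewrite (X01_lowdeg T (leqnn _) ld) eqxx.
have -> (th : functional F 'I_N) s : foldl (fun f i => mulx (false, i) f) (tensor th phi) s =
     tensor (foldl (fun f i => mulx i f) th s) phi.
  by elim: s th => //= i s IHs th; rewrite tensor_X0 IHs.
rewrite ffunE (_ : pair false @^-1: _ = set0); last by apply/setP=> j; rewrite !inE; apply/imsetP=> -[? _ []].
rewrite (_ : pair true @^-1: _ = T); last by apply/setP=> j; rewrite !inE (mem_imset _ _ (_ : injective (pair true))) // => ? ? [].
rewrite -[left_ends A]revK foldl_rev mulx_seq0; last by rewrite rev_uniq filter_uniq ?enum_uniq.
have bE B : bf A A al B = (ptransversal (circ A A) B && (missed (circ A A) B == circle_label A A al))%:R by rewrite ffunE.
rewrite bE {bE}.
set B := [set x in _]; have BE j : (j \in B) = (j < par A j)%N by rewrite inE mem_rev mem_left_ends.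
have pB : ptransversal (circ A A) B.
  apply/ptransversalP=> i j; rewrite !BE circ_self => il jl /orP[]/eqP // E; move: il jl.
  by rewrite -E parK // => h1 h2; have := ltn_trans h1 h2; rewrite ltnn.
have lB : missed (circ A A) B = circle_label A A al.
  apply/ffunP=> i; rewrite o0 ffunE; apply/negbTE; rewrite negb_forall_in; apply/exists_inP.
  have := par_neq mA i; rewrite neq_ltn => /orP[] lt; [exists (par A i)|exists i];
    by rewrite ?BE ?parK // negbK circ_self eqxx ?orbT.
by rewrite pB lB eqxx mul1r.
Qed.

Lemma kh_unit (al mu nu : word N) : (forall i : 'I_N, (i < par A i)%N -> al i = false) -> co_oriented A D mu -> co_oriented A D nu ->
  kh A A D al mu nu = (mu == nu)%:R.
Proof.
move=> a0 om on; rewrite kh_coefE // surg_prod_unit //; last exact: word_fnl_compat.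
rewrite basis_fnl_tr; [|exact: circ_refl|exact: circ_sym|exact: circ_trans|exact: circle_label_vlab].
congr (nat_of_bool _)%:R; rewrite eq_sym; apply/eqP/eqP=> [|->//]; exact: circle_label_inj.
Qed.
End Unit.

End Kh.

Local Open Scope ring_scope.

(** * Winding numbers and monotonicity *)

Lemma sum_invol0 (T : finType) (f : T -> T) (B : pred T) (g : T -> int) :
  (forall x, B x -> B (f x)) -> (forall x, B x -> f (f x) = x) -> (forall x, B x -> g (f x) = - g x) ->
  \sum_(x | B x) g x = 0.
Proof.
move=> fB fK fg; suff: \sum_(x | B x) g x = - \sum_(x | B x) g x by lia.
rewrite -sumrN [LHS](reindex_onto f f) //=.
apply: eq_big => [x|x /andP[Bfx /eqP fx]].
  by apply/andP/idP=> [[Bfx /eqP <-]|Bx]; [exact: fB|rewrite fB // fK].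
by rewrite -fg // -fx; apply: fB.
Qed.

Section Heights.
Variable N : nat.
Implicit Types (i j k : 'I_N) (K : {set V2 N}) (b : bool) (t : nat).

Definition psign i : int := if odd i then -1 else 1.

(* The winding number of the circle K around a point of line b just left of vertex t. *)
Definition wind K b t : int := \sum_(i : 'I_N | (i < t)%N && ((b, i) \in K)) psign i.

Lemma wind0 K b : wind K b 0 = 0.
Proof. by rewrite /wind big_pred0. Qed.

Lemma windS K b i : wind K b i.+1 = wind K b i + (if (b, i) \in K then psign i else 0).
Proof.
rewrite /wind; case: ifP => iK; last first.
  rewrite addr0; apply: eq_bigl => k; rewrite ltnS leq_eqVlt (inj_eq val_inj).
  by case: (eqVneq k i) => //= ->; rewrite iK andbF.
rewrite (bigD1 i) ?ltnSn //= addrC; congr (_ + _); apply: eq_bigl => k.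
by rewrite ltnS ltn_neqAle -(inj_eq val_inj) /=; case: (_ == _); rewrite /= ?andbF ?andbT.
Qed.

Lemma wind_big K b t : (N <= t)%N -> wind K b t.+1 = wind K b t.
Proof. by move=> Nt; apply: eq_bigl => k; have := ltn_ord k; lia. Qed.

Lemma wind_split K b t t' : (t <= t')%N ->
  wind K b t' = wind K b t + \sum_(i : 'I_N | (t <= i < t')%N && ((b, i) \in K)) psign i.
Proof.
move=> tt'; rewrite /wind (bigID (fun i : 'I_N => (i < t)%N)) /=; congr (_ + _); apply: eq_bigl => i; last by lia.
by case: ((b, i) \in K); rewrite ?andbF ?andbT //; lia.
Qed.

(** Orient the circle upwards at even vertices and downwards at odd ones, on both lines. This is the
    winding number of the region just to the left of the curve, which should be constant along
    it. *)
Definition left_wind K (u : V2 N) : int := if odd u.2 then wind K u.1 u.2.+1 else wind K u.1 u.2.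

Lemma psign_par d i : matching d -> psign (par d i) = - psign i.
Proof. by move=> md; rewrite /psign par_odd //; case: (odd i). Qed.

(** Partners strictly under the arc lie on [K] together and have opposite signs, so they cancel. *)
Lemma wind_arc (d : cupd N) K b i : matching d -> (i < par d i)%N ->
  (forall k, (i < k < par d i)%N -> ((b, par d k) \in K) = ((b, k) \in K)) ->
  wind K b (par d i) = wind K b i.+1.
Proof.
move=> md lt h; rewrite (wind_split K b lt) [X in _ + X](@sum_invol0 _ (par d)) ?addr0 // => k /andP[kr kK].
- by rewrite h // kK andbT; apply: par_nest.
- exact: parK.
- exact: psign_par.
Qed.

Lemma left_wind_arc (d : cupd N) K b i : matching d ->
  (forall k, (i < k < par d i)%N || (par d i < k < i)%N -> ((b, par d k) \in K) = ((b, k) \in K)) ->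
  (b, i) \in K -> (b, par d i) \in K -> left_wind K (b, i) = left_wind K (b, par d i).
Proof.
move=> md; wlog lt : i / (i < par d i)%N => [gen|] h iK pK.
  have := par_neq md i; rewrite neq_ltn => /orP[lt|]; last by move=> lt; apply: gen.
  have := gen (par d i); rewrite parK // => -> // k; rewrite orbC; exact: h.
have H := wind_arc (b := b) md lt (fun k kr => h k (introT orP (or_introl kr))).
rewrite /left_wind /= par_odd // (windS K b (par d i)) pK H (windS K b i) iK psign_par //.
by case: (odd i); rewrite //= -addrA subrr addr0.
Qed.
End Heights.

(** * A discrete Jordan curve theorem *)

Section Jordan.
Variables (N : nat) (A C D : cupd N).
Hypotheses (mA : matching A) (mC : matching C) (mD : matching D).
Implicit Types (S : {set 'I_N}) (i j k : 'I_N) (K : {set V2 N}) (u v : V2 N).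

(** No remaining cup spans [i], so a vertical segment at [i] crosses nothing. *)
Definition nospan S i := forall k, k \notin S -> (k < i)%N -> (par C k < i)%N.
Definition good S := par_closed C S /\ forall i, i \in S -> nospan S i.

Definition kclosed S K := forall u v, kedge A C D S u v -> (u \in K) = (v \in K).

Lemma kedge_rigid S b i : kedge A C D S (b, i) (b, par (if b then D else A) i).
Proof. by rewrite kedgeE // /two_rel eqxx. Qed.

Lemma kedge_cup S b i : i \notin S -> kedge A C D S (b, i) (b, par C i).
Proof. by move=> iS; rewrite kedgeE // /two_rel /rho2 /= (negbTE iS) eqxx orbT. Qed.

Lemma kedge_vert S b i : i \in S -> kedge A C D S (b, i) (~~ b, i).
Proof. by move=> iS; rewrite kedgeE // /two_rel /rho2 /= iS eqxx orbT. Qed.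

(** Left of [i] the uncut cups cancel in pairs, and the cut vertices are joined vertically, so they
    count equally on the two lines. *)
Lemma wind_vert S K i : par_closed C S -> kclosed S K -> nospan S i -> wind K false i = wind K true i.
Proof.
move=> cS cK ns.
have E b : wind K b i = \sum_(k : 'I_N | [&& (k < i)%N, (b, k) \in K & k \in S]) psign k.
  rewrite /wind (bigID (mem S)) /= [X in _ + X](@sum_invol0 _ (par C)) ?addr0.
  - by apply: eq_bigl => k; rewrite andbA.
  - move=> k /andP[/andP[ki kK] kS]; by rewrite ns // cS kS andbT -(cK _ _ (kedge_cup b kS)) kK.
  - by move=> k _; apply: parK.
  - by move=> k _; apply: psign_par.
rewrite !E; apply: eq_bigl => k; congr (_ && _); case kS: (k \in S); rewrite ?andbF // !andbT.
exact: cK (kedge_vert false kS).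
Qed.

Lemma left_wind_edge S K u v : good S -> kclosed S K -> kedge A C D S u v -> u \in K -> left_wind K u = left_wind K v.
Proof.
case=> cS gS cK uv uK; have vK : v \in K by rewrite -(cK u).
case: u uv uK => [b i]; case: v vK => [b' j] vK; rewrite /kedge /=; case: eqP => [bb|nb].
  rewrite -bb in vK * => /orP[iAD|/andP[iC iS]] iK.
    pose d := if b then D else A; have md : matching d by rewrite /d; case: (b).
    have jE : j = par d i by move: iAD; rewrite /d; case: (b); rewrite parE // => /eqP.
    rewrite jE in vK *; apply: left_wind_arc => // k _; by rewrite -(cK _ _ (kedge_rigid S b k)).
  move: iC; rewrite parE // => /eqP jE; rewrite -jE in vK *; apply: left_wind_arc => // k kr.
  (* A cut vertex under this uncut cup would be spanned by it. *)
  suff kS : k \notin S by rewrite -(cK _ _ (kedge_cup b kS)).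
  apply/negP=> /gS ns; case/orP: kr => /andP[h1 h2].
    by have := ns _ iS h1; lia.
  by have := ns (par C i); rewrite cS iS parK // => /(_ isT h1); lia.
case/andP=> /eqP ij iS iK; rewrite -ij in vK *; rewrite /left_wind /=.
have -> : wind K b i = wind K b' i.
  by have := wind_vert cS cK (gS _ iS); move: nb; case: (b); case: (b').
by rewrite !windS iK vK; have -> : wind K b i = wind K b' i;
  first by have := wind_vert cS cK (gS _ iS); move: nb; case: (b); case: (b').
Qed.

Definition circle_of (e : rel (V2 N)) u : {set V2 N} := [set v | e u v].

Lemma circle_of_closed S u : par_closed C S -> kclosed S (circle_of (conn2 A C D S) u).
Proof.
move=> cS v w vw; rewrite !inE; have h := connect1 vw.
apply/idP/idP=> uv; first exact: connect_trans uv h.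
by apply: connect_trans uv _; rewrite -/(conn2 A C D S _ _) conn2_sym.
Qed.

Definition leftmost2 (e : rel (V2 N)) u : V2 N := [arg min_(v < u | e u v) nat_of_ord v.2].

(* The discrete Jordan curve theorem: 0 is the value outside, and the sign of a
   leftmost vertex the value inside. *)
Lemma jordan S u b t : good S -> let h := wind (circle_of (conn2 A C D S) u) b t in
  (h == 0) || (h == psign (leftmost2 (conn2 A C D S) u).2).
Proof.
move=> gS; have [cS _] := gS; set e := conn2 A C D S; set K := circle_of e u.
have [uM mM] : e u (leftmost2 e u) /\ forall v, e u v -> (((leftmost2 e u).2 : nat) <= v.2)%N.
  by rewrite /leftmost2; case: arg_minnP => [|v h1 h2]; [exact: connect0|split].
set m := leftmost2 e u in uM mM *.
have cK := circle_of_closed u cS; rewrite -/e -/K in cK.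
have gc v : v \in K -> left_wind K v = left_wind K m.
  rewrite inE => uv; have mv : e m v by apply: connect_trans uv; rewrite -/(conn2 A C D S _ _) conn2_sym.
  have mK : m \in K by rewrite inE.
  case/connectP: mv => s; elim: s (m) mK => [|w s IHs] x /= xK; first by move=> _ ->.
  case/andP=> xw sp vE; rewrite (left_wind_edge gS cK xw xK); apply: IHs => //.
  by rewrite -(cK x).
have hm : wind K m.1 m.2 = 0.
  rewrite /wind big_pred0 // => i; apply/negP=> /andP[lt]; rewrite inE => /mM /=; lia.
have mK : (m.1, m.2) \in K by rewrite inE -surjective_pairing.
(* The circle has no vertex left of its leftmost one, so the jump there determines the value along
   one side of the whole curve. *)
have Gm : left_wind K m = if odd m.2 then -1 else 0.
  by rewrite /left_wind; case: ifP => om //; rewrite windS mK hm /psign om.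
elim: t => [|t /= IHt]; first by rewrite wind0.
case: (ltnP t N) => [lt|]; last by move=> /wind_big ->.
have := windS K b (Ordinal lt); rewrite /=; case: ifP => iK; last by move=> ->; rewrite addr0.
(* At each crossing one side has this common value and the jump [psign] gives the other. *)
have := gc _ iK; rewrite Gm /left_wind /= /psign /=.
by case: ifP => ot; case: ifP => om; lia.
Qed.
End Jordan.

(** * Heights as sums over circles *)

Section Weight.
Variable N : nat.
Implicit Types (e : rel (V2 N)) (l : {ffun V2 N -> bool}) (u v x y : V2 N) (b : bool) (t : nat).

Definition up_sign (b : bool) : int := if b then 1 else -1.
Definition lsign e v : int := psign (leftmost2 e v).2.
(** The label gives the direction at the leftmost vertex, and the parity relative to it gives the
    direction at any other. So [tsign] times [psign] is the sign of a vertex, and [lheight] is the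
    height of the word induced on a line. *)
Definition tsign e l v : int := up_sign (l v) * lsign e v.
Definition lheight e l b t : int := \sum_(i : 'I_N | (i < t)%N) tsign e l (b, i) * psign i.
Definition height (w : word N) t : int := \sum_(i : 'I_N | (i < t)%N) up_sign (w i).

Lemma psign_odd (i j : 'I_N) : psign i * psign j = up_sign (~~ (odd i (+) odd j)).
Proof. by rewrite /psign /up_sign; case: (odd i); case: (odd j). Qed.

Lemma lsign_eq e e' u v : e u u -> e' v v -> (forall w, e u w = e' v w) -> lsign e u = lsign e' v.
Proof.
move=> eu ev ee; rewrite /lsign /leftmost2; case: arg_minnP => // m um mm; case: arg_minnP => // m' vm' mm'.
have h1 := mm m'; have h2 := mm' m; rewrite ee in h1; rewrite -ee in h2.
have E : (m.2 : nat) = m'.2 by apply/eqP; rewrite eqn_leq h1 // h2.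
by rewrite /psign E.
Qed.

Lemma lheightS e l b (i : 'I_N) : lheight e l b i.+1 = lheight e l b i + tsign e l (b, i) * psign i.
Proof.
rewrite /lheight (bigD1 i) ?ltnSn //= addrC; congr (_ + _); apply: eq_bigl => k.
by rewrite ltnS ltn_neqAle -(inj_eq val_inj) /=; case: (_ == _); rewrite /= ?andbF ?andbT.
Qed.

Lemma lheight_inj e l l' : (forall b t, lheight e l b t = lheight e l' b t) -> l = l'.
Proof.
move=> h; apply/ffunP=> -[b i]; have := lheightS e l b i; rewrite !h lheightS => /addrI.
have sn : psign i != 0 by rewrite /psign; case: ifP.
move/(mulIf sn); rewrite /tsign; have : lsign e (b, i) != 0 by rewrite /lsign /psign; case: ifP.
by move=> kn /(mulIf kn); rewrite /up_sign; case: (l _); case: (l' _).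
Qed.

Section Equiv.
Variables (e e' : rel (V2 N)).
Hypotheses (er : reflexive e) (es : symmetric e) (et : transitive e).
Hypotheses (er' : reflexive e') (es' : symmetric e') (et' : transitive e').

Lemma tsign_cls l u v : class_const e l -> e u v -> tsign e l u = tsign e l v.
Proof.
move=> /class_constP vl uv; rewrite /tsign (vl _ _ uv); congr (_ * _).
by apply: lsign_eq => // w; apply: eqr.
Qed.

Lemma lheight_cls l u b t : class_const e l ->
  \sum_(i : 'I_N | (i < t)%N && ((b, i) \in circle_of e u)) tsign e l (b, i) * psign i = tsign e l u * wind (circle_of e u) b t.
Proof.
move=> vl; rewrite /wind mulr_sumr; apply: eq_bigr => i /andP[_]; rewrite inE => ui.
by rewrite (tsign_cls vl ui).
Qed.
End Equiv.

Section Glue.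
Variables (e e' : rel (V2 N)) (x y : V2 N).
Hypotheses (er : reflexive e) (es : symmetric e) (et : transitive e).
Hypotheses (er' : reflexive e') (es' : symmetric e') (et' : transitive e').
Hypotheses (eE : forall u v, e u v = join_rel e' x y u v) (nxy : ~~ e' x y).

Lemma circle_of_glue v : e x v = e' x v || e' y v.
Proof. by rewrite eE /join_rel er' (negbTE nxy) orbF. Qed.

Lemma circle_of_glue_disj v : e' x v -> e' y v = false.
Proof. by move=> xv; apply/negP=> yv; case/negP: nxy; apply: et' xv _; rewrite es'. Qed.

Lemma wind_glue b t : wind (circle_of e x) b t = wind (circle_of e' x) b t + wind (circle_of e' y) b t.
Proof.
rewrite /wind (bigID (fun i => (b, i) \in circle_of e' x)) /=; congr (_ + _); apply: eq_bigl => i; rewrite !inE circle_of_glue.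
  by case: (e' x _); rewrite /= ?andbF ?andbT.
case: (boolP (e' x _)) => [/circle_of_glue_disj->|_]; by rewrite ?andbF ?andbT.
Qed.

(** Circles that are not glued keep their label and leftmost position, so they cancel in the
    difference. *)
Lemma lheight_glue l l' b t : class_const e l -> class_const e' l' -> (forall v, ~~ e x v -> l v = l' v) ->
  lheight e l b t - lheight e' l' b t =
  tsign e l x * wind (circle_of e x) b t - (tsign e' l' x * wind (circle_of e' x) b t + tsign e' l' y * wind (circle_of e' y) b t).
Proof.
move=> vl vl' ll'; rewrite -lheight_cls // -[in RHS](lheight_cls er' es' et' x) // -[in RHS](lheight_cls er' es' et' y) //.
rewrite /lheight (bigID (fun i => (b, i) \in circle_of e x)) /= [X in _ - X](bigID (fun i => (b, i) \in circle_of e x)) /=.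
have -> : \sum_(i < N | (i < t)%N && ((b, i) \notin circle_of e x)) tsign e l (b, i) * psign i =
          \sum_(i < N | (i < t)%N && ((b, i) \notin circle_of e x)) tsign e' l' (b, i) * psign i.
  apply: eq_bigr => i /andP[_]; rewrite inE => nx; congr (_ * _).
  rewrite /tsign ll' //; congr (_ * _); apply: lsign_eq => // w.
  move: nx; rewrite circle_of_glue negb_or => /andP[nx ny].
  by rewrite eE /join_rel ![e' (b, i) _]es' (negbTE nx) (negbTE ny) orbF.
rewrite opprD addrACA subrr addr0; congr (_ - _).
rewrite (bigID (fun i => (b, i) \in circle_of e' x)) /=; congr (_ + _); apply: eq_bigl => i; rewrite !inE circle_of_glue.
  by case: (e' x _); rewrite /= ?andbF ?andbT.
case: (boolP (e' x _)) => [/circle_of_glue_disj->|_]; by rewrite ?andbF ?andbT.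
Qed.
End Glue.
End Weight.

(** A winding number takes only the values 0 and its own sign, so sign times winding number is an
    absolute value; these are the triangle inequalities in all three directions. *)
Lemma tri_abs (s1 s2 s3 a1 a2 a3 : int) : s1 = 1 \/ s1 = -1 -> s2 = 1 \/ s2 = -1 -> s3 = 1 \/ s3 = -1 ->
  a1 = 0 \/ a1 = s1 -> a2 = 0 \/ a2 = s2 -> a3 = 0 \/ a3 = s3 -> a3 = a1 + a2 ->
  [/\ s3 * a3 <= s1 * a1 + s2 * a2, s1 * a1 <= s3 * a3 + s2 * a2 & s2 * a2 <= s3 * a3 + s1 * a1].
Proof.
have ab (s a : int) : s = 1 \/ s = -1 -> a = 0 \/ a = s -> s * a = `|a|.
  by case=> -> [] -> //; rewrite mulr0 normr0.
move=> h1 h2 h3 g1 g2 g3 e; rewrite !ab //; clear -e.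
by split; lia.
Qed.

Lemma merge_le (l1 l2 l3 : bool) (n1 n2 n3 x y : int) : l3 = l1 || l2 -> ~~ (l1 && l2) ->
  n3 <= n1 + n2 -> n1 <= n3 + n2 -> n2 <= n3 + n1 ->
  y - x = up_sign l3 * n3 - (up_sign l1 * n1 + up_sign l2 * n2) -> x <= y.
Proof. by move=> ->; rewrite /up_sign; case: l1; case: l2 => //= _; lia. Qed.

Lemma split_le (l1 l2 l3 : bool) (n1 n2 n3 x y : int) :
  (if l3 then l1 && l2 else l1 != l2) ->
  n3 <= n1 + n2 -> n1 <= n3 + n2 -> n2 <= n3 + n1 ->
  x - y = up_sign l3 * n3 - (up_sign l1 * n1 + up_sign l2 * n2) -> x <= y.
Proof. by rewrite /up_sign; case: l1; case: l2; case: l3 => //= _; lia. Qed.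

Section Mono.
Variables (N : nat) (A C D : cupd N).
Hypotheses (mA : matching A) (mC : matching C) (mD : matching D).
Implicit Types (S : {set 'I_N}) (s : seq 'I_N) (i j k : 'I_N) (b : bool) (t : nat).
Local Notation e2S S := (conn2 A C D S).

Lemma wind_val S u b t : good C S ->
  wind (circle_of (e2S S) u) b t = 0 \/ wind (circle_of (e2S S) u) b t = lsign (e2S S) u.
Proof. by move=> /(jordan mA mC mD u b t)/orP[]/eqP; [left|right]. Qed.

Lemma entry_mono S i l l' b t : good C S -> good C (addc C S i) -> i \notin S ->
  entry (e2S S) (e2S (addc C S i)) (false, i) (true, i) (false, par C i) l l' ->
  lheight (e2S S) l b t <= lheight (e2S (addc C S i)) l' b t.
Proof.
move=> gS gS' iS; have [cS _] := gS; have [cS' _] := gS'.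
have := surgery2 mA mC mD cS iS.
set e := e2S S; set e' := e2S _; set p := (false, i); set q := (true, i); set p' := (false, par C i).
case=> h0 h1 h2 /and4P[vl vl' /forallP out].
have er : reflexive e by apply: conn2_refl.
have es : symmetric e by apply: conn2_sym.
have et : transitive e by apply: conn2_trans.
have er' : reflexive e' by apply: conn2_refl.
have es' : symmetric e' by apply: conn2_sym.
have et' : transitive e' by apply: conn2_trans.
have sv (f : rel (V2 N)) u : lsign f u = 1 \/ lsign f u = -1.
  by rewrite /lsign /psign; case: ifP; [right|left].
have outE v : ~~ e p v -> ~~ e q v -> l v = l' v.
  by move=> n1 n2; apply/eqP; have := out v; rewrite negb_or n1 n2.
case: ifP => [sep|/negbFE epq].
  have {}h1 := h1 sep.
  have ll v : ~~ e' p v -> l' v = l v.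
    by move=> nv; rewrite outE //; move: nv; rewrite (circle_of_glue er h1 sep) negb_or => /andP[].
  have := lheight_glue er' es' et' er es et h1 sep b t vl' vl ll; have := wind_glue er es et h1 sep b t.
  rewrite /tsign -!mulrA => hE NE /andP[/eqP lp lpq].
  have [t1 t2 t3] := tri_abs (sv e p) (sv e q) (sv e' p) (wind_val p b t gS) (wind_val q b t gS)
    (wind_val p b t gS') hE.
  exact: merge_le lp lpq t1 t2 t3 NE.
have {}h2 := h2 epq; have npp : ~~ e' p p' by rewrite h0 epq.
have ll v : ~~ e p v -> l v = l' v.
  by move=> nv; apply: outE => //; apply: contra nv; apply: et.
have := lheight_glue er es et er' es' et' h2 npp b t vl vl' ll; have := wind_glue er' es' et' h2 npp b t.
rewrite /tsign -!mulrA => hE NE lpp.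
have [t1 t2 t3] := tri_abs (sv e' p) (sv e' p') (sv e p) (wind_val p b t gS') (wind_val p' b t gS')
  (wind_val p b t gS) hE.
exact: split_le lpp t1 t2 t3 NE.
Qed.

(** The sorted list contains every remaining left end; this completeness is what keeps vertical
    segments unspanned. *)
Definition ready S s : Prop :=
  [/\ fresh C S s, good C S, pairwise ltn (map val s) &
      forall k, k \notin S -> (k < par C k)%N -> k \in s].

Lemma ready_cons S i s : ready S (i :: s) ->
  [/\ good C S, i \notin S, nospan C S i, good C (addc C S i) & ready (addc C S i) s].
Proof.
case=> /(fresh_cons mC)[cS iS fr] gS /= /andP[/allP lt pw] cov.
(* As [i] is the leftmost remaining left end, an uncut vertex before it can only be a right end. *)
have ns : nospan C S i.
  move=> k kS ki; have := par_neq mC k; rewrite neq_ltn => /orP[|kp]; first by move=> h; apply: ltn_trans h ki.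
  have := cov k kS kp; rewrite inE => /orP[/eqP E|ks]; first by rewrite E ltnn in ki.
  by have := lt (val k) (map_f _ ks); rewrite /= => h; have := ltn_trans h ki; rewrite ltnn.
have gS' : good C (addc C S i).
  split; first exact: addc_closed.
  move=> x; rewrite !inE => xS k; rewrite !inE !negb_or => /and3P[ki kpi kS] kx.
  have [_ gS2] := gS; case/or3P: xS kx => [/eqP->|/eqP->|/gS2]; [exact: ns| |exact].
  move=> kx; have nki : (k : nat) != i by [].
  case: (ltnP k i) => [/(ns _ kS)|ik].
    case: fr => _ _ _; have := ns (par C i); rewrite cS iS parK // => /(_ isT).
    have := par_neq mC i; rewrite -(inj_eq val_inj) /=; lia.
  (* A vertex under the cup being cut has its partner under the same cup. *)
  have ik' : (i < k < par C i)%N by lia.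
  by have := par_nest mC (ltn_trans (proj1 (andP ik')) kx) ik'; lia.
split=> //; split=> // k; rewrite !inE !negb_or => /and3P[ki kpi kS] kp.
by have := cov k kS kp; rewrite inE (negbTE ki).
Qed.

Lemma ready_left_ends : ready set0 (left_ends C).
Proof.
split; first exact: fresh_left_ends.
- by split; [exact: set0_closed|move=> k; rewrite inE].
- rewrite -sorted_pairwise; last exact: ltn_trans.
  rewrite sorted_map /left_ends; apply: sorted_filter; first by move=> ? ? ?; apply: ltn_trans.
  by have := iota_ltn_sorted 0 N; rewrite -val_enum_ord sorted_map.
by move=> k _; rewrite mem_left_ends.
Qed.

Variable F : fieldType.

Lemma step_mono1 (beta : bool -> nat -> int) S (f : kvec F N) i :
  good C S -> good C (addc C S i) -> i \notin S ->
  (forall l, f l != 0 -> forall b t, beta b t <= lheight (e2S S) l b t) ->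
  forall l, step_vec (e2S S) (e2S (addc C S i)) (false, i) (true, i) (false, par C i) f l != 0 ->
  forall b t, beta b t <= lheight (e2S (addc C S i)) l b t.
Proof.
move=> gS gS' iS h l'; rewrite ffunE => nz b t.
have [l] : exists l, f l * (entry (e2S S) (e2S (addc C S i)) (false, i) (true, i) (false, par C i) l l')%:R != 0.
  apply/existsP; apply: contraNT nz; rewrite negb_exists => /forallP nz.
  by rewrite big1 // => l _; have := nz l; rewrite negbK => /eqP.
rewrite mulf_eq0 negb_or => /andP[fl]; case: entry (entry_mono (l := l) (l' := l') b t gS gS' iS) => [le _|]; last by rewrite eqxx.
exact: Order.POrderTheory.le_trans (h _ fl b t) (le isT).
Qed.

Lemma step_mono (beta : bool -> nat -> int) S (f : kvec F N) s : ready S s ->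
  (forall l, f l != 0 -> forall b t, beta b t <= lheight (e2S S) l b t) ->
  let st := foldl (surg_step A C D) (S, f) s in
  forall l, st.2 l != 0 -> forall b t, beta b t <= lheight (e2S st.1) l b t.
Proof.
elim: s S f => //= i s IHs S f /ready_cons[gS iS _ gS' rd] h.
have [cS _] := gS; rewrite surg_stepE //; apply: IHs => //; exact: step_mono1.
Qed.

Definition consistent S (wl : V2 N -> bool) :=
  forall u v, kedge A C D S u v -> wl v (+) odd v.2 = wl u (+) odd u.2.

(** Word plus parity is constant on a circle, so transporting the direction at the leftmost vertex
    by parity gives back the word. *)
Lemma lheight_orient S wl b t : consistent S wl ->
  lheight (e2S S) (orient_lab A C D S wl) b t = \sum_(i : 'I_N | (i < t)%N) up_sign (wl (b, i)).
Proof.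
move=> cw; apply: eq_bigr => i _; rewrite /tsign ffunE -/(leftmost2 (e2S S) (b, i)) /lsign.
have um : e2S S (b, i) (leftmost2 (e2S S) (b, i)).
  by rewrite /leftmost2; case: arg_minnP => //; apply: connect0.
move: (leftmost2 _ _) um => m um; rewrite -mulrA psign_odd.
have {um} : wl m (+) odd m.2 = wl (b, i) (+) odd i.
  rewrite -[odd i]/(odd (b, i).2); move: (b, i) um => u /connectP[s].
  elim: s u => [|w s IHs] u /=; first by move=> _ ->.
  by case/andP=> uw sp vE; rewrite (IHs _ sp vE) (cw _ _ uw).
by case: (wl m); case: (wl _); case: (odd m.2); case: (odd i).
Qed.

Lemma orient_lab_vlab S wl : par_closed C S -> consistent S wl -> class_const (e2S S) (orient_lab A C D S wl).
Proof.
move=> cS cw; apply/class_constP=> u v uv; rewrite !ffunE -!/(leftmost2 (e2S S) _).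
have /(congr1 (fun z => z == 1)) : lsign (e2S S) u = lsign (e2S S) v.
  by apply: lsign_eq => [||w]; [exact: connect0|exact: connect0|apply: eqr uv; [exact: conn2_sym|exact: conn2_trans]].
have [um vm] : e2S S u (leftmost2 (e2S S) u) /\ e2S S v (leftmost2 (e2S S) v).
  by rewrite /leftmost2; split; case: arg_minnP => //; apply: connect0.
have : e2S S (leftmost2 (e2S S) u) (leftmost2 (e2S S) v).
  by apply: connect_trans (connect_trans uv vm); rewrite -/(e2S S _ _) conn2_sym.
rewrite /lsign; move: (leftmost2 _ u) (leftmost2 _ v) => {um vm uv}m m' /connectP[s].
move=> sp mE; have : wl m' (+) odd m'.2 = wl m (+) odd m.2.
  elim: s m sp mE => [|w s IHs] m /=; first by move=> _ ->.
  by case/andP=> mw sp mE; rewrite (IHs _ sp mE) (cw _ _ mw).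
by rewrite /psign; case: (odd _); case: (odd _); case: (wl m); case: (wl m').
Qed.

Lemma consistent0 (la mu : word N) : co_oriented A C la -> co_oriented C D mu ->
  consistent set0 (fun v => if v.1 then mu v.2 else la v.2).
Proof.
move=> /andP[/(orientedP _ mA) lA /(orientedP _ mC) lC] /andP[/(orientedP _ mC) mC' /(orientedP _ mD) mD'].
move=> u v; rewrite kedgeE // => /orP[]/eqP<-; case: u => [[] i];
  rewrite /kap2 /rho2 /= ?inE /= ?lA ?lC ?mC' ?mD' par_odd // addNb addbN negbK //.
Qed.

Lemma consistentT S (w : word N) : oriented A w -> oriented D w -> (S = setT \/ oriented C w) ->
  consistent S (fun v => w v.2).
Proof.
move=> /(orientedP _ mA) wA /(orientedP _ mD) wD wC.
move=> u v; rewrite kedgeE // => /orP[]/eqP<-; case: u => [b i]; rewrite /kap2 /rho2 /=.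
  by case: b; rewrite ?wA ?wD par_odd // addNb addbN negbK.
case: ifPn => //= iS; case: wC iS => [->|/(orientedP _ mC) wC _]; first by rewrite inE.
by rewrite wC par_odd // addNb addbN negbK.
Qed.

Theorem kh_mono la mu nu : co_oriented A C la -> co_oriented C D mu -> co_oriented A D nu ->
  kh_coef F A C D la mu nu != 0 -> forall t, height la t <= height nu t /\ height mu t <= height nu t.
Proof.
move=> ol om /andP[oA oD]; pose wl (v : V2 N) := if v.1 then mu v.2 else la v.2.
rewrite /kh_coef; set f0 : kvec F N := finfun _ => nz t.
have c0 := consistent0 ol om; rewrite -/wl in c0.
have := step_mono (f := f0) (beta := lheight (e2S set0) (orient_lab A C D set0 wl)) ready_left_ends.
have h0 l : f0 l != 0 -> forall b t, lheight (e2S set0) (orient_lab A C D set0 wl) b t <= lheight (e2S set0) l b t.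
  by rewrite ffunE; case: (l =P _) => [->//|_]; rewrite eqxx.
move=> /(_ h0) H; cbv zeta in H.
have [stT _] := fold_surg_step mA mC mD f0 (fresh_left_ends mC); rewrite fold_left_ends // in stT.
rewrite stT in nz H; have {H}H := H _ nz.
have cT := consistentT oA oD (or_introl (erefl setT)).
(* The lines carry [la] and [mu] at the start and both carry [nu] at the end, so each line yields
   one of the two bounds. *)
have H0 := H false t; have H1 := H true t.
by split; [move: H0|move: H1]; rewrite (lheight_orient _ _ c0) (lheight_orient _ _ cT); apply.
Qed.

(* Keeping the weight mu on both lines: the labelling which orients both lines
   by mu is the only way to reach mu, and each surgery takes it to itself. *)
Section Diagonal.
Variable mu : word N.
Hypotheses (muA : oriented A mu) (muC : oriented C mu) (muD : oriented D mu).
Hypothesis mu0 : forall i, (i < par C i)%N -> mu i = false.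

Let wl (v : V2 N) := mu v.2.
Let diag_label S := orient_lab A C D S wl.

Lemma wl_consistent S : consistent S wl.
Proof. by apply: consistentT => //; right. Qed.

Lemma diag_labelE S u v : e2S S u v -> diag_label S u = mu v.2 (+) odd v.2 (+) (lsign (e2S S) u == -1).
Proof.
move=> uv; rewrite ffunE -/(leftmost2 (e2S S) u) /wl /lsign.
have : e2S S u (leftmost2 (e2S S) u) by rewrite /leftmost2; case: arg_minnP => //; apply: connect0.
have gen x y : e2S S x y -> mu y.2 (+) odd y.2 = mu x.2 (+) odd x.2.
  case/connectP=> s; elim: s x => [|w s IHs] x /=; first by move=> _ ->.
  by case/andP=> xw sp yE; rewrite (IHs _ sp yE) (wl_consistent xw).
move/gen; rewrite (gen _ _ uv) => <-; rewrite /psign.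
by case: (odd _); case: (mu _).
Qed.

(** Consecutive winding numbers lie in the two-element set of the Jordan theorem and differ by
    [psign i], which determines both. *)
Lemma wind_at S u i b : good C S -> e2S S u (b, i) ->
  wind (circle_of (e2S S) u) b i = if lsign (e2S S) u == psign i then 0 else - psign i.
Proof.
move=> gS ui; have := windS (circle_of (e2S S) u) b i; rewrite inE ui.
have := wind_val u b i gS; have := wind_val u b i.+1 gS.
have : lsign (e2S S) u = 1 \/ lsign (e2S S) u = -1 by rewrite /lsign /psign; case: ifP; [right|left].
move: (wind _ _ i.+1) (wind _ _ i) (lsign _ _) => x y z; rewrite /psign.
by case: ifP => _ [->|->] [->|->] [->|->].
Qed.

(** As [mu] is \vee at [i], the label there is x exactly when the circle winds around the point just
    left of [i]. At the right end of the cup it is x exactly when the winding number just left of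
    that end is 0. Additivity of winding numbers then leaves only the allowed merge and split
    rules. *)
Lemma entry_diag S i : good C S -> good C (addc C S i) -> i \notin S -> nospan C S i -> (i < par C i)%N ->
  entry (e2S S) (e2S (addc C S i)) (false, i) (true, i) (false, par C i) (diag_label S) (diag_label (addc C S i)).
Proof.
move=> gS gS' iS ns lt; have [cS _] := gS; have [cS' _] := gS'.
have := surgery2 mA mC mD cS iS.
set S' := addc C S i; set e := e2S S; set e' := e2S S'; set p := (false, i); set q := (true, i); set p' := (false, par C i).
case=> h0 h1 h2.
have er : reflexive e by apply: conn2_refl.
have es : symmetric e by apply: conn2_sym.
have et : transitive e by apply: conn2_trans.
have er' : reflexive e' by apply: conn2_refl.
have es' : symmetric e' by apply: conn2_sym.
have et' : transitive e' by apply: conn2_trans.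
have sub u v : ~~ e p u -> ~~ e q u -> e u v = e' u v.
  move=> np nq; case: (boolP (e p q)) => epq.
    have {}h2 := h2 epq; rewrite h2 /join_rel.
    have npp : ~~ e' p p' by rewrite h0 epq.
    move: np; rewrite (circle_of_glue er' h2 npp) negb_or => /andP[n1 n2].
    by rewrite ![e' u _]es' (negbTE n1) (negbTE n2) orbF.
  rewrite (h1 epq) /join_rel; move: np nq; rewrite ![e _ u]es => /negbTE-> /negbTE->.
  by rewrite orbF.
have m0 := mu0 lt; have m1 : mu (par C i) = true by move/(orientedP _ mC): muC => ->; rewrite m0.
have sv (f : rel (V2 N)) u : lsign f u = 1 \/ lsign f u = -1.
  by rewrite /lsign /psign; case: ifP; [right|left].
have lp : diag_label S p = (lsign e p != psign i).
  by rewrite (diag_labelE (er p)) /= m0 /psign; case: (sv e p) => ->; case: (odd i).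
have lq : diag_label S q = (lsign e q != psign i).
  by rewrite (diag_labelE (er q)) /= m0 /psign; case: (sv e q) => ->; case: (odd i).
have lp' : diag_label S' p = (lsign e' p != psign i).
  by rewrite (diag_labelE (er' p)) /= m0 /psign; case: (sv e' p) => ->; case: (odd i).
have lpp' : diag_label S' p' = (lsign e' p' != psign i).
  by rewrite (diag_labelE (er' p')) /= m1 par_odd // /psign; case: (sv e' p') => ->; case: (odd i).
have sgn : psign i = 1 \/ psign i = -1 by rewrite /psign; case: ifP; [right|left].
apply/and4P; split; [exact: orient_lab_vlab cS (wl_consistent (S := S))
  |exact: orient_lab_vlab cS' (wl_consistent (S := S'))| |].
  apply/forallP=> v; apply/implyP; rewrite negb_or => /andP[np nq].
  apply/eqP; have -> : diag_label S v = _ := diag_labelE (er v); have -> : diag_label S' v = _ := diag_labelE (er' v).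
  suff -> : lsign (e2S S) v = lsign (e2S S') v by [].
  by apply: lsign_eq => // w; apply: sub.
rewrite [diag_label S p]lp [diag_label S q]lq [diag_label S' p]lp' [diag_label S' p']lpp'; case: ifP => [sep|/negbFE epq].
  have {}h1 := h1 sep; have := wind_glue er es et h1 sep false i.
  have -> : wind (circle_of e q) false i = wind (circle_of e q) true i.
    by apply: (wind_vert mA mC mD cS _ ns); apply: (circle_of_closed mA mC mD).
  rewrite !wind_at // ?er ?er' //; move: (sv e p) (sv e q) (sv e' p) sgn.
  by case=> -> [] -> [] -> [] ->.
have {}h2 := h2 epq; have npp : ~~ e' p p' by rewrite h0 epq.
have := wind_glue er' es' et' h2 npp false i.
(* The winding number of the circle of [p'] is carried from [i] to [par C i]: this circle avoids
   [i], and the cups strictly between cancel. *)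
have <- : wind (circle_of e' p') false i.+1 = wind (circle_of e' p') false i.
  by rewrite windS inE es' (negbTE npp) addr0.
have -> : wind (circle_of e' p') false i.+1 = wind (circle_of e' p') false (par C i).
  apply/esym; apply: wind_arc => // k kr; have [_ gS2] := gS.
  have kS : k \notin S.
    by apply/negP=> /gS2 h; case/andP: kr => h3 h4; have := ltn_trans h4 (h _ iS h3); rewrite ltnn.
  have kS' : k \notin S'.
    by case/andP: kr => h3 h4; rewrite !inE !negb_or kS -!(inj_eq val_inj) /= gtn_eqF // ltn_eqF.
  by apply/esym; apply: (circle_of_closed mA mC mD p' cS'); apply: kedge_cup.
rewrite !wind_at // ?er ?er' // psign_par //; move: (sv e p) (sv e' p) (sv e' p') sgn.
by case=> -> [] -> [] -> [] ->.
Qed.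

Lemma step_diag S (f : kvec F N) s : ready S s -> f (diag_label S) = 1 ->
  (forall l, f l != 0 -> forall b t, height mu t <= lheight (e2S S) l b t) ->
  let st := foldl (surg_step A C D) (S, f) s in st.2 (diag_label st.1) = 1.
Proof.
elim: s S f => //= i s IHs S f rd f1 fm.
have [gS iS ns gS' rd'] := ready_cons rd; have [cS _] := gS.
have lt : (i < par C i)%N by case: rd => -[_ _ h] _ _ _; apply: (h i (mem_head _ _)).2.
rewrite surg_stepE //; apply: IHs => //; last exact: (step_mono1 (beta := fun _ t => height mu t)).
rewrite ffunE (bigD1 (diag_label S)) //= f1 entry_diag // mul1r big1 ?addr0 // => l nl.
apply: contraNeq nl; rewrite mulf_eq0 negb_or => /andP[fl].
case El: entry; last by rewrite eqxx.
(* Monotonicity squeezes the heights of [l] between those of [mu] on both sides, so [l] is the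
   diagonal labelling. *)
move=> _; apply/eqP/(lheight_inj (e := e2S S)) => b t; apply: Order.POrderTheory.le_anti.
rewrite [X in _ <= X <= _]lheight_orient; last exact: wl_consistent.
rewrite -/(height mu t) fm // andbT.
have := entry_mono b t gS gS' iS El; rewrite lheight_orient //; exact: wl_consistent.
Qed.

Theorem kh_diag : kh_coef F A C D mu mu mu = 1.
Proof.
rewrite /kh_coef; set f0 : kvec F N := finfun _.
have [stT _] := fold_surg_step mA mC mD f0 (fresh_left_ends mC); rewrite fold_left_ends // in stT.
apply: step_diag; first exact: ready_left_ends.
  rewrite ffunE /diag_label; set x := orient_lab _ _ _ _ _; set y := orient_lab _ _ _ _ _.
  suff -> : x = y by rewrite eqxx.
  by congr orient_lab; apply: functional_extensionality => v; case: v.1.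
move=> l; rewrite ffunE; case: (l =P _) => [->|_ /eqP//] _ b t.
have oAC : co_oriented A C mu by rewrite /co_oriented muA muC.
have oCD : co_oriented C D mu by rewrite /co_oriented muC muD.
rewrite (lheight_orient _ _ (consistent0 oAC oCD)) [X in _ <= X](_ : _ = height mu t) //.
by apply: eq_bigr => i _; case: b.
Qed.
End Diagonal.
End Mono.

Section Indep.
Variables (F : fieldType) (N : nat).
Implicit Types (A C D : cupd N) (la mu nu w : word N).
Local Notation kh := (kh_coef F).

Lemma heightS w (i : 'I_N) : height w i.+1 = height w i + up_sign (w i).
Proof.
rewrite /height (bigD1 i) ?ltnSn //= addrC; congr (_ + _); apply: eq_bigl => k.
by rewrite ltnS ltn_neqAle -(inj_eq val_inj) /=; case: (_ == _); rewrite /= ?andbF ?andbT.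
Qed.

Lemma height_inj w w' : (forall t, height w t = height w' t) -> w = w'.
Proof.
move=> h; apply/ffunP=> i; have := heightS w i; rewrite !h heightS => /addrI.
by rewrite /up_sign; case: (w i); case: (w' i).
Qed.

Lemma height_anti w w' : (forall t, height w t <= height w' t) -> (forall t, height w' t <= height w t) -> w = w'.
Proof. by move=> h h'; apply: height_inj => t; apply: Order.POrderTheory.le_anti; rewrite h h'. Qed.

Lemma co_oriented_mk A D w : oriented A w -> oriented D w -> co_oriented A D w.
Proof. by rewrite /co_oriented => -> ->. Qed.

Lemma sum_only (I : finType) (P : pred I) (f : I -> F) (i0 : I) : P i0 ->
  (forall i, P i -> f i != 0 -> i = i0) -> \sum_(i | P i) f i = f i0.
Proof.
move=> P0 h; rewrite (bigD1 i0) //= big1 ?addr0 // => i /andP[Pi ni].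
by apply: contraNeq ni => /(h _ Pi)/eqP.
Qed.

(* Both sides are the coefficient of mu in the triple product
   (A la C)(C mu D0)(D0 mu D); by monotonicity only mu contributes. *)
Theorem kh_indep A C D D0 la mu :
  matching A -> matching C -> matching D -> matching D0 ->
  co_oriented A C la -> oriented A mu -> oriented C mu -> oriented D mu -> oriented D0 mu ->
  (forall i : 'I_N, (i < par D0 i)%N -> mu i = false) ->
  kh A C D la mu mu = kh A C D0 la mu mu.
Proof.
move=> mA mC mD mD0 oL muA muC muD muD0 mu0.
have oA0 := co_oriented_mk muA muD0; have oCD := co_oriented_mk muC muD; have oC0 := co_oriented_mk muC muD0.
have o0D := co_oriented_mk muD0 muD; have oAD := co_oriented_mk muA muD.
have d1 := kh_diag mA mD0 mD F muA muD0 muD mu0.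
have d2 := kh_diag mC mD0 mD F muC muD0 muD mu0.
have s1 : \sum_(k | co_oriented A D0 k) kh A C D0 la mu k * kh A D0 D k mu mu = kh A C D0 la mu mu * kh A D0 D mu mu mu.
  apply: sum_only oA0 _ => k ok; rewrite mulf_eq0 negb_or => /andP[k1 k2].
  have h1 := kh_mono mA mC mD0 oL oC0 ok k1; have h2 := kh_mono mA mD0 mD ok o0D oAD k2.
  by apply: height_anti => t; [case: (h2 t)|case: (h1 t)].
have s2 : \sum_(k | co_oriented C D k) kh C D0 D mu mu k * kh A C D la k mu = kh C D0 D mu mu mu * kh A C D la mu mu.
  apply: sum_only oCD _ => k ok; rewrite mulf_eq0 negb_or => /andP[k1 k2].
  have h1 := kh_mono mC mD0 mD oC0 o0D ok k1; have h2 := kh_mono mA mC mD oL ok oAD k2.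
  by apply: height_anti => t; [case: (h2 t)|case: (h1 t)].
have := etrans (esym s2) (etrans (esym (kh_assoc F la mu mu mu mA mC mD0 mD)) s1).
by rewrite d1 d2 mulr1 mul1r.
Qed.
End Indep.

(** * Weights and their cup diagrams *)

Section Match.
Variable n : nat.
Implicit Types (w : word n) (d : cupd n) (i j k : 'I_n).

Lemma height0 w : height w 0 = 0.
Proof. by rewrite /height big_pred0. Qed.

(* \vee and \wedge as opening and closing parentheses; height decreases at \vee. *)
Definition matched w i j := [&& (i < j)%N, ~~ w i, w j, height w j.+1 == height w i &
  [forall k : 'I_n, (i < k <= j)%N ==> (height w k < height w i)]].

Lemma matchedP w i j : reflect [/\ (i < j)%N, w i = false, w j = true, height w j.+1 = height w i &
    forall k, (i < k <= j)%N -> height w k < height w i] (matched w i j).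
Proof.
apply: (iffP and5P) => [[h1 /negbTE h2 h3 /eqP h4 /forallP h5]|[h1 h2 h3 h4 h5]]; split=> //.
- by move=> k; apply/implyP/h5.
- by rewrite h2.
- exact/eqP.
- by apply/forallP=> k; apply/implyP/h5.
Qed.

(** The mate of a \vee is found at the first return of the height to its value before [r]. *)
Lemma matched_fwd w r t0 : w r = false -> (r < t0 <= n)%N -> height w r <= height w t0 ->
  exists2 j : 'I_n, (j < t0)%N & matched w r j.
Proof.
move=> wr rt h; have ex : exists t, ((r < t <= t0)%N && (height w r <= height w t)).
  by exists t0; rewrite h andbT; case/andP: rt => ->; rewrite leqnn.
case: (ex_minnP ex) => t /andP[/andP[rlt tt0] ht] mint.
case: t rlt tt0 ht mint => // t rlt tt0 ht mint.
have tn : (t < n)%N by lia.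
have := heightS w (Ordinal tn) => /= pt.
have rt' : (r < t)%N.
  rewrite ltn_neqAle; apply/andP; split; last by lia.
  apply/eqP=> E; move: ht; rewrite -E heightS wr /up_sign; lia.
have lt (k : nat) : (r < k <= t)%N -> height w k < height w r.
  move=> /andP[rk kt]; rewrite Order.TotalTheory.ltNge; apply/negP=> hk.
  by have := mint k; rewrite hk rk andbT /=; lia.
have := lt t; rewrite rt' leqnn => /(_ isT) lt1.
have wt : w (Ordinal tn) = true.
  by move: pt; rewrite /up_sign; case: (w _) => // pt; lia.
exists (Ordinal tn); first by rewrite /=; lia.
apply/matchedP; split=> //= [|k kr]; last exact: lt.
by move: pt; rewrite wt /up_sign; lia.
Qed.

(** Dually, the mate of a \wedge is found at the last earlier time when the height was at least its
    value after [r]. *)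
Lemma matched_bwd w r t0 : w r = true -> (t0 <= r)%N -> height w r.+1 <= height w t0 ->
  exists2 i : 'I_n, (t0 <= i)%N & matched w i r.
Proof.
move=> wr rt h; have ex : exists t, ((t0 <= t <= r)%N && (height w r.+1 <= height w t)).
  by exists t0; rewrite h rt leqnn.
have bd t : ((t0 <= t <= r)%N && (height w r.+1 <= height w t)) -> (t <= r)%N by lia.
case: (ex_maxnP ex bd) => t /andP[/andP[t0t transversal] ht] maxt.
have tn : (t < n)%N by have := ltn_ord r; lia.
have := heightS w (Ordinal tn) => /= pt.
have tr' : (t < r)%N.
  rewrite ltn_neqAle transversal andbT; apply/eqP=> E; move: ht; rewrite E heightS wr /up_sign; lia.
have lt (k : nat) : (t < k <= r)%N -> height w k < height w r.+1.
  move=> /andP[tk kr]; rewrite Order.TotalTheory.ltNge; apply/negP=> hk.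
  by have := maxt k; rewrite hk kr; lia.
have := lt t.+1; rewrite leqnn tr' => /(_ isT) lt1.
have wt : w (Ordinal tn) = false.
  by move: pt; rewrite /up_sign; case: (w _) => // pt; lia.
have e : height w r.+1 = height w t by move: pt; rewrite wt /up_sign; lia.
exists (Ordinal tn); first by [].
by apply/matchedP; split=> //= k kr; rewrite -e; apply: lt.
Qed.

Lemma matched_inj w i j j' : matched w i j -> matched w i j' -> j = j'.
Proof.
wlog lt : j j' / (j < j')%N => [gen m m'|].
  by case: (ltngtP j j') => [/gen->|/gen->|/val_inj] //.
move=> /matchedP[ij _ _ e _] /matchedP[_ _ _ _ /(_ (Ordinal (leq_ltn_trans lt (ltn_ord j'))))] /=.
by rewrite e; move=> h; have := h; rewrite ltnS (ltnW ij) lt => /(_ isT); rewrite Order.POrderTheory.ltxx.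
Qed.

Lemma matched_injl w i i' j : matched w i j -> matched w i' j -> i = i'.
Proof.
wlog lt : i i' / (i < i')%N => [gen m m'|].
  by case: (ltngtP i i') => [/gen->|/gen->|/val_inj] //.
move=> /matchedP[ij _ _ e h] /matchedP[i'j _ _ e' _]; have := h i'.
by rewrite lt (ltnW i'j) -e e' Order.POrderTheory.ltxx => /(_ isT).
Qed.

Definition mated w i j := matched w i j || matched w j i.

Lemma matedC w i j : mated w i j = mated w j i.
Proof. exact: orbC. Qed.

Lemma mated_inj w i j j' : mated w i j -> mated w i j' -> j = j'.
Proof.
move=> /orP[m|m] /orP[m'|m']; first exact: matched_inj m m'.
- by case/matchedP: m => _ wi _ _ _; case/matchedP: m' => _ _; rewrite wi.
- by case/matchedP: m => _ _ wi _ _; case/matchedP: m' => _; rewrite wi.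
- exact: matched_injl m m'.
Qed.

Lemma matched_nest w i j k : matched w i j -> (i < k < j)%N -> exists2 l : 'I_n, (i < l < j)%N & mated w k l.
Proof.
move=> /matchedP[ij wi wj e h] /andP[ik kj]; case wk: (w k).
  have kn : (k.+1 < n)%N by have := ltn_ord j; lia.
  have h1 : height w k.+1 < height w i by apply: (h (Ordinal kn)); rewrite /=; lia.
  have [|l il m] := @matched_bwd w k i wk _ (Order.POrderTheory.ltW h1); first exact: ltnW.
  exists l; last by rewrite /mated m orbT.
  have [lk _ _ el _] := matchedP _ _ _ m.
  rewrite (ltn_trans lk kj) andbT ltn_neqAle il andbT; apply/eqP=> E.
  by move: h1; rewrite el -E Order.POrderTheory.ltxx.
have h1 : height w k < height w i by apply: h; lia.
have [||l lj m] := @matched_fwd w k j.+1 wk; first by have := ltn_ord j; lia.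
  by rewrite e Order.POrderTheory.ltW.
exists l; last by rewrite /mated m.
have [kl _ _ el _] := matchedP _ _ _ m; rewrite (ltn_trans ik kl) /= ltn_neqAle -ltnS lj andbT.
by apply/eqP=> /val_inj E; move: h1; rewrite -el E e Order.POrderTheory.ltxx.
Qed.

Lemma matched_nc w i j k l : matched w i j -> matched w k l -> ~ (i < k /\ k < j /\ j < l)%N.
Proof.
move=> m m' [ik [kj jl]]; have [|l' /andP[_ l'j] m2] := matched_nest m (k := k); first by rewrite ik.
have E : l = l' by apply: (mated_inj (w := w) (i := k)) m2; rewrite /mated m'.
by move: jl; rewrite E; lia.
Qed.

(** Parenthesis matching shows that the [pick] in [under] succeeds, so its default value never
    occurs. *)
Definition under0 w : cupd n := [ffun i => [pick j | mated w i j]].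

Lemma under0E w i j : (under0 w i == Some j) = mated w i j.
Proof.
rewrite ffunE; case: pickP => [k mk|nk]; last by rewrite nk.
by apply/eqP/idP=> [[<-] //|mj]; rewrite (mated_inj mk mj).
Qed.

Definition deg0 d w := [&& wf_cup d, oriented d w & degree d w == 0].

Lemma under0P w : deg0 (under0 w) w.
Proof.
have U i j : under0 w i = Some j -> mated w i j by move/eqP; rewrite under0E.
have U' i : under0 w i = None -> forall j, ~~ mated w i j.
  by move=> N j; apply/negP; rewrite -under0E N.
have lt i j : under0 w i = Some j -> (i < j)%N -> matched w i j.
  by move=> /U /orP[//|/matchedP[ji]]; lia.
apply/and3P; split.
- apply/wf_cupP; split=> [i j /U m|i j k l /lt m /lt m' ij kl|i j r /lt m ir rj].
  + split; last by apply/eqP; rewrite under0E matedC.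
    by case/orP: m => /matchedP[h _ _ _ _]; rewrite -(inj_eq val_inj) /=; lia.
  + exact: matched_nc (m ij) (m' kl).
  + have [||l _ m2] := matched_nest (m _) (k := r); [lia|by rewrite ir|].
    by apply/eqP=> /U'/(_ l); rewrite m2.
- apply/andP; split; apply/forallP=> i; apply/forallP=> j; apply/implyP.
    by rewrite under0E => /orP[]/matchedP[_ -> -> _ _].
  case/and3P=> /eqP/U' ni /eqP/U' nj ij; apply/negP=> /andP[/negbTE wi wj].
  (* If the height after [j] has climbed back to that before [i], the \vee at [i] has a mate;
     otherwise the \wedge at [j] has one. *)
  case: (Order.TotalTheory.leP (height w i) (height w j.+1)) => h.
    have [||l _ m] := @matched_fwd w i j.+1 wi; [by have := ltn_ord j; lia|exact: h|].
    by have := ni l; rewrite /mated m.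
  have [||l _ m] := @matched_bwd w j i wj; [lia|exact: Order.POrderTheory.ltW|].
  by have := nj l; rewrite /mated m orbT.
- rewrite /degree cards_eq0; apply/eqP/setP=> i; rewrite !inE; apply/negbTE/andP=> -[/existsP[j /andP[/eqP dj ij]]].
  by case/matchedP: (lt _ _ dj ij) => _ ->.
Qed.

Lemma height_between w t t' : (t <= t')%N -> height w t' = height w t + \sum_(k : 'I_n | (t <= k < t')%N) up_sign (w k).
Proof.
move=> tt'; rewrite /height (bigID (fun i : 'I_n => (i < t)%N)) /=; congr (_ + _); apply: eq_bigl => i; lia.
Qed.

(** Under a cup there are no rays and nothing crosses out, and in degree 0 every left end is \vee.
    So the height stays below its initial value until the cup closes: the diagram has no freedom. *)
Lemma deg0_mt d w i j : deg0 d w -> d i = Some j -> (i < j)%N -> matched w i j.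
Proof.
case/and3P=> /wf_cupP[sy nc ray] /andP[/forallP ori _] deg dij ij.
have left k l : d k = Some l -> (k < l)%N -> w k = false.
  move=> dkl kl; apply: contraTF deg => wk; rewrite /degree cards_eq0; apply/set0Pn; exists k.
  by rewrite inE wk andbT; apply/existsP; exists l; rewrite dkl eqxx.
have flip k l : d k = Some l -> w l = ~~ w k.
  move=> dkl; have /forallP/(_ l) := ori k; rewrite dkl eqxx /=.
  by case: (w k); case: (w l).
have wi := left _ _ dij ij; have wj : w j = true by rewrite (flip _ _ dij) wi.
have inn k : (i < k < j)%N -> exists2 l : 'I_n, d k = Some l & (i < l < j)%N.
  move=> /andP[ik kj]; have := ray i j k dij ik kj; case dk: (d k) => [l|//] _; exists l => //.
  have [nkl dl] := sy _ _ dk.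
  have ni : l != i :> nat by apply: contraTneq kj => /val_inj E; move: dl; rewrite E dij => -[->]; rewrite ltnn.
  have nj : l != j :> nat.
    by apply: contraTneq ik => /val_inj E; move: dl; rewrite E (sy _ _ dij).2 => -[->]; rewrite ltnn.
  case: (ltngtP k l) => [kl|lk|/val_inj E]; last by rewrite E eqxx in nkl.
    by have := nc i j k l dij dk ij kl; lia.
  by have := nc l k i j dl dij lk ij; lia.
pose f k := odflt k (d k).
(* Cups closed before [t] cancel; only those still open at [t] remain, and they contribute their
   left ends. *)
have low t : (i < t <= j)%N -> \sum_(k : 'I_n | (i.+1 <= k < t)%N) up_sign (w k) =
    \sum_(k : 'I_n | (i.+1 <= k < t)%N && (t <= f k)%N) up_sign (w k).
  move=> /andP[it tj]; rewrite (bigID (fun k => (t <= f k)%N)) /= [X in _ + X = _](@sum_invol0 _ f) ?addr0 // => k /andP[kr kf].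
  - have [|l dk lr] := inn k; first by lia.
    by move: kf; rewrite /f dk /= (sy _ _ dk).2 /=; lia.
  - have [|l dk lr] := inn k; first by lia.
    by rewrite /f dk /= (sy _ _ dk).2.
  - have [|l dk lr] := inn k; first by lia.
    by rewrite /f dk /= (flip _ _ dk) /up_sign; case: (w k).
have pi := heightS w i; rewrite wi in pi.
apply/matchedP; split=> // [|k /andP[ik kj]].
  rewrite heightS wj (height_between w (t := i.+1) (t' := j)) // low ?ij ?leqnn // big_pred0 ?pi.
    by rewrite /up_sign; lia.
  move=> k; apply/negbTE/negP=> /andP[kr]; have [|l dk lr] := inn k; first by lia.
  by rewrite /f dk /=; lia.
rewrite (height_between w (t := i.+1) (t' := k)) // low ?ik // pi.
have : \sum_(k0 : 'I_n | (i.+1 <= k0 < k)%N && (k <= f k0)%N) up_sign (w k0) <= 0.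
  apply: sumr_le0 => m /andP[mr mf]; have [|l dm lr] := inn m; first by lia.
  by rewrite (left m l) // ; move: mf; rewrite /f dm /=; lia.
by rewrite /up_sign; lia.
Qed.

Lemma deg0E d w i j : deg0 d w -> (d i == Some j) = mated w i j.
Proof.
move=> h; have /and3P[/wf_cupP[sy nc ray] /andP[_ /forallP ori] _] := h.
have D k l : d k = Some l -> mated w k l.
  move=> dk; case: (ltngtP k l) => [kl|lk|/val_inj E].
  - by rewrite /mated (deg0_mt h dk kl).
  - by rewrite /mated (deg0_mt h (sy _ _ dk).2 lk) orbT.
  - by have [] := sy _ _ dk; rewrite E eqxx.
apply/eqP/idP=> [/D //|m]; case di: (d i) => [k|]; first by rewrite (mated_inj (D _ _ di) m).
case dj: (d j) => [k|].
  have E : k = i by apply: mated_inj (D _ _ dj) _; rewrite matedC.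
  by move: di; rewrite -E (sy _ _ dj).2.
exfalso; case/orP: m => /matchedP[lt w1 w2 _ _].
  by have /forallP/(_ j) := ori i; rewrite di dj lt w1 w2.
by have /forallP/(_ i) := ori j; rewrite di dj lt w1 w2.
Qed.

Lemma underP w : deg0 (under w) w.
Proof. by rewrite /under; case: pickP => [d //|/(_ (under0 w))]; rewrite -/(deg0 _ _) under0P. Qed.

Lemma underE w i j : (under w i == Some j) = mated w i j.
Proof. exact: deg0E (underP w). Qed.

Lemma under_oriented w : oriented (under w) w.
Proof. by case/and3P: (underP w). Qed.
End Match.

(** * Rays *)

Section Rays.
Variable n : nat.
Implicit Types (d : cupd n) (u w : word n).

(** Cups contribute nothing to the total height, so both words have equally many \wedge on rays. On
    rays every \wedge precedes every \vee, which fixes their positions. *)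
Lemma rays_le d u w : wf_cup d -> oriented d u -> oriented d w -> height u n = height w n ->
  forall r, d r = None -> w r -> u r.
Proof.
move=> /wf_cupP[sy _ _] ou ow e r dr wr; apply: contraT => nur.
pose f k := odflt k (d k).
have flip v : oriented d v -> forall k l, d k = Some l -> v l = ~~ v k.
  move=> /andP[/forallP ov _] k l dk; have /forallP/(_ l) := ov k.
  by rewrite dk eqxx /=; case: (v k); case: (v l).
have sumE v : oriented d v -> height v n = \sum_(k | d k == None) up_sign (v k).
  move=> ov; rewrite /height (eq_bigl xpredT); last by move=> k; rewrite ltn_ord.
  rewrite (bigID (fun k => d k == None)) /= [X in _ + X](@sum_invol0 _ f) ?addr0 // => k.
  - by case dk: (d k) => [l|//] _; rewrite /f dk /= (sy _ _ dk).2.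
  - by case dk: (d k) => [l|//] _; rewrite /f dk /= (sy _ _ dk).2.
  - by case dk: (d k) => [l|//] _; rewrite /f dk /= (flip v ov _ _ dk) /up_sign; case: (v k).
have nx v : oriented d v -> forall k l, d k = None -> d l = None -> (k < l)%N -> v l -> v k.
  move=> /andP[_ /forallP ov] k l dk dl kl vl; have /forallP/(_ l) := ov k.
  by rewrite dk dl kl vl /= andbT negbK.
have le k : d k == None -> up_sign (u k) <= up_sign (w k).
  move=> /eqP dk; rewrite /up_sign; case uk: (u k); last by case: (w k).
  suff -> : w k by []. 
  case: (ltngtP k r) => [kr|rk|/val_inj ->] //; first exact: nx kr wr.
  by move: nur; rewrite (nx u ou r k) // uk.
move: e; rewrite !sumE // (bigD1 r) ?dr //= [RHS](bigD1 r) ?dr //= wr (negbTE nur) => e.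
have : \sum_(k | (d k == None) && (k != r)) up_sign (u k) <= \sum_(k | (d k == None) && (k != r)) up_sign (w k).
  by apply: ler_sum => k /andP[dk _]; apply: le.
by move: e; set X := \sum_(_ | _) up_sign (u _); set Y := \sum_(_ | _) up_sign (w _); rewrite /up_sign; lia.
Qed.
End Rays.

(** * Closures of words *)

Section Closure.
Variable n : nat.
Implicit Types (w wa wl : word n) (i j : 'I_n) (x y : 'I_(n + n)).

Definition num_up w : nat := #|[set i | w i]|.

Lemma num_up_le w : (num_up w <= n)%N.
Proof. by rewrite -[X in (_ <= X)%N]card_ord max_card. Qed.

Lemma num_upE w : (num_up w)%:Z = \sum_i (w i)%:Z.
Proof.
rewrite /num_up -sum1_card -natz natr_sum big_mkcond /=; apply: eq_bigr => i _.
by rewrite inE; case: (w i).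
Qed.

Lemma height_le w t : height w t <= (num_up w)%:Z.
Proof.
rewrite num_upE /height big_mkcond; apply: ler_sum => i _.
by rewrite /up_sign; case: ifP => _; case: (w i).
Qed.

Lemma height_total w : height w n = (num_up w)%:Z + (num_up w)%:Z - n%:Z.
Proof.
have -> : n%:Z = \sum_(i < n) 1 by rewrite sumr_const card_ord natz.
rewrite num_upE -big_split -sumrB /= /height.
by apply: eq_big => [i|i _]; rewrite ?ltn_ord // /up_sign; case: (w i).
Qed.

Lemma closure_emb_subproof w i : (num_up w + i < n + n)%N.
Proof. by have := num_up_le w; have := ltn_ord i; lia. Qed.

Definition closure_emb w i : 'I_(n + n) := Ordinal (closure_emb_subproof w i).

Lemma clwE w x : clw w x = if (x < num_up w)%N then false else if (x < num_up w + n)%N then wat w (x - num_up w) else true.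
Proof. by rewrite ffunE. Qed.

Lemma clw_emb w wl i : num_up wl = num_up w -> clw wl (closure_emb w i) = wl i.
Proof.
move=> e; rewrite clwE e /= ltnNge leq_addr /= ltn_add2l ltn_ord addKn /wat insubT //= => h.
by congr (wl _); apply: val_inj.
Qed.

Lemma closure_embP w x : (num_up w <= x < num_up w + n)%N -> exists i, x = closure_emb w i.
Proof.
move=> h; have lt : (x - num_up w < n)%N by lia.
by exists (Ordinal lt); apply: val_inj => /=; lia.
Qed.

Lemma clw_out w wl x : num_up wl = num_up w -> ~~ (num_up w <= x < num_up w + n)%N -> clw wl x = clw w x.
Proof. by move=> e h; rewrite !clwE e; case: ifP => // h1; case: ifP => // h2; lia. Qed.

Lemma heightSn (m : nat) (w : word m) t (lt : (t < m)%N) : height w t.+1 = height w t + up_sign (w (Ordinal lt)).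
Proof. exact: (heightS w (Ordinal lt)). Qed.

Lemma height_clw1 w t : (t <= num_up w)%N -> height (clw w) t = - t%:Z.
Proof.
elim: t => [|t IHt] le; first by rewrite height0.
have lt : (t < n + n)%N by have := num_up_le w; lia.
by rewrite (heightSn _ lt) IHt ?(ltnW le) // clwE /= le /up_sign; lia.
Qed.

Lemma height_clw2 w t : (t <= n)%N -> height (clw w) (num_up w + t) = height w t - (num_up w)%:Z.
Proof.
elim: t => [|t IHt] le; first by rewrite addn0 height_clw1 // height0 sub0r.
have := heightS (clw w) (closure_emb w (Ordinal le)); rewrite /= clw_emb // -addnS IHt ?(ltnW le) // => ->.
by rewrite (heightSn _ le); lia.
Qed.

Lemma height_clw3 w t : (num_up w + n <= t <= n + n)%N -> height (clw w) t = t%:Z - (n + n)%:Z.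
Proof.
elim: t => [|t IHt] h.
  have n0 : n = 0%N by lia.
  by rewrite height0 n0.
have [e|ne] := eqVneq t.+1 (num_up w + n)%N.
  by rewrite e height_clw2 // height_total; lia.
have lt : (t < n + n)%N by lia.
rewrite (heightSn _ lt) IHt; last by lia.
by rewrite clwE /= ifF ?ifF ?/up_sign; lia.
Qed.

Lemma height_clw_le0 w t : (t <= n + n)%N -> height (clw w) t <= 0.
Proof.
move=> le; case: (leqP t (num_up w)) => h1; first by rewrite height_clw1 //; lia.
case: (leqP t (num_up w + n)) => h2; last by rewrite height_clw3; lia.
have -> : t = (num_up w + (t - num_up w))%N by lia.
by rewrite height_clw2; [have := height_le w (t - num_up w)%N|]; lia.
Qed.

Lemma height_clw_end w : height (clw w) (n + n) = 0.
Proof. by rewrite height_clw3 ?subrr //; have := num_up_le w; lia. Qed.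

(** The height of a closure starts and ends at 0 and never exceeds 0, so every parenthesis finds its
    mate. *)
Lemma matching_clw w : matching (under (clw w)).
Proof.
apply/andP; split; first by case/and3P: (underP (clw w)).
apply/forallP=> x; case wx: (clw w x).
  have [||y _ m] := @matched_bwd _ (clw w) x 0 wx; [by []|by rewrite height0 height_clw_le0 ?ltn_ord|].
  by apply/eqP=> N; have := underE (clw w) x y; rewrite N /mated m orbT.
have [||y _ m] := @matched_fwd _ (clw w) x (n + n) wx; first by rewrite ltn_ord leqnn.
  by rewrite height_clw_end height_clw_le0 // ltnW.
by apply/eqP=> N; have := underE (clw w) x y; rewrite N /mated m.
Qed.

Lemma mated_par w x : mated (clw w) x (par (under (clw w)) x).
Proof. by rewrite -underE parE ?eqxx //; apply: matching_clw. Qed.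

Lemma par_left w x : (x < par (under (clw w)) x)%N -> clw w x = false.
Proof. by case/orP: (mated_par w x) => /matchedP[lt wx _ _ _] //; lia. Qed.

Lemma matched_clw w i j : matched (clw w) (closure_emb w i) (closure_emb w j) = matched w i j.
Proof.
rewrite /matched !clw_emb // ltn_add2l -addnS !height_clw2 ?ltn_ord //; last exact: ltnW.
rewrite (inj_eq (addIr _)); do 4 congr (_ && _); apply/forallP/forallP=> h k; apply/implyP=> kr.
  have /implyP := h (closure_emb w k); rewrite /= ltn_add2l leq_add2l => /(_ kr).
  by rewrite height_clw2 ?ltrD2r // ltnW.
have [|k' E] := @closure_embP w k; first by move: kr => /=; have := ltn_ord j; lia.
have /implyP := h k'; move: kr; rewrite E /= ltn_add2l leq_add2l => kr /(_ kr).
by rewrite height_clw2 ?ltrD2r // ltnW.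
Qed.

Lemma mated_clw w i j : mated (clw w) (closure_emb w i) (closure_emb w j) = mated w i j.
Proof. by rewrite /mated !matched_clw. Qed.

Lemma ray_out w i : under w i = None -> ~~ (num_up w <= par (under (clw w)) (closure_emb w i) < num_up w + n)%N.
Proof.
move=> ri; apply/negP=> /closure_embP[j E]; have := mated_par w (closure_emb w i).
by rewrite E mated_clw -underE ri.
Qed.

(** Cups are common to both sides. A ray closes up with an added vertex of fixed label, so on the
    left [wl] must agree with [wa] on rays; on the right [rays_le] forces the same agreement. *)
Lemma oriented_clw wa wl : num_up wl = num_up wa ->
  oriented (under (clw wa)) (clw wl) = oriented (under wa) wl.
Proof.
move=> e; have mW := matching_clw wa; have /(orientedP _ mW) oW := under_oriented (clw wa).
apply/(orientedP _ mW)/idP=> [oL|oL].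
  have agree i : under wa i = None -> wl i = wa i.
    move=> ri; have := oL (closure_emb wa i); have := oW (closure_emb wa i).
    rewrite (clw_out e (ray_out ri)) => ->; rewrite !clw_emb //.
    by case: (wl i); case: (wa i).
  have /andP[_ /forallP oa] := under_oriented wa.
  apply/andP; split; apply/forallP=> i; apply/forallP=> j; apply/implyP.
    rewrite underE -mated_clw -underE parE // => /eqP E.
    by have := oL (closure_emb wa i); rewrite E !clw_emb // => ->; case: (wl i).
  move=> h; have /forallP/(_ j)/implyP/(_ h) := oa i.
  by case/and3P: h => /eqP ri /eqP rj _; rewrite !agree.
have agree i : under wa i = None -> wl i = wa i.
  move=> ri; have /and3P[wf oa _] := underP wa.
  have ep : height wl n = height wa n by rewrite !height_total e.
  by apply/idP/idP; [apply: (rays_le wf oa oL (esym ep))|apply: (rays_le wf oL oa ep)].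
have out x : ~~ (num_up wa <= par (under (clw wa)) x < num_up wa + n)%N -> clw wl x = clw wa x.
  case: (boolP (num_up wa <= x < num_up wa + n)%N) => [/closure_embP[i ->]|h _]; last exact: clw_out.
  move=> h; rewrite !clw_emb //; apply: agree.
  case ri: (under wa i) => [j|//]; case/negP: h.
  have /eqP -> : par (under (clw wa)) (closure_emb wa i) == closure_emb wa j.
    by rewrite -parE // underE mated_clw -underE ri.
  by rewrite /= leq_addr ltn_add2l ltn_ord.
move=> x; set y := par _ x.
case: (boolP (num_up wa <= x < num_up wa + n)%N) => hx; case: (boolP (num_up wa <= y < num_up wa + n)%N) => hy.
- have [i xE] := closure_embP hx; have [j yE] := closure_embP hy.
  have m : under wa i == Some j by rewrite underE -mated_clw -xE -yE; apply: mated_par.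
  rewrite xE yE !clw_emb //; case/andP: oL => /forallP/(_ i)/forallP/(_ j); rewrite m /= => + _.
  by case: (wl i); case: (wl j).
- by rewrite (out x) // (clw_out e hy) oW.
- have hx' : ~~ (num_up wa <= par (under (clw wa)) y < num_up wa + n)%N by rewrite /y parK.
  by rewrite (out y) // (clw_out e hx) oW.
- by rewrite (clw_out e hx) (clw_out e hy) oW.
Qed.

(** In a closure the left ends are exactly the \vee's, so the diagram determines the word; equal
    [num_up] aligns the two embedded copies. *)
Lemma under_clw_inj wa wb : num_up wa = num_up wb -> under (clw wa) = under (clw wb) -> wa = wb.
Proof.
move=> e E; have val w x : clw w x = ~~ (x < par (under (clw w)) x)%N.
  case: ltnP => [/par_left //|le]; have /(orientedP _ (matching_clw w)) oW := under_oriented (clw w).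
  have := oW x; have := par_left (w := w) (x := par (under (clw w)) x).
  rewrite parK ?matching_clw // ltn_neqAle le andbT (inj_eq val_inj) par_neq ?matching_clw // => /(_ isT) ->.
  by case: (clw w x).
by apply/ffunP=> i; rewrite -(clw_emb i (erefl (num_up wa))) -[RHS](clw_emb (w := wa) i (esym e)) !val E.
Qed.

(** On the added vertices a closure already has the least height possible for a word of total height
    0, so a lower word agrees with it there. This makes the weights outside the closure span an
    ideal. *)
Lemma clw_lower wn (k : word (n + n)) : height k (n + n) = 0 ->
  (forall t, height k t <= height (clw wn) t) -> exists2 w, num_up w = num_up wn & k = clw w.
Proof.
move=> k0 le; have lo t : - t%:Z <= height k t.
  elim: t => [|t IHt]; first by rewrite height0.
  case: (ltnP t (n + n)) => [lt|ge].
    by rewrite (heightSn _ lt) /up_sign; case: ifP; lia.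
  rewrite (_ : height k t.+1 = height k t); first by lia.
  by apply: eq_bigl => i; have := ltn_ord i; lia.
have hi t : (t <= n + n)%N -> t%:Z - (n + n)%:Z <= height k t.
  move=> tn; have : forall s, (s <= n + n - t)%N -> height k (t + s) <= height k t + s%:Z.
    elim=> [|s IHs] h; first by rewrite addn0; lia.
    have lt : (t + s < n + n)%N by lia.
    by rewrite addnS (heightSn _ lt) /up_sign; have := IHs (ltnW h); case: ifP; lia.
  by move/(_ (n + n - t)%N (leqnn _)); rewrite subnKC // k0; lia.
have p1 t : (t <= num_up wn)%N -> height k t = - t%:Z.
  by move=> h; have := le t; rewrite height_clw1 //; have := lo t; lia.
have p3 t : (num_up wn + n <= t <= n + n)%N -> height k t = t%:Z - (n + n)%:Z.
  by move=> h; have := le t; rewrite height_clw3 //; have := hi t; lia.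
pose w : word n := [ffun i => k (closure_emb wn i)].
have pw t : (t <= n)%N -> height k (num_up wn + t) = height w t - (num_up wn)%:Z.
  elim: t => [|t IHt] lt; first by rewrite addn0 p1 // height0 sub0r.
  have := heightS k (closure_emb wn (Ordinal lt)); rewrite /= -addnS IHt ?(ltnW lt) // => ->.
  by rewrite (heightSn _ lt) ffunE; lia.
have ew : num_up w = num_up wn.
  have := pw n (leqnn n); rewrite p3 ?height_total; last by have := num_up_le wn; lia.
  by lia.
exists w => //; apply/ffunP=> x.
case: (boolP (num_up wn <= x < num_up wn + n)%N) => hx.
  by have [i ->] := closure_embP hx; rewrite clw_emb // ffunE.
rewrite (clw_out ew hx) clwE; case: ifP => h1.
  by have := heightS k x; rewrite !p1 ?(ltnW h1) // /up_sign; case: (k x) => //; lia.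
rewrite ifF; last by lia.
by have := heightS k x; have := ltn_ord x => hn; rewrite !p3 /up_sign; [case: (k x) => //; lia|lia|lia].
Qed.

Lemma oriented_pre0 (N : nat) (d : cupd N) (k : word N) : matching d -> oriented d k -> height k N = 0.
Proof.
move=> md /(orientedP _ md) ok; rewrite /height (eq_bigl xpredT); last by move=> i; rewrite ltn_ord.
by apply: (@sum_invol0 _ (par d)) => // i _; [rewrite parK|rewrite ok /up_sign; case: (k i)].
Qed.
End Closure.

(** * The Bruhat order on a block *)

Section Block.
Variables (k n : nat) (lam : 'I_k -> weight) (pos : 'I_n -> int).
Variable i0 : 'I_k.
Hypotheses (lam_inj : injective lam)
  (blk : forall mu, (exists i, lam i = mu) <-> wf_weight mu /\ perm_related (lam i0) mu).
Hypothesis pos_mono : forall s t : 'I_n, (s < t)%N -> pos s < pos t.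
Hypothesis supp : forall (i : 'I_k) (x : int), (exists t, pos t = x) <-> (lam i x = Down \/ lam i x = Up).
Implicit Types (a b l m : 'I_k) (w u v : word n) (s t : 'I_n) (y z : weight).
Local Notation wd := (wd lam pos).

Lemma pos_inj : injective pos.
Proof.
move=> s t e; case: (ltngtP s t) => [/pos_mono|/pos_mono|/val_inj//]; by rewrite e ltxx.
Qed.

Lemma pos_lt s t : (pos s < pos t) = (s < t)%N.
Proof.
apply/idP/idP; last exact: pos_mono.
by case: (ltngtP s t) => // [/pos_mono/lt_trans h /h|/val_inj->]; rewrite ltxx.
Qed.

Definition supported y := forall x, (exists t, pos t = x) <-> (y x = Down \/ y x = Up).
Definition weight_word y : word n := [ffun t => isUp (y (pos t))].
Definition posseq := [seq pos t | t <- enum 'I_n].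

Lemma posseq_uniq : uniq posseq.
Proof. by rewrite map_inj_uniq ?enum_uniq //; apply: pos_inj. Qed.

Lemma mem_posseq x : reflect (exists t, pos t = x) (x \in posseq).
Proof.
apply: (iffP mapP) => [[t _ ->]|[t <-]]; first by exists t.
by exists t; rewrite ?mem_enum.
Qed.

Lemma supported_pos y t : supported y -> y (pos t) = if weight_word y t then Up else Down.
Proof. by move=> sy; rewrite ffunE; have [+ _] := sy (pos t); case=> [|->|->] //; exists t. Qed.

Lemma num_up_wdy y : supported y -> num_up (weight_word y) = (n - count (fun x => isDown (y x)) posseq)%N.
Proof.
move=> sy; have -> : count (fun x => isDown (y x)) posseq = #|[set t | ~~ weight_word y t]|.
  rewrite /posseq count_map -sum1_card -sum1_count big_enum_cond /=; apply: eq_bigl => t.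
  by rewrite inE supported_pos //; case: (weight_word y t).
have := cardsC [set t | weight_word y t]; rewrite card_ord /num_up.
rewrite (_ : ~: _ = [set t | ~~ weight_word y t]); last by apply/setP=> t; rewrite !inE.
by move=> e; rewrite -[X in (X - _)%N]e addnK.
Qed.

Lemma count_supported y (s : seq int) : supported y ->
  count (fun x => isDown (y x)) (undup s) = count (fun x => (x \in s) && isDown (y x)) posseq.
Proof.
move=> sy; rewrite -!size_filter; apply/perm_size/uniq_perm; rewrite ?filter_uniq ?undup_uniq ?posseq_uniq //.
move=> x; rewrite !mem_filter mem_undup; case yx: (y x); rewrite ?andbF //=.
by have -> : x \in posseq; [apply/mem_posseq/sy; left|rewrite ?andbT].
Qed.

Lemma perm_related_count y z : supported y -> supported z -> perm_related y z ->
  count (fun x => isDown (y x)) posseq = count (fun x => isDown (z x)) posseq.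
Proof.
move=> sy sz [_ [_ [s [out]]]]; rewrite !count_supported // => e.
have split c : count c posseq = (count (fun x => (x \in s) && c x) posseq + count (fun x => (x \notin s) && c x) posseq)%N.
  elim: posseq => //= x q ->; case: (x \in s); case: (c x) => /=; lia.
rewrite split e [RHS]split; congr (_ + _)%N; apply: eq_count => x /=.
by case: (boolP (x \in s)) => //= /out ->.
Qed.

Lemma block_perm a : perm_related (lam i0) (lam a).
Proof. by have /blk[] : exists i, lam i = lam a by exists a. Qed.

Lemma block_nup a : num_up (wd a) = num_up (wd i0).
Proof.
rewrite -/(weight_word (lam a)) -/(weight_word (lam i0)) !num_up_wdy; try exact: supp.
by rewrite (perm_related_count (supp i0) (supp a) (block_perm a)).
Qed.

Definition word_weight w : weight := fun x => if [pick t | pos t == x] is Some t then (if w t then Up else Down) else lam i0 x.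

Lemma word_weight_pos w t : word_weight w (pos t) = if w t then Up else Down.
Proof. by rewrite /word_weight; case: pickP => [t' /eqP/pos_inj->|/(_ t)] //; rewrite eqxx. Qed.

Lemma word_weight_out w x : ~ (exists t, pos t = x) -> word_weight w x = lam i0 x.
Proof. by rewrite /word_weight; case: pickP => // t /eqP e; case; exists t. Qed.

Lemma word_weight_supported w : supported (word_weight w).
Proof.
move=> x; split=> [[t <-]|]; first by rewrite word_weight_pos; case: (w t); auto.
case: (boolP (x \in posseq)) => [/mem_posseq//|/mem_posseq nx].
by rewrite word_weight_out // => /supp.
Qed.

Lemma weight_word_W w : weight_word (word_weight w) = w.
Proof. by apply/ffunP=> t; rewrite ffunE word_weight_pos; case: (w t). Qed.

Lemma word_weight_wd a : word_weight (wd a) = lam a.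
Proof.
apply: functional_extensionality => x; case: (boolP (x \in posseq)) => [/mem_posseq[t <-]|/mem_posseq nx].
  by rewrite word_weight_pos -[wd a]/(weight_word (lam a)) -supported_pos //; exact: supp.
rewrite word_weight_out //.
have na c : ~ (lam c x = Down \/ lam c x = Up) by move=> /supp.
have [c2 [x2 _]] := block_perm a.
move: (c2 x) (x2 x) (na i0) (na a).
by case: (lam i0 x); case: (lam a x); intuition congruence.
Qed.

Lemma wd_inj : injective wd.
Proof. by move=> a b e; apply: lam_inj; rewrite -(word_weight_wd a) e word_weight_wd. Qed.

Lemma word_weight_perm w : num_up w = num_up (wd i0) -> perm_related (lam i0) (word_weight w).
Proof.
move=> e.
have out x : x \in posseq -> (lam i0 x = Down \/ lam i0 x = Up) /\ (word_weight w x = Down \/ word_weight w x = Up).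
  by move/mem_posseq => ex; split; [apply/supp|apply/word_weight_supported].
split; [|split] => [x|x|].
- by case: (boolP (x \in posseq)) => [/out[[]-> []->] //|/mem_posseq nx]; rewrite word_weight_out.
- by case: (boolP (x \in posseq)) => [/out[[]-> []->] //|/mem_posseq nx]; rewrite word_weight_out.
exists posseq; split=> [x /mem_posseq nx|]; first by rewrite word_weight_out.
rewrite undup_id ?posseq_uniq //.
have := num_up_wdy (word_weight_supported w); have := num_up_wdy (supp i0); rewrite weight_word_W e -/(weight_word (lam i0)) => ->.
have bd y : (count (fun x => isDown (y x)) posseq <= n)%N.
  by apply: leq_trans (count_size _ _) _; rewrite size_map size_enum_ord.
by have := bd (word_weight w); have := bd (lam i0); lia.
Qed.

Lemma wd_surj w : num_up w = num_up (wd i0) -> exists a, wd a = w.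
Proof.
move=> e; suff [a ea] : exists i, lam i = word_weight w by exists a; rewrite -(weight_word_W w) -ea.
apply/blk; split; last exact: word_weight_perm.
(* Beyond the largest [|pos t|] there is no \vee or \wedge, so the condition at infinity is
   vacuous. *)
exists (\max_t absz (pos t)) => i j _ _ jN [_ jU]; have [_] := word_weight_supported w j.
case; first by right.
by move=> t ejt; move: jN; rewrite -ejt ltnNge leq_bigmax.
Qed.

Lemma height_swap u v (s1 s2 : 'I_n) : u s1 = false -> u s2 = true ->
  (forall t, v t = if t == s1 then true else if t == s2 then false else u t) ->
  forall t : nat, height v t = height u t + (if (s1 < t)%N then 2 else 0) - (if (s2 < t)%N then 2 else 0).
Proof.
move=> u1 u2 vE; elim=> [|t IHt]; first by rewrite !height0.
case: (ltnP t n) => [lt|ge].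
  rewrite !(heightSn _ lt) IHt vE; set x := Ordinal lt.
  have e1 : (s1 < t.+1)%N = (x == s1) || (s1 < t)%N by rewrite ltnS leq_eqVlt eq_sym.
  have e2 : (s2 < t.+1)%N = (x == s2) || (s2 < t)%N by rewrite ltnS leq_eqVlt eq_sym.
  rewrite e1 e2; case: eqVneq => [E1|n1]; case: eqVneq => [E2|n2] /=.
  - by move: u1; rewrite -E1 E2 u2.
  - by rewrite E1 u1 -E1 /= ltnn /up_sign; case: ifP; lia.
  - by rewrite E2 u2 -E2 /= ltnn /up_sign; case: ifP; lia.
  - by case: ifP; case: ifP; lia.
have big (z : word n) : height z t.+1 = height z t by apply: eq_bigl => i; have := ltn_ord i; lia.
rewrite !big IHt; have l1 := ltn_ord s1; have l2 := ltn_ord s2.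
by rewrite !(leq_trans l1) ?(leq_trans l2) // leqW.
Qed.

Lemma bruhat_supported y z : bruhat_le y z -> supported y ->
  supported z /\ forall t : nat, height (weight_word y) t <= height (weight_word z) t.
Proof.
elim=> {y z} [y z [i [j [ij [yi [yj zE]]]]] sy|y sy|y z z' _ IH1 _ IH2 sy] //; last first.
  by have [sz h1] := IH1 sy; have [sz' h2] := IH2 sz; split=> // t; apply: le_trans (h1 t) (h2 t).
have [s1 e1] : exists t, pos t = i by apply/sy; left.
have [s2 e2] : exists t, pos t = j by apply/sy; right.
split.
  move=> x; rewrite zE; case: eqP => [->|_]; first by split=> _; [right|exists s1].
  by case: eqP => [->|_]; [split=> _; [left|exists s2]|exact: sy].
move=> t; rewrite (@height_swap (weight_word y) (weight_word z) s1 s2).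
- have : (s1 < s2)%N by rewrite -pos_lt e1 e2.
  by case: ifP; case: ifP; lia.
- by rewrite ffunE e1 yi.
- by rewrite ffunE e2 yj.
- move=> x; rewrite !ffunE zE -e1 -e2 !(inj_eq pos_inj).
  by case: ifP => // _; case: ifP.
Qed.

Lemma bruhat_pre a b : bruhat_idx lam a b -> forall t : nat, height (wd a) t <= height (wd b) t.
Proof. by move=> /bruhat_supported/(_ (supp a))[]. Qed.

Lemma height_dec (z : word n) (t s : nat) : (t + s <= n)%N -> height z t - s%:Z <= height z (t + s).
Proof.
elim: s => [|s IHs] h; first by rewrite addn0; lia.
have lt : (t + s < n)%N by lia.
by rewrite addnS (heightSn _ lt); have := IHs (ltnW lt); rewrite /up_sign; case: ifP; lia.
Qed.

Lemma height_run (z : word n) (t s : nat) : (t + s <= n)%N -> (forall i : 'I_n, (t <= i < t + s)%N -> z i = false) ->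
  height z (t + s) = height z t - s%:Z.
Proof.
elim: s => [|s IHs] h zf; first by rewrite addn0; lia.
have lt : (t + s < n)%N by lia.
rewrite addnS (heightSn _ lt) IHs ?(ltnW lt) // => [|i ir]; last by apply: zf; lia.
by rewrite zf /up_sign /=; lia.
Qed.

(** A single exchange at the first disagreement moves [u] towards [v] and keeps it below [v]. *)
Lemma height_bruhat_W u v : height u n = height v n -> (forall t : nat, height u t <= height v t) -> bruhat_le (word_weight u) (word_weight v).
Proof.
(* The induction is on the length [m] of the final segment on which the words may differ. *)
suff gen (m : nat) : forall u, (forall i : 'I_n, (i + m < n)%N -> u i = v i) -> height u n = height v n ->
    (forall t : nat, height u t <= height v t) -> bruhat_le (word_weight u) (word_weight v).
  by move=> e le; apply: (gen n u _ e le) => i; lia.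
elim: m {u} => [|m IHm] u agree tot le.
  have -> : u = v by apply/ffunP=> i; apply: agree; rewrite addn0.
  exact: rt_refl.
case: (ltnP m n) => [mn|nm]; last by apply: IHm => // i; lia.
have xn : (n - m.+1 < n)%N by lia.
pose x := Ordinal xn.
have pe : height u x = height v x by apply: eq_bigr => i ix; rewrite agree //; move: ix => /=; lia.
have [e|ne] := eqVneq (u x) (v x).
  apply: IHm => // i im; case: (ltnP (i + m.+1) n) => [/agree //|h].
  by have -> : i = x by apply: val_inj => /=; lia.
have := le x.+1; rewrite !heightS pe lerD2l; case ux: (u x); case vx: (v x) => //; try by rewrite ux vx in ne.
move=> _.
have uv : height u x.+1 + 2 <= height v x.+1 by rewrite !heightS pe ux vx /up_sign; lia.
(* The \vee of [u] at [x] is exchanged with the next \wedge. If there were none, [u] would descend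
   steadily to the end, while [v] starts two higher and cannot descend faster, against equal
   totals. *)
case: (pickP (fun y : 'I_n => (x < y)%N && u y)) => [y1 y1P|none]; last first.
  have r := @height_run u x.+1 m; have d := @height_dec v x.+1 m.
  have E : (x.+1 + m = n)%N by rewrite /=; lia.
  rewrite E leqnn in r d; have := d isT; rewrite -tot r // => [|i /andP[xi _]]; first by lia.
  by have := none i; rewrite xi.
case: (@arg_minnP _ y1 (fun y : 'I_n => (x < y)%N && u y) (fun y : 'I_n => y : nat) y1P) => y /andP[xy uy] ymin.
pose u' : word n := [ffun t => if t == x then true else if t == y then false else u t].
have sw := @height_swap u u' x y ux uy (fun t => ffunE _ t).
have low (i : 'I_n) : (x < i < y)%N -> u i = false.
  by move=> /andP[xi iy]; apply/negP=> ui; have := ymin i; rewrite xi ui => /(_ isT); lia.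
apply: (rt_trans _ _ _ (word_weight u')).
  apply: rt_step; exists (pos x), (pos y); split; first by rewrite pos_lt.
  split; first by rewrite word_weight_pos ux.
  split; first by rewrite word_weight_pos uy.
  apply: functional_extensionality => z; case: (boolP (z \in posseq)) => [/mem_posseq[t <-]|/mem_posseq nz].
    by rewrite !(inj_eq pos_inj) !word_weight_pos ffunE; case: eqP => // _; case: eqP.
  by rewrite !word_weight_out // !ifF //; apply/eqP=> e; apply: nz; [exists y|exists x].
apply: IHm.
- move=> i im; rewrite ffunE; case: eqP => [->|/eqP nx]; first by rewrite vx.
  have ix : (i < x)%N by move: nx; rewrite -(inj_eq val_inj) /=; lia.
  rewrite ifF ?agree //; last by apply/eqP=> e; move: ix xy; rewrite e; lia.
  by move: ix => /=; lia.
- by rewrite sw !ltn_ord tot; lia.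
move=> t; rewrite sw; have := le t; case: ifP => xt; case: ifP => yt; try lia.
  (* Only here does the exchange raise the height, by two: [u] descends steadily from [x], and [v]
     starts at least two above it. *)
  have [s ts] : exists s : nat, t = (x.+1 + s)%N by exists (t - x.+1)%N; lia.
  have sn : (x.+1 + s <= n)%N by have := ltn_ord y; lia.
  have d := height_dec v sn; have r : height u (x.+1 + s) = height u x.+1 - s%:Z.
    by apply: height_run => // i /andP[h1 h2]; apply: low; lia.
  by rewrite ts r => _; lia.
Qed.

Lemma bruhatP a b : bruhat_idx lam a b <-> forall t : nat, height (wd a) t <= height (wd b) t.
Proof.
split; first exact: bruhat_pre.
move=> h; rewrite /bruhat_idx -(word_weight_wd a) -(word_weight_wd b); apply: height_bruhat_W => //.
by rewrite !height_total (block_nup a) (block_nup b).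
Qed.

Lemma bruhat_anti a b : bruhat_idx lam a b -> bruhat_idx lam b a -> a = b.
Proof. by move=> /bruhatP h1 /bruhatP h2; apply/wd_inj/height_anti. Qed.
End Block.

(** * The cell datum *)

Lemma sum_at (F : fieldType) (I : finType) (f : I -> F) (i0 : I) :
  (forall i, i != i0 -> f i = 0) -> \sum_i f i = f i0.
Proof. by move=> h; rewrite (bigD1 i0) //= big1 ?addr0 // => i /h. Qed.

Section Assembly.
Variables (F : fieldType) (k n : nat) (lam : 'I_k -> weight) (pos : 'I_n -> int).
Local Notation Bas := (Bas lam pos).
Local Notation Halg := (Halg F lam pos).
Local Notation inH := (inH lam pos).
Local Notation Hmul := (@Hmul F k n lam pos).
Local Notation Hone := (@Hone F k n lam pos).
Local Notation Hstar := (@Hstar F k n lam pos).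
Local Notation Cel := (@Cel F k n lam pos).
Local Notation Mset := (@Mset k n lam pos).
Local Notation circb := (circb lam pos).
Implicit Types (a b c d e l m r nu kap : 'I_k) (x y z : Halg) (s u : Bas).

(** [K a b d l m nu] stands for the coefficient of (a nu d) in (a l b)(b m d). The algebra axioms
    are derived from the hypotheses on these structure constants, without reference to circles. *)
Variable K : 'I_k -> 'I_k -> 'I_k -> 'I_k -> 'I_k -> 'I_k -> F.
Hypothesis bmulE : forall (s t u : Bas), bmul F s t u =
  if [&& (val s).2 == (val t).1.1, (val u).1.1 == (val s).1.1 & (val u).2 == (val t).2]
  then K (val s).1.1 (val s).2 (val t).2 (val s).1.2 (val t).1.2 (val u).1.2 else 0.
Hypothesis Kassoc : forall a b c e l m r nu, inH (a, l, b) -> inH (b, m, c) -> inH (c, r, e) -> inH (a, nu, e) ->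
  \sum_(kap | inH (b, kap, e)) K b c e m r kap * K a b e l kap nu =
  \sum_(kap | inH (a, kap, c)) K a b c l m kap * K a c e kap r nu.
Hypothesis Kflip : forall a b c l m nu, K a b c l m nu = K c b a m l nu.
Hypothesis Kunit : forall a d m nu, inH (a, m, d) -> inH (a, nu, d) -> K a a d a m nu = (m == nu)%:R.
Variable le : 'I_k -> 'I_k -> Prop.
Hypothesis Kmono : forall a b d l m nu, inH (a, l, b) -> inH (b, m, d) -> inH (a, nu, d) ->
  K a b d l m nu != 0 -> le m nu.
Hypothesis Kind : forall a b d l m, inH (a, l, b) -> inH (b, m, d) -> inH (a, m, d) ->
  K a b d l m m = K a b m l m m.
Hypothesis subw_refl : forall a, subw lam pos a a.

(** Extended by zero outside the basis, so that sums run over all triples of indices. *)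
Definition coef x a l b : F := oapp (fun s => x s : F) 0 (insub (a, l, b) : option Bas).

Lemma coef_val x s : coef x (val s).1.1 (val s).1.2 (val s).2 = x s.
Proof. by rewrite /coef -!surjective_pairing valK. Qed.

Lemma coef_out x a l b : ~~ inH (a, l, b) -> coef x a l b = 0.
Proof. by move=> h; rewrite /coef insubN. Qed.

Lemma coef_in x a l b (h : inH (a, l, b)) : coef x a l b = x (Sub (a, l, b) h).
Proof. by rewrite /coef insubT. Qed.

Lemma coef_ext x y : (forall a l b, inH (a, l, b) -> coef x a l b = coef y a l b) -> x = y.
Proof.
move=> h; apply/ffunP=> s; rewrite -!coef_val; apply: h.
by rewrite -!surjective_pairing; apply: valP.
Qed.

Lemma sum_Bas (G : 'I_k * 'I_k * 'I_k -> F) : \sum_(s : Bas) G (val s) = \sum_(t | inH t) G t.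
Proof.
rewrite [RHS](reindex_omap (val : Bas -> _) insub) /=; last by move=> i Pi; rewrite insubT.
by apply: eq_bigl => s; rewrite (valP s) valK eqxx.
Qed.

Lemma sum_ev x (G : 'I_k -> 'I_k -> 'I_k -> F) :
  \sum_(s : Bas) x s * G (val s).1.1 (val s).1.2 (val s).2 = \sum_a \sum_l \sum_b coef x a l b * G a l b.
Proof.
rewrite pair_bigA pair_bigA /=.
rewrite (eq_bigr (fun s => coef x (val s).1.1 (val s).1.2 (val s).2 * G (val s).1.1 (val s).1.2 (val s).2)); last first.
  by move=> s _; rewrite coef_val.
rewrite (sum_Bas (fun t => coef x t.1.1 t.1.2 t.2 * G t.1.1 t.1.2 t.2)) big_mkcond.
by apply: eq_bigr => -[[a l] b] _ /=; case: ifPn => // h; rewrite coef_out ?mul0r.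
Qed.

Lemma HmulE x y a nu d : inH (a, nu, d) ->
  coef (Hmul x y) a nu d = \sum_b \sum_l \sum_m coef x a l b * coef y b m d * K a b d l m nu.
Proof.
move=> h; rewrite (coef_in _ h) /Defs.Hmul sum_ffunE.
pose G a' l b := \sum_c \sum_m \sum_d' coef y c m d' *
  (if [&& b == c, a == a' & d == d'] then K a' b d' l m nu else 0).
rewrite (eq_bigr (fun s => x s * G (val s).1.1 (val s).1.2 (val s).2)); last first.
  move=> s _; rewrite sum_ffunE /G -(sum_ev y (fun c m d' => if [&& (val s).2 == c, a == (val s).1.1 & d == d'] then _ else 0)).
  rewrite mulr_sumr; apply: eq_bigr => t _; rewrite ffunE bmulE /= mulrA; exact: erefl.
rewrite sum_ev (sum_at (i0 := a)) => [|a' na]; last first.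
  rewrite big1 // => l _; rewrite big1 // => b _; rewrite /G big1 ?mulr0 // => c _.
  by rewrite big1 // => m _; rewrite big1 // => d' _; rewrite (eq_sym a) (negbTE na) andbF mulr0.
rewrite exchange_big; apply: eq_bigr => b _; apply: eq_bigr => l _.
rewrite /G (sum_at (i0 := b)) => [|c nc]; last first.
  by rewrite big1 // => m _; rewrite big1 // => d' _; rewrite (eq_sym b) (negbTE nc) mulr0.
rewrite mulr_sumr; apply: eq_bigr => m _; rewrite (sum_at (i0 := d)) => [|d' nd]; last first.
  by rewrite (eq_sym d) (negbTE nd) !andbF mulr0.
by rewrite !eqxx mulrA.
Qed.

Lemma coefD (al : F) x y a l b : coef (al *: x + y) a l b = al * coef x a l b + coef y a l b.
Proof. by rewrite /coef; case: insub => [s|] /=; rewrite ?mulr0 ?addr0 // !ffunE. Qed.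

Lemma Hmul_linl (al : F) x y z : Hmul (al *: x + y) z = al *: Hmul x z + Hmul y z.
Proof.
apply: coef_ext => a nu d h; rewrite coefD !HmulE // mulr_sumr -big_split; apply: eq_bigr => b _.
rewrite mulr_sumr -big_split; apply: eq_bigr => l _; rewrite mulr_sumr -big_split; apply: eq_bigr => m _.
by rewrite coefD !mulrDl !mulrA.
Qed.

Lemma Hmul_linr (al : F) x y z : Hmul x (al *: y + z) = al *: Hmul x y + Hmul x z.
Proof.
apply: coef_ext => a nu d h; rewrite coefD !HmulE // mulr_sumr -big_split; apply: eq_bigr => b _.
rewrite mulr_sumr -big_split; apply: eq_bigr => l _; rewrite mulr_sumr -big_split; apply: eq_bigr => m _.
by rewrite coefD mulrDr mulrDl !mulrA [al * _]mulrC.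
Qed.

Lemma Hmul_assoc x y z : Hmul x (Hmul y z) = Hmul (Hmul x y) z.
Proof.
apply: coef_ext => a nu e h; rewrite !HmulE //.
pose T b l c m r := coef x a l b * coef y b m c * coef z c r e.
transitivity (\sum_b \sum_l \sum_c \sum_m \sum_r T b l c m r *
   \sum_(kap | inH (b, kap, e)) K b c e m r kap * K a b e l kap nu).
  apply: eq_bigr => b _; apply: eq_bigr => l _.
  transitivity (\sum_(kap | inH (b, kap, e)) \sum_c \sum_m \sum_r T b l c m r * (K b c e m r kap * K a b e l kap nu)).
    rewrite [RHS]big_mkcond; apply: eq_bigr => kap _; case: ifPn => hk; last by rewrite (coef_out _ hk) mulr0 mul0r.
    rewrite HmulE // mulr_sumr mulr_suml; apply: eq_bigr => c _.
    rewrite mulr_sumr mulr_suml; apply: eq_bigr => m _; rewrite mulr_sumr mulr_suml; apply: eq_bigr => r _.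
    by rewrite /T !mulrA.
  rewrite exchange_big; apply: eq_bigr => c _; rewrite exchange_big; apply: eq_bigr => m _.
  by rewrite exchange_big; apply: eq_bigr => r _; rewrite mulr_sumr.
transitivity (\sum_b \sum_l \sum_c \sum_m \sum_r T b l c m r *
   \sum_(kap | inH (a, kap, c)) K a b c l m kap * K a c e kap r nu).
  apply: eq_bigr => b _; apply: eq_bigr => l _; apply: eq_bigr => c _; apply: eq_bigr => m _; apply: eq_bigr => r _.
  rewrite /T; case: (boolP (inH (a, l, b))) => h1; last by rewrite (coef_out _ h1) !mul0r.
  case: (boolP (inH (b, m, c))) => h2; last by rewrite (coef_out _ h2) mulr0 !mul0r.
  case: (boolP (inH (c, r, e))) => h3; last by rewrite (coef_out _ h3) mulr0 !mul0r.
  by rewrite Kassoc.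
transitivity (\sum_c \sum_r \sum_b \sum_l \sum_m T b l c m r *
   \sum_(kap | inH (a, kap, c)) K a b c l m kap * K a c e kap r nu).
  under eq_bigr => b _ do rewrite exchange_big.
  rewrite exchange_big; apply: eq_bigr => c _.
  under eq_bigr => b _ do under eq_bigr => l _ do rewrite exchange_big.
  under eq_bigr => b _ do rewrite exchange_big.
  by rewrite exchange_big.
apply: eq_bigr => c _; rewrite [RHS]exchange_big; apply: eq_bigr => r _.
rewrite [RHS](eq_bigr (fun kap => if inH (a, kap, c) then
   \sum_b \sum_l \sum_m T b l c m r * (K a b c l m kap * K a c e kap r nu) else 0)); last first.
  move=> kap _; case: ifPn => hk; last by rewrite (coef_out _ hk) !mul0r.
  rewrite HmulE // !mulr_suml; apply: eq_bigr => b _; rewrite !mulr_suml; apply: eq_bigr => l _.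
  rewrite !mulr_suml; apply: eq_bigr => m _; rewrite /T -!mulrA; congr (_ * (_ * _)).
  by rewrite mulrCA.
rewrite -big_mkcond [RHS]exchange_big; apply: eq_bigr => b _; rewrite [RHS]exchange_big; apply: eq_bigr => l _.
by rewrite [RHS]exchange_big; apply: eq_bigr => m _; rewrite mulr_sumr.
Qed.

Lemma inHE a l b : inH (a, l, b) = [&& circb a, circb b, subw lam pos a l & subw lam pos b l].
Proof. by []. Qed.

Lemma inH_sym a l b : inH (a, l, b) = inH (b, l, a).
Proof. by rewrite !inHE; case: (circb a); case: (circb b) => //=; rewrite andbC. Qed.

Lemma coef_one a l b : inH (a, l, b) -> coef Hone a l b = ((a == l) && (l == b))%:R.
Proof. by move=> h; rewrite (coef_in _ h) ffunE. Qed.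

Lemma inH_refl a : circb a -> inH (a, a, a).
Proof. by move=> h; rewrite inHE h subw_refl. Qed.

Lemma Hmul_1l x : Hmul Hone x = x.
Proof.
apply: coef_ext => a nu d h; have ca : circb a by case/and4P: h.
have one0 l b : (l != a) || (b != a) -> coef Hone a l b = 0.
  case: (boolP (inH (a, l, b))) => [h1|/coef_out-> //]; rewrite coef_one //.
  by rewrite (eq_sym a l); case: (eqVneq l a) => [->|_] //=; rewrite eq_sym => /negbTE->.
rewrite HmulE // (sum_at (i0 := a)) => [|b nb]; last first.
  by rewrite big1 // => l _; rewrite big1 // => m _; rewrite one0 ?nb ?orbT // !mul0r.
rewrite (sum_at (i0 := a)) => [|l nl]; last by rewrite big1 // => m _; rewrite one0 ?nl // !mul0r.
rewrite coef_one ?inH_refl // eqxx (sum_at (i0 := nu)) => [|m nm].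
  by rewrite Kunit // eqxx mul1r mulr1.
case: (boolP (inH (a, m, d))) => hm; last by rewrite (coef_out _ hm) mulr0 mul0r.
by rewrite Kunit // (negbTE nm) mulr0.
Qed.

Lemma coef_star x a l b : coef (Hstar x) a l b = coef x b l a.
Proof.
case: (boolP (inH (a, l, b))) => h; last by rewrite !coef_out // inH_sym.
have h' : inH (b, l, a) by rewrite inH_sym.
rewrite (coef_in _ h) (coef_in _ h') ffunE; congr (x _); apply: val_inj.
by rewrite /swapB /= val_insubd h'.
Qed.

Lemma Hstar_lin (al : F) x y : Hstar (al *: x + y) = al *: Hstar x + Hstar y.
Proof. by apply: coef_ext => a l b _; rewrite coefD !coef_star coefD. Qed.

Lemma HstarK : involutive Hstar.
Proof. by move=> x; apply: coef_ext => a l b _; rewrite !coef_star. Qed.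

Lemma Hstar_mul x y : Hstar (Hmul x y) = Hmul (Hstar y) (Hstar x).
Proof.
apply: coef_ext => a nu d h; have h' : inH (d, nu, a) by rewrite inH_sym.
rewrite coef_star !HmulE //; apply: eq_bigr => b _; rewrite [RHS]exchange_big; apply: eq_bigr => l _.
by apply: eq_bigr => m _; rewrite !coef_star Kflip [coef x _ _ _ * _]mulrC.
Qed.

Lemma Hstar_1 : Hstar Hone = Hone.
Proof.
apply: coef_ext => a l b h; rewrite coef_star !coef_one // 1?inH_sym //.
by rewrite [b == l]eq_sym [l == a]eq_sym andbC.
Qed.

Lemma Hmul_1r x : Hmul x Hone = x.
Proof. by rewrite -[LHS]HstarK Hstar_mul Hstar_1 Hmul_1l HstarK. Qed.

Lemma MsetE l a b : (a \in Mset l) && (b \in Mset l) = inH (a, l, b).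
Proof. by rewrite !inE inHE; case: (circb a); case: (circb b); rewrite ?andbF. Qed.

Lemma coefS (I : finType) (P : pred I) (al : I -> F) (f : I -> Halg) a l b :
  coef (\sum_(i | P i) al i *: f i) a l b = \sum_(i | P i) al i * coef (f i) a l b.
Proof.
rewrite /coef; case: insub => [s|] /=; last by rewrite big1 // => i _; rewrite mulr0.
by rewrite sum_ffunE; apply: eq_bigr => i _; rewrite ffunE.
Qed.

Lemma coef_CelT l g d a nu d' : inH (a, nu, d') ->
  coef (Cel l g d) a nu d' = [&& a == g, nu == l & d' == d]%:R.
Proof. by move=> h; rewrite (coef_in _ h) ffunE /= !xpair_eqE andbA. Qed.

Lemma coef_sum_Cel (c : 'I_k * 'I_k * 'I_k -> F) a nu d : inH (a, nu, d) ->
  coef (\sum_t c t *: Cel t.1.1 t.1.2 t.2) a nu d = c (nu, a, d).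
Proof.
move=> h; rewrite coefS (sum_at (i0 := (nu, a, d))) => [|t nt].
  by rewrite coef_CelT // !eqxx mulr1.
rewrite coef_CelT //; case: eqP => [e1|_]; last by rewrite mulr0.
case: eqP => [e2|_]; last by rewrite mulr0.
case: eqP => [e3|_]; last by rewrite mulr0.
by move: nt; rewrite e1 e2 e3 -!surjective_pairing eqxx.
Qed.

Lemma Cel_inj l a b l' a' b' : inH (a, l, b) -> Cel l a b = Cel l' a' b' -> (l, a, b) = (l', a', b').
Proof.
move=> h e; have := coef_CelT l a b h; rewrite e coef_CelT // !eqxx.
case: eqP => [->|_]; last by move/esym/eqP; rewrite oner_eq0.
case: eqP => [->|_]; last by move/esym/eqP; rewrite oner_eq0.
by case: eqP => [->|_] //; move/esym/eqP; rewrite oner_eq0.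
Qed.

Lemma Cel_expand x : exists! c : {ffun 'I_k * 'I_k * 'I_k -> F},
  (forall t, ~~ ((t.1.2 \in Mset t.1.1) && (t.2 \in Mset t.1.1)) -> c t = 0) /\
  x = \sum_t c t *: Cel t.1.1 t.1.2 t.2.
Proof.
exists [ffun t => coef x t.1.2 t.1.1 t.2]; split.
  split=> [t|]; first by rewrite MsetE ffunE => /coef_out.
  by apply: coef_ext => a nu d h; rewrite coef_sum_Cel // ffunE.
move=> c [c0 xE]; apply/ffunP=> -[[l a] b]; rewrite ffunE /=.
case: (boolP (inH (a, l, b))) => h; first by rewrite xE coef_sum_Cel.
by rewrite coef_out // c0 // MsetE.
Qed.

Lemma Hstar_Cel l a b : inH (a, l, b) -> Hstar (Cel l a b) = Cel l b a.
Proof.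
move=> h; apply: coef_ext => a' nu d' h'; rewrite coef_star !coef_CelT // 1?inH_sym //.
by case: (a' == b); case: (nu == l); rewrite ?andbF ?andbT.
Qed.

Lemma Cel_cell x l g : g \in Mset l ->
  exists r : 'I_k -> F, forall d, d \in Mset l ->
    exists c : 'I_k * 'I_k * 'I_k -> F,
      (forall t, c t <> 0 -> [/\ t.1.2 \in Mset t.1.1, t.2 \in Mset t.1.1, le l t.1.1 & t.1.1 <> l]) /\
      Hmul x (Cel l g d) - \sum_(g' in Mset l) r g' *: Cel l g' d = \sum_t c t *: Cel t.1.1 t.1.2 t.2.
Proof.
(* The right boundary is taken to be the cup diagram of [l] itself, whether or not [l] has maximal
   defect. The scalars thus do not mention [d], and [Kind] compares them with the actual product. *)
move=> gM; exists (fun g' => \sum_kap coef x g' kap g * K g' g l kap l l) => d dM.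
have hgd : inH (g, l, d) by rewrite -MsetE gM dM.
(* The remainder consists of the coefficients of the product at weights other than [l], which lie
   above [l] by [Kmono]. *)
exists (fun t => if [&& t.2 == d, t.1.1 != l & inH (t.1.2, t.1.1, t.2)] then
    \sum_kap coef x t.1.2 kap g * K t.1.2 g d kap l t.1.1 else 0); split.
  move=> [[nu a] d'] /=; case: ifP => // /and3P[/eqP-> nl h] nz.
  have /andP[-> ->] : (a \in Mset nu) && (d \in Mset nu) by rewrite MsetE.
  split=> //; last exact/eqP.
  have [kap] : exists kap, coef x a kap g * K a g d kap l nu != 0.
    apply/existsP; apply: contra_notT nz; rewrite negb_exists => /forallP z.
    by rewrite big1 // => kap _; have := z kap; rewrite negbK => /eqP.
  rewrite mulf_eq0 negb_or => /andP[xn]; apply: Kmono hgd h.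
  by apply: contraR xn => /coef_out ->.
apply: coef_ext => a nu d' h.
have -> (p q : Halg) : coef (p - q) a nu d' = coef p a nu d' - coef q a nu d'.
  by rewrite addrC -scaleN1r coefD mulN1r addrC.
rewrite coef_sum_Cel // coefS HmulE // [\sum_b _](sum_at (i0 := g)) => [|b nb]; last first.
  rewrite big1 // => kap _; rewrite big1 // => m _.
  case: (boolP (inH (b, m, d'))) => hm; last by rewrite (coef_out _ hm) mulr0 mul0r.
  by rewrite coef_CelT // (negbTE nb) mulr0 mul0r.
have mulE : \sum_kap \sum_m coef x a kap g * coef (Cel l g d) g m d' * K a g d' kap m nu =
   if d' == d then \sum_kap coef x a kap g * K a g d kap l nu else 0.
  case: eqP => [->|/eqP nd].
    apply: eq_bigr => kap _; rewrite (sum_at (i0 := l)) => [|m nm].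
      by rewrite coef_CelT // !eqxx mulr1.
    case: (boolP (inH (g, m, d))) => hm; last by rewrite (coef_out _ hm) mulr0 mul0r.
    by rewrite coef_CelT // (negbTE nm) andbF mulr0 mul0r.
  rewrite big1 // => kap _; rewrite big1 // => m _.
  case: (boolP (inH (g, m, d'))) => hm; last by rewrite (coef_out _ hm) mulr0 mul0r.
  by rewrite coef_CelT // (negbTE nd) !andbF mulr0 mul0r.
rewrite mulE h /=.
have rE : \sum_(g' in Mset l) (\sum_kap coef x g' kap g * K g' g l kap l l) * coef (Cel l g' d) a nu d' =
   if (nu == l) && (d' == d) then \sum_kap coef x a kap g * K a g l kap l l else 0.
  rewrite big_mkcond (sum_at (i0 := a)) => [|g' ng]; last first.
    by case: ifP => // _; rewrite coef_CelT // (eq_sym a) (negbTE ng) mulr0.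
  rewrite coef_CelT // eqxx /=; case: eqP => [enl|_] /=; last by rewrite mulr0 if_same.
  case: (d' == d); last by rewrite mulr0 if_same.
  have -> : a \in Mset l by rewrite -enl; have /andP[] : (a \in Mset nu) && (d' \in Mset nu) by rewrite MsetE.
  by rewrite mulr1.
rewrite rE andbT; case: (eqVneq d' d) => [ed|nd]; rewrite ?andbF ?subr0 //= andbT.
case: (eqVneq nu l) => [en|nn]; rewrite ?subr0 //=.
apply/eqP; rewrite subr_eq0; apply/eqP/eq_bigr => kap _; rewrite en.
case: (boolP (inH (a, kap, g))) => hk; last by rewrite (coef_out _ hk) !mul0r.
by rewrite (@Kind a g d) // -en -ed.
Qed.

End Assembly.

(** * Closed diagrams of a block and the cellular structure *)

Section Final.
Variables (F : fieldType) (k n : nat) (lam : 'I_k -> weight) (pos : 'I_n -> int).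
Variable i0 : 'I_k.
Hypotheses (lam_inj : injective lam)
  (blk : forall mu, (exists i, lam i = mu) <-> wf_weight mu /\ perm_related (lam i0) mu).
Hypothesis pos_mono : forall s t : 'I_n, (s < t)%N -> pos s < pos t.
Hypothesis supp : forall (i : 'I_k) (x : int), (exists t, pos t = x) <-> (lam i x = Down \/ lam i x = Up).
Implicit Types (a b c d e l m r nu kap : 'I_k).
Local Notation wd := (wd lam pos).
Local Notation inH := (inH lam pos).

Definition cl a : word (n + n) := clw (wd a).
Definition ucl a : cupd (n + n) := under (cl a).
Definition kh_idx a b c l m nu : F := kh_coef F (ucl a) (ucl b) (ucl c) (cl l) (cl m) (cl nu).

Lemma num_up_eq a b : num_up (wd a) = num_up (wd b).
Proof.
by rewrite (block_nup blk pos_mono supp a) (block_nup blk pos_mono supp b).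
Qed.

Lemma subwE a l : subw lam pos a l = oriented (ucl a) (cl l).
Proof. by rewrite /subw -oriented_clw //; apply: num_up_eq. Qed.

Lemma ucl_inj a b : (ucl a == ucl b) = (a == b).
Proof.
apply/eqP/eqP=> [e|->//].
exact: (wd_inj lam_inj blk pos_mono supp) (under_clw_inj (num_up_eq a b) e).
Qed.

Lemma cl_inj a b : cl a = cl b -> a = b.
Proof. by move=> e; apply/eqP; rewrite -ucl_inj /ucl e. Qed.

Lemma height_cl a b (t : nat) : (t <= n)%N ->
  (height (cl a) (num_up (wd a) + t) <= height (cl b) (num_up (wd a) + t)) = (height (wd a) t <= height (wd b) t).
Proof. by move=> tn; rewrite height_clw2 // {2}(num_up_eq a b) height_clw2 // (num_up_eq a b) lerD2r. Qed.

Lemma height_bruhat a b : (forall t, height (cl a) t <= height (cl b) t) -> bruhat_idx lam a b.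
Proof.
move=> h; apply/(bruhatP blk pos_mono supp) => t.
have big (w : word n) : (n <= t)%N -> height w t = height w n.
  by move=> nt; apply: eq_bigl => i; rewrite ltn_ord (leq_trans (ltn_ord i) nt).
case: (leqP t n) => [tn|/ltnW nt]; first by rewrite -height_cl.
by rewrite !big // -height_cl.
Qed.

Lemma inHP a l b : inH (a, l, b) = [&& circb lam pos a, circb lam pos b & co_oriented (ucl a) (ucl b) (cl l)].
Proof. by rewrite /Defs.inH !subwE. Qed.

Lemma inH_orie a l b : inH (a, l, b) -> co_oriented (ucl a) (ucl b) (cl l).
Proof. by rewrite inHP => /and3P[]. Qed.

(* This is the passage to the quotient by the ideal spanned by the weights outside
   the closure: they contribute nothing to coefficients at weights inside it. *)
Lemma sum_cl a b (f : word (n + n) -> F) : circb lam pos a -> circb lam pos b ->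
  (forall w, co_oriented (ucl a) (ucl b) w -> f w != 0 -> exists kap, cl kap = w) ->
  \sum_(w | co_oriented (ucl a) (ucl b) w) f w = \sum_(kap | inH (a, kap, b)) f (cl kap).
Proof.
move=> ca cb h; rewrite (eq_bigl (fun kap => co_oriented (ucl a) (ucl b) (cl kap))); last first.
  by move=> kap; rewrite inHP ca cb.
pose A := [set kap | co_oriented (ucl a) (ucl b) (cl kap)].
transitivity (\sum_(w in cl @: A) f w); last first.
  rewrite big_imset; last by move=> x y _ _; apply: cl_inj.
  by apply: eq_bigl => kap; rewrite inE.
rewrite (bigID (mem (cl @: A))) /= [X in _ + X]big1 ?addr0 => [|w /andP[ow nw]]; last first.
  apply: contraNeq nw => /(h _ ow)[kap kE]; rewrite -kE; apply: imset_f.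
  by rewrite inE kE.
apply: eq_bigl => w; rewrite andbC; case: (boolP (w \in _)) => // /imsetP[kap].
by rewrite inE => ok ->; rewrite ok.
Qed.

Lemma matching_ucl a : matching (ucl a).
Proof. exact: matching_clw. Qed.

Lemma ucl_left a (x : 'I_(n + n)) : (x < par (ucl a) x)%N -> cl a x = false.
Proof. exact: par_left. Qed.

Lemma kh_idx_assoc a b c e l m r nu : inH (a, l, b) -> inH (b, m, c) -> inH (c, r, e) -> inH (a, nu, e) ->
  \sum_(kap | inH (b, kap, e)) kh_idx b c e m r kap * kh_idx a b e l kap nu =
  \sum_(kap | inH (a, kap, c)) kh_idx a b c l m kap * kh_idx a c e kap r nu.
Proof.
move=> h1 h2 h3 h4.
have o1 := inH_orie h1; have o2 := inH_orie h2; have o3 := inH_orie h3; have o4 := inH_orie h4.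
have [ca cb cc ce] : [/\ circb lam pos a, circb lam pos b, circb lam pos c & circb lam pos e].
  by move: h1 h2 h3; rewrite !inHP => /and3P[-> -> _] /and3P[_ -> _] /and3P[_ -> _].
(* By monotonicity an intermediate weight that contributes lies below the closure of [nu], so it is
   itself the closure of a weight of the block. *)
have low x y w : co_oriented (ucl x) (ucl y) w -> (forall t, height w t <= height (cl nu) t) -> exists kap, cl kap = w.
  move=> /andP[ox _] le; have p0 := oriented_pre0 (matching_ucl x) ox.
  have [w' nw' ->] := clw_lower p0 le.
  have [kap <-] := wd_surj blk pos_mono supp (w := w') (etrans nw' (num_up_eq _ _)).
  by exists kap.
have mat := matching_ucl.
have e1 := sum_cl (f := fun w => kh_coef F (ucl a) (ucl b) (ucl c) (cl l) (cl m) w *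
   kh_coef F (ucl a) (ucl c) (ucl e) w (cl r) (cl nu)) ca cc.
have e2 := sum_cl (f := fun w => kh_coef F (ucl b) (ucl c) (ucl e) (cl m) (cl r) w *
   kh_coef F (ucl a) (ucl b) (ucl e) (cl l) w (cl nu)) cb ce.
apply: etrans (esym (e2 _)) (etrans (esym (kh_assoc F _ _ _ _ (mat a) (mat b) (mat c) (mat e))) (e1 _)) => w ow;
  rewrite mulf_eq0 negb_or => /andP[_ k2].
  apply: (low b e w ow) => t; by case: (kh_mono (mat a) (mat b) (mat e) o1 ow o4 k2 t).
apply: (low a c w ow) => t; by case: (kh_mono (mat a) (mat c) (mat e) ow o3 o4 k2 t).
Qed.

Lemma kh_idx_mono a b d l m nu : inH (a, l, b) -> inH (b, m, d) -> inH (a, nu, d) ->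
  kh_idx a b d l m nu != 0 -> bruhat_idx lam m nu.
Proof.
move=> h1 h2 h3 nz; apply: height_bruhat => t.
by case: (kh_mono (matching_ucl a) (matching_ucl b) (matching_ucl d) (inH_orie h1) (inH_orie h2) (inH_orie h3) nz t).
Qed.

Lemma kh_idx_unit a d m nu : inH (a, m, d) -> inH (a, nu, d) -> kh_idx a a d a m nu = (m == nu)%:R.
Proof.
move=> h1 h2; rewrite /kh_idx kh_unit ?(inH_orie h1) ?(inH_orie h2) //; try exact: matching_ucl.
  by congr (nat_of_bool _)%:R; apply/eqP/eqP=> [/cl_inj|->].
exact: ucl_left.
Qed.

Lemma kh_idx_indep a b d l m : inH (a, l, b) -> inH (b, m, d) -> inH (a, m, d) ->
  kh_idx a b d l m m = kh_idx a b m l m m.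
Proof.
move=> h1 h2 h3; have /andP[o1 o2] := inH_orie h2; have /andP[o3 _] := inH_orie h3.
exact (kh_indep F (matching_ucl a) (matching_ucl b) (matching_ucl d) (matching_ucl m) (inH_orie h1)
  o3 o1 o2 (under_oriented (cl m)) (@ucl_left m)).
Qed.

Lemma kh_idx_flip a b c l m nu : kh_idx a b c l m nu = kh_idx c b a m l nu.
Proof. exact: kh_flip (matching_ucl a) (matching_ucl b) (matching_ucl c). Qed.

Lemma bmul_khl (s t u : Bas lam pos) : bmul F s t u =
  if [&& (val s).2 == (val t).1.1, (val u).1.1 == (val s).1.1 & (val u).2 == (val t).2]
  then kh_idx (val s).1.1 (val s).2 (val t).2 (val s).1.2 (val t).1.2 (val u).1.2 else 0.
Proof.
rewrite /bmul; case: s t u => [[[a l] b] hs] [[[c m] d] ht] [[[a' nu] d'] hu] /=.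
rewrite -!/(cl _) -!/(ucl _) ucl_inj; case: eqP => [<-|_] /=; last by rewrite ffunE.
by rewrite ffunE /=.
Qed.

Lemma subw_refl a : subw lam pos a a.
Proof. exact: under_oriented. Qed.

Lemma bruhat_cellular : is_cellular (@Hmul F k n lam pos) (@Hone F k n lam pos)
    (@bruhat_idx k lam) (@Mset k n lam pos) (@Cel F k n lam pos) (@Hstar F k n lam pos).
Proof.
split; first exact: (Hmul_assoc bmul_khl kh_idx_assoc).
split; first exact: (Hmul_1l bmul_khl kh_idx_unit subw_refl).
split; first exact: (Hmul_1r bmul_khl kh_idx_flip kh_idx_unit subw_refl).
split; first exact: (Hmul_linl bmul_khl).
split; first exact: (Hmul_linr bmul_khl).
split; first by move=> l; apply: rt_refl.
split; first exact: (bruhat_anti lam_inj blk pos_mono supp).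
split; first by move=> l m p; apply: rt_trans.
split.
  by move=> l a b l' a' b' al bl _ _; apply: Cel_inj; rewrite -MsetE al bl.
split; first exact: Cel_expand.
split; first exact: Hstar_lin.
split; first exact: inv_bij (@HstarK _ _ _ _ _).
split; first exact: (Hstar_mul bmul_khl kh_idx_flip).
split; first by move=> l a b al bl; apply: Hstar_Cel; rewrite -MsetE al bl.
exact: (Cel_cell bmul_khl kh_idx_mono kh_idx_indep).
Qed.
End Final.

Theorem theorem6p2 (F : fieldType) (k : nat) (lam : 'I_k -> weight)
    (n : nat) (pos : 'I_n -> int) :
  (* Lambda = {lam i | i < k} is a block, enumerated without repetition *)
  injective lam ->
  is_block (fun mu => exists i, lam i = mu) ->
  (* pos enumerates, increasingly, the vertices labelled \vee or \wedge *)
  (forall s t : 'I_n, (s < t)%N -> (pos s < pos t)%R) ->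
  (forall (i : 'I_k) (x : int), (exists t, pos t = x) <-> (lam i x = Down \/ lam i x = Up)) ->
  is_cellular (@Hmul F k n lam pos) (@Hone F k n lam pos)
    (@bruhat_idx k lam) (@Mset k n lam pos) (@Cel F k n lam pos) (@Hstar F k n lam pos).
Proof.
move=> lam_inj [la0 [wf0 blk]] pos_mono supp.
have [i0 e0] : exists i, lam i = la0 by apply/blk; split=> //; split=> //; split=> //; exists nil.
by apply: (bruhat_cellular _ (i0 := i0)) => //; rewrite e0.
Qed.
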